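(* There is a polynomial-time algorithm which, given an $n$-node undirected planar graph $G$, constructs a radio gossip schedule for $G$ of length $O(OPT\cdot\log^2 n)$, where $OPT$ is the length of an optimal radio gossip schedule for $G$.
   Context: Radio model: communication proceeds in synchronous rounds. In each round, some set of nodes transmit; a transmitting node sends all messages it currently knows to all of its neighbors simultaneously, but a node receives (without interference) in that round only if exactly one of its neighbors transmits in that round. Radio gossip: every node initially holds its own message, and every node's message must be delivered to every other node. A schedule specifies the transmitting set in each round; its length is the number of rounds, and $OPT$ is the minimum length of a schedule that completes gossip. *)

(* Defs.v *)
From HB Require Import structures.
From mathcomp Require Import all_boot all_order all_algebra.
From mathcomp Require Import all_classical all_reals all_analysis.

Set Implicit Arguments.
Unset Strict Implicit.
Unset Printing Implicit Defensive.

Import numFieldNormedType.Exports.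

(** ** Planarity

  A graph is planar if it can be drawn in the plane R^2: distinct points for
  the vertices, simple arcs for the edges, and no intersections other than at
  common endpoints.  [arc u v] is only constrained when [u v] is an edge; it
  runs from [u] to [v], and [arc v u] is the same arc run backwards. *)

Record plane_drawing (R : realType) (V : finType) (e : rel V)
    (pt : V -> R * R) (arc : V -> V -> R -> R * R) : Prop := PlaneDrawing {
  pt_inj : injective pt;
  arc_continuous : forall u v, e u v ->
    {within `[0%R, 1%R], continuous (arc u v)}%classic;
  arc_simple : forall u v, e u v -> {in `[0, 1]%R &, injective (arc u v)};
  arc_source : forall u v, e u v -> arc u v 0%R = pt u;
  arc_target : forall u v, e u v -> arc u v 1%R = pt v;
  arc_sym : forall u v, e u v ->
    {in `[0, 1]%R, forall t : R, arc v u t = arc u v (1 - t)%R};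
  arc_avoids_pt : forall u v w, e u v ->
    {in `]0, 1[%R, forall t, arc u v t <> pt w};
  arc_disjoint : forall u v u' v', e u v -> e u' v' ->
    [set u; v]%SET <> [set u'; v']%SET ->
    {in `]0, 1[%R &, forall s t, arc u v s <> arc u' v' t}
}.

Definition planar (R : realType) (V : finType) (e : rel V) : Prop :=
  exists (pt : V -> R * R) (arc : V -> V -> R -> R * R),
    plane_drawing e pt arc.

(** ** Radio gossip *)

Section Radio.
Variables (V : finType) (e : rel V).

(** A schedule lists the transmitting set of each round. *)
Definition schedule := seq {set V}.

Definition hears (T : {set V}) (u v : V) : bool :=
  [&& u \in T, e u v & #|[set w in T | e w v]%SET| == 1].

(** [K v] is the set of nodes whose message [v] knows.  All transmissions of a
  round carry the knowledge held before that round. *)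
Definition radio_round (K : V -> {set V}) (T : {set V}) : V -> {set V} :=
  fun v => (K v :|: \bigcup_(u | hears T u v) K u)%SET.

Definition knowledge (s : schedule) : V -> {set V} :=
  foldl radio_round (fun v => [set v]%SET) s.

Definition completes_gossip (s : schedule) : Prop :=
  forall u v : V, u \in knowledge s v.

Definition is_optimal_length (k : nat) : Prop :=
  (exists2 s, completes_gossip s & size s = k) /\
  (forall s, completes_gossip s -> k <= size s).

End Radio.

(** ** Random access machine

  Structured programs over a memory of natural-number registers with indirect
  addressing, charged one time unit per assignment and per test.  A program is
  a fixed piece of syntax, so the size of its expressions only contributes a
  constant factor.  There is no multiplication: each time unit lengthens the
  numbers in memory by at most a constant number of bits, so unit-cost time is
  polynomially equivalent to Turing machine time. *)

Definition memory := nat -> nat.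

Inductive expr : Type :=
  | Const of nat
  | Read of expr
  | Add of expr & expr
  | Sub of expr & expr.

Fixpoint eval (m : memory) (x : expr) : nat :=
  match x with
  | Const a => a
  | Read y => m (eval m y)
  | Add y z => eval m y + eval m z
  | Sub y z => eval m y - eval m z
  end.

(** [Write x y] stores the value of [y] in the register whose address is the
  value of [x]; tests succeed on nonzero values. *)
Inductive program : Type :=
  | Skip
  | Write of expr & expr
  | Seq of program & program
  | If of expr & program & program
  | While of expr & program.

Definition update (m : memory) (a b : nat) : memory :=
  fun a' => if a' == a then b else m a'.

(** [runs P m t m']: started in memory [m], [P] halts after [t] time units in
  memory [m']. *)
Inductive runs : program -> memory -> nat -> memory -> Prop :=
  | RunSkip m : runs Skip m 1 m
  | RunWrite x y m : runs (Write x y) m 1 (update m (eval m x) (eval m y))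
  | RunSeq P Q m t m' t' m'' :
      runs P m t m' -> runs Q m' t' m'' -> runs (Seq P Q) m (t + t') m''
  | RunIfTrue x P Q m t m' :
      eval m x <> 0 -> runs P m t m' -> runs (If x P Q) m t.+1 m'
  | RunIfFalse x P Q m t m' :
      eval m x = 0 -> runs Q m t m' -> runs (If x P Q) m t.+1 m'
  | RunWhileTrue x P m t m' t' m'' :
      eval m x <> 0 -> runs P m t m' -> runs (While x P) m' t' m'' ->
      runs (While x P) m (t + t').+1 m''
  | RunWhileFalse x P m : eval m x = 0 -> runs (While x P) m 1 m.

(** Input: register 0 holds [n], and the [n * n] registers from 1 on hold the
  adjacency matrix in row-major order; all others are 0. *)
Definition graph_memory (n : nat) (e : rel 'I_n) : memory :=
  fun a =>
    if a is b.+1 then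
      nat_of_bool [exists u : 'I_n, exists v : 'I_n, (b == u * n + v) && e u v]
    else n.

(** Output: register 0 holds the number of rounds; register [1 + t * n + v] is
  nonzero when node [v] transmits in round [t]. *)
Definition read_schedule (n : nat) (m : memory) : schedule 'I_n :=
  [seq [set v : 'I_n | m (1 + t * n + v) != 0]%SET | t <- iota 0 (m 0)].

(* Main.v *)
Require Import Defs.
From HB Require Import structures.
From mathcomp Require Import all_boot all_order all_algebra.
From mathcomp Require Import zify ring lra.

Set Implicit Arguments.
Unset Strict Implicit.
Unset Printing Implicit Defensive.

(** Messages are gathered at one node and then spread by running the gathering rounds
  backwards, with the receivers transmitting.  For every guess [k] of the optimum, gathering
  proceeds in phases that halve the number of tokens.  In a phase, tokens are paired up one
  pair at a time, the two tokens of a pair walking to a common node within [k] steps; the price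
  of being at a node at a given time starts at 1 and doubles with every token that passes there.
  Merging the tokens along an optimal schedule shows that if [N] tokens are unpaired and the
  prices add up to [Z], then some pair can meet at cost at most [4 Z / (N - 1)].  Hence
  [Z (N + 7) (N + 5) (N + 3) (N + 1)] never increases, prices stay polynomial, and only
  [O(log n)] tokens use a node at a time.  The moves of one time step are split into
  interference-free rounds by greedy colouring: in a degenerate graph, their conflict graph is
  sparse, and [O(log n)] rounds suffice.  This gives [O(k log n)] rounds per phase.

  A planar graph has no [K_5] minor: in a drawing of [K_5] by polygons in general position, the
  number of crossings between disjoint edges is odd, which follows from the exchange properties of
  orientations.  By an argument of Mader, graphs without [K_5] minor are degenerate. *)

(** * Dense minors *)

(** The algorithm never sees an optimal schedule. Its existence serves the analysis only, as a bound
    on the cheapest meeting, which shortest walks in the time-expanded graph find without it; even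
    its length is unknown, and all lengths below n*n are tried. Exponential prices turn a bound on a
    sum into a bound on each load: l tokens passing a node cost 2^l, so polynomial prices mean
    logarithmic loads. One logarithm of the result pays for the loads, the other for the halving
    phases. Planarity is used through degeneracy alone. The arcs of a drawing are arbitrary
    continuous curves; compactness replaces them by polygons in which disjoint edges still do not
    cross, and straightening the edges one by one keeps the parity of crossings, so that the
    topology is reduced to a finite check on the orientations of five points. For the running time,
    the algorithm is written in a small language without unbounded loops and then compiled. *)

Section Minors.
Variables (V : finType) (e : rel V).
Hypothesis esym : symmetric e.

Definition adjacent_sets (A B : {set V}) : bool := [exists a in A, exists b in B, e a b].

Definition connected_set (A : {set V}) : Prop :=
  forall x y, x \in A -> y \in A ->
    exists p, [/\ path e x p, last x p = y & {subset p <= A}].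

Lemma adjacent_setsP (A B : {set V}) :
  reflect (exists a b, [/\ a \in A, b \in B & e a b]) (adjacent_sets A B).
Proof.
apply: (iffP existsP) => [[a /andP[aA /existsP[b /andP[bB ab]]]]|[a [b [aA bB ab]]]].
  by exists a, b.
by exists a; rewrite aA; apply/existsP; exists b; rewrite bB.
Qed.

Lemma adjacent_sets_sym (A B : {set V}) : adjacent_sets A B = adjacent_sets B A.
Proof.
by apply/adjacent_setsP/adjacent_setsP => -[a [b [aA bB ab]]]; exists b, a; rewrite esym.
Qed.

Lemma adjacent_setsUl (A B C : {set V}) : adjacent_sets (A :|: B)%SET C = adjacent_sets A C ||
  adjacent_sets B C.
Proof.
apply/adjacent_setsP/orP => [[a [b []]]|[] /adjacent_setsP[a [b [aA bC ab]]]].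
- by rewrite inE => /orP[] aA bC ab; [left|right]; apply/adjacent_setsP; exists a, b.
- by exists a, b; rewrite inE aA.
- by exists a, b; rewrite inE aA orbT.
Qed.

Lemma connected_setU (A B : {set V}) :
  connected_set A -> connected_set B -> adjacent_sets A B -> connected_set (A :|: B)%SET.
Proof.
move=> cA cB /adjacent_setsP[a [b [aA bB ab]]].
have AB (x y : V) : x \in A -> y \in B -> exists p,
    [/\ path e x p, last x p = y & {subset p <= (A :|: B)%SET}].
  move=> xA yB; have [p [pp lp sp]] := cA x a xA aA; have [q [pq lq sq]] := cB b y bB yB.
  exists (p ++ b :: q); rewrite cat_path pp lp /= ab pq last_cat /= lq; split=> // z.
  by rewrite mem_cat !inE => /or3P[/sp->|/eqP->|/sq->]; rewrite ?bB ?orbT.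
have BA (x y : V) : x \in B -> y \in A -> exists p,
    [/\ path e x p, last x p = y & {subset p <= (A :|: B)%SET}].
  move=> xB yA; have [p [pp lp sp]] := cB x b xB bB; have [q [pq lq sq]] := cA a y aA yA.
  exists (p ++ a :: q); rewrite cat_path pp lp /= esym ab pq last_cat /= lq; split=> // z.
  by rewrite mem_cat !inE => /or3P[/sp->|/eqP->|/sq->]; rewrite ?aA ?orbT.
move=> x y; rewrite !inE => /orP[xA|xB] /orP[yA|yB]; [| exact: AB | exact: BA |].
  by have [p [pp lp sp]] := cA x y xA yA; exists p; split=> // z /sp; rewrite inE => ->.
by have [p [pp lp sp]] := cB x y xB yB; exists p; split=> // z /sp; rewrite inE orbC => ->.
Qed.

Implicit Types F G : {set {set V}}.

(** Minors are kept as families of vertex sets of the original graph, so that contracting an edge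
    just replaces two members by their union. *)
Definition branch_family F : Prop :=
  [/\ forall A, A \in F -> A != set0, forall A, A \in F -> connected_set A
    & forall A B, A \in F -> B \in F -> A != B -> [disjoint A & B]].

Definition family_degree F (A : {set V}) : nat := \sum_(B in F) adjacent_sets A B.

(** A sum of degrees, so every edge between members counts twice; [2 ^ t * #|F| <= family_edges F]
    says that the average degree is at least [2 ^ t]. *)
Definition family_edges F : nat := \sum_(A in F) family_degree (F :\ A)%SET A.

Lemma family_degreeU1 F A B : B \notin F ->
  family_degree (B |: F)%SET A = adjacent_sets A B + family_degree F A.
Proof. by move=> nB; rewrite /family_degree big_setU1. Qed.

Lemma family_edgesU1 F A : A \notin F ->
  family_edges (A |: F)%SET = family_edges F + 2 * family_degree F A.
Proof.
move=> nA; rewrite /family_edges big_setU1 //= setU1K //.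
rewrite addnC mul2n -addnn addnA; congr (_ + _).
rewrite -big_split /=; apply: eq_bigr => B BF.
have nAB : A != B by apply: contra nA => /eqP->.
have -> : ((A |: F) :\ B = A |: (F :\ B))%SET.
  by apply/setP => C; rewrite !inE; case: (eqVneq C A) => [->|]; rewrite /= ?nAB ?andbT.
rewrite family_degreeU1; last by rewrite !inE negb_and nA orbT.
by rewrite addnC adjacent_sets_sym.
Qed.

(** A complete minor. That each set contains a member of [F] is what lets the induction extend it:
    sets found among the neighbours of a branch set [A] are then adjacent to [A], and inclusion in
    [cover F] keeps them disjoint from [A]. *)
Definition minor_of F (L : seq {set V}) : Prop :=
  [/\ forall A, A \in L -> connected_set A /\ (exists2 B, B \in F & B \subset A),
      forall A, A \in L -> A \subset cover F
    & pairwise (fun A B : {set V} => [disjoint A & B] && adjacent_sets A B) L].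

Lemma minor_of_trans F G L : (forall B, B \in G -> exists2 A, A \in F & A \subset B) ->
  cover G \subset cover F -> minor_of G L -> minor_of F L.
Proof.
move=> sub cov [h1 h2 h3]; split=> // A AL; last exact: subset_trans (h2 A AL) cov.
have [cA [B BG BA]] := h1 A AL; split=> //.
by have [C CF CB] := sub B BG; exists C => //; exact: subset_trans CB BA.
Qed.

Lemma branch_family_sub F G : G \subset F -> branch_family F -> branch_family G.
Proof.
move=> /subsetP s [h1 h2 h3]; split=> [A /s|A /s|A B /s AF /s BF].
- exact: h1.
- exact: h2.
- exact: h3.
Qed.

(* Mader: delete branch sets of small degree and contract edges with few common neighbours;
  when neither is possible, every neighbourhood is dense. *)
Lemma dense_minor t F : branch_family F -> F != set0 -> 2 ^ t * #|F| <= family_edges F ->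
  exists2 L, size L = t.+1 & minor_of F L.
Proof.
elim: t F => [|t IHt] F.
  move=> [h1 h2 h3] /set0Pn[A AF] _; exists [:: A] => //; split=> // B; rewrite inE => /eqP->.
    by split; [exact: h2|exists A].
  exact: bigcup_sup.
have [m] := ubnP #|F|; elim: m F => // m IHm F Fm bF F0 dense.
have [n1 cF dF] := bF.
(* Removing such an [A] lowers [family_edges] by at most [2 * 2 ^ t], which is what the density
   allows for one member. *)
case: (boolP [exists A in F, family_degree (F :\ A)%SET A <= 2 ^ t]).
  case/existsP => A /andP[AF low].
  have cardF := cardsD1 A F; rewrite AF in cardF.
  have edges : family_edges F = family_edges (F :\ A)%SET + 2 * family_degree (F :\ A)%SET A.
    by rewrite -[in LHS](setD1K AF) family_edgesU1 // !inE eqxx.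
  have sub : (F :\ A)%SET \subset F by exact: subD1set.
  have [||||L sL mL] := IHm (F :\ A)%SET.
  - by move: Fm; rewrite cardF add1n.
  - exact: branch_family_sub sub bF.
  - apply/eqP => G0; move: edges dense; rewrite cardF G0 cards0 /family_edges big_set0.
    by rewrite /family_degree big_set0 => ->; rewrite muln0 !addn0 muln1 leqn0 expn_eq0.
  - move: dense; rewrite edges cardF expnS; lia.
  exists L => //; apply: minor_of_trans mL => [B BG|]; last first.
    by apply/bigcupsP => B /(subsetP sub) BF; apply: bigcup_sup.
  by exists B => //; apply: (subsetP sub).
rewrite negb_exists => /forallP high.
(* Contracting such a pair loses the edge itself and one edge per common neighbour, again at most
   [2 ^ t] edges. *)
case: (boolP [exists A in F, exists B in F, [&& A != B, adjacent_sets A B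
    & \sum_(C in F :\ A :\ B) (adjacent_sets A C && adjacent_sets B C) < 2 ^ t]%SET]).
  case/existsP => A /andP[AF /existsP[B /andP[BF /and3P[nAB aAB few]]]].
  set G := (F :\ A :\ B)%SET in few.
  have BFA : B \in (F :\ A)%SET by rewrite !inE BF eq_sym nAB.
  have eF : F = (A |: (B |: G))%SET by rewrite /G setD1K // setD1K.
  have nBG : B \notin G by rewrite !inE eqxx.
  have nAG : A \notin (B |: G)%SET by rewrite /G setD1K // !inE eqxx.
  have [nA nB] := (n1 A AF, n1 B BF).
  have GF C : C \in G -> [/\ C \in F, C != A & C != B].
    by rewrite !inE => /and3P[-> -> ->].
  have disG C : C \in G -> [disjoint (A :|: B) & C]%SET.
    move=> /GF[CF CA CB]; rewrite disjoints_subset subUset -!disjoints_subset.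
    by rewrite !dF // eq_sym.
  have nABG : (A :|: B)%SET \notin G.
    apply/negP => /disG; rewrite -setI_eq0 setIid setU_eq0 (negbTE nA) //.
  have cardF : #|F| = #|G|.+2 by rewrite eF !cardsU1 nAG nBG.
  have [||||L sL mL] := IHm ((A :|: B) |: G)%SET.
  - by rewrite cardsU1 nABG add1n; move: Fm; rewrite cardF.
  - split=> C.
    + rewrite in_setU1 => /orP[/eqP->|/GF[CF _ _]]; last exact: n1.
      by rewrite setU_eq0 negb_and nA.
    + rewrite in_setU1 => /orP[/eqP->|/GF[CF _ _]]; last exact: cF.
      by apply: connected_setU => //; exact: cF.
    + move=> D; rewrite !in_setU1.
      case/orP=> [/eqP->|CG] /orP[/eqP->|DG]; rewrite ?eqxx //.
      * by move=> _; exact: disG.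
      * by move=> _; rewrite disjoint_sym; exact: disG.
      * by have [CF _ _] := GF C CG; have [DF _ _] := GF D DG; exact: dF.
  - by apply/set0Pn; exists (A :|: B)%SET; rewrite !inE eqxx.
  - move: dense; rewrite {1 2}eF !family_edgesU1 // family_degreeU1 // aAB.
    rewrite !cardsU1 nAG nBG nABG.
    have : family_degree G (A :|: B)%SET
        + \sum_(C in G) (adjacent_sets A C && adjacent_sets B C) =
        family_degree G A + family_degree G B.
      rewrite /family_degree -!big_split /=; apply: eq_bigr => C _.
      by rewrite adjacent_setsUl; case: (adjacent_sets A C); case: (adjacent_sets B C).
    move: few; rewrite expnS !mulnDr !muln1; clear; move: (\sum_(C in G) _) => c.
    move: (family_degree G _) (family_degree G A) (family_degree G B) => x y z.
    move: (family_edges G) (2 * 2 ^ t * #|G|) (2 ^ t) => E g w; lia.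
  exists L => //; apply: minor_of_trans mL.
    move=> C; rewrite in_setU1 => /orP[/eqP->|/GF[CF _ _]]; last by exists C.
    by exists A => //; exact: subsetUl.
  apply/bigcupsP => C; rewrite in_setU1 => /orP[/eqP->|/GF[CF _ _]]; last exact: bigcup_sup.
  by rewrite subUset !(bigcup_sup _ (F := id)).
rewrite negb_exists => /forallP rich.
have [A AF] := set0Pn F F0.
(* By [rich] each member of [N] has at least [2 ^ t] neighbours in [N], namely its common neighbours
   with [A]; the minor found in [N] is completed by [A]. *)
pose N := [set B in F | (B != A) && adjacent_sets A B]%SET.
have NF : N \subset F by apply/subsetP => B; rewrite inE => /andP[].
have [|||L sL [h1 h2 h3]] := IHt N.
- exact: branch_family_sub NF bF.
- have := high A; rewrite AF /= -ltnNge => pos.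
  have : 0 < family_degree (F :\ A)%SET A by apply: leq_ltn_trans pos.
  rewrite lt0n sum_nat_eq0 negb_forall => /existsP[B].
  rewrite negb_imply !inE -lt0n lt0b => /andP[/andP[nBA BF] ab].
  by apply/set0Pn; exists B; rewrite inE BF nBA.
- rewrite mulnC -sum_nat_const; apply: leq_sum => B; rewrite inE => /and3P[BF nBA ab].
  have := rich A; rewrite AF negb_exists => /forallP/(_ B); rewrite BF eq_sym nBA ab /=.
  rewrite -leqNgt => h; apply: leq_trans h _.
  rewrite /family_degree [leqRHS]big_mkcond [leqLHS]big_mkcond /=; apply: leq_sum => C _.
  rewrite !inE; case: (C \in F); case: (C == B); case: (C == A) => //=.
  by case: (adjacent_sets A C); case: (adjacent_sets B C).
exists (A :: L); first by rewrite /= sL.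
have dA B : B \in L -> [disjoint A & B] && adjacent_sets A B.
  move=> BL; apply/andP; split.
    have : [disjoint A & cover N].
      rewrite disjoint_sym disjoints_subset; apply/bigcupsP => C; rewrite inE => /and3P[CF nCA _].
      by rewrite -disjoints_subset dF.
    by apply: disjointWr; exact: h2.
  have [_ [C CN /subsetP CB]] := h1 B BL; move: CN; rewrite inE => /and3P[_ _].
  by move=> /adjacent_setsP[a [b [aA bC ab]]]; apply/adjacent_setsP; exists a, b; split=> //;
    exact: CB.
split=> [B|B|].
- rewrite inE => /orP[/eqP->|/h1[cB [C CN CB]]]; first by split; [exact: cF|exists A].
  by split=> //; exists C => //; exact: (subsetP NF).
- rewrite inE => /orP[/eqP->|/h2 BN]; first exact: bigcup_sup.
  apply: subset_trans BN _; apply/bigcupsP => C /(subsetP NF) CF.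
  exact: bigcup_sup.
- by rewrite /= h3 andbT; apply/allP.
Qed.

End Minors.

(** * A term language and its compilation *)

Inductive term : Type :=
  | TCst of nat
  | TVar of nat
  | TSize
  | TArr of nat & term
  | TAdd of term & term
  | TSub of term & term
  | TIf of term & term & term
  | TSum of nat & term.

(** The only loop runs exactly [n] times, as do the sums in terms, so polynomial running time
    follows from the syntax: each level of nesting raises the exponent by one. *)
Inductive stmt : Type :=
  | SSkip
  | SAsg of nat & term & term
  | SSeq of stmt & stmt
  | SIf of term & stmt & stmt
  | SFor of nat & stmt.

Definition store := nat -> nat -> nat.

Definition store_set (sg : store) (a i v : nat) : store :=
  fun b j => if (b == a) && (j == i) then v else sg b j.

Fixpoint teval (n : nat) (rho : nat -> nat) (sg : store) (e : term) : nat :=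
  match e with
  | TCst c => c
  | TVar x => rho x
  | TSize => n
  | TArr a e1 => sg a (teval n rho sg e1)
  | TAdd e1 e2 => teval n rho sg e1 + teval n rho sg e2
  | TSub e1 e2 => teval n rho sg e1 - teval n rho sg e2
  | TIf e1 e2 e3 =>
      if teval n rho sg e1 != 0 then teval n rho sg e2 else teval n rho sg e3
  | TSum x e1 => \sum_(i < n) teval n (update rho x i) sg e1
  end.

Fixpoint sexec (n : nat) (rho : nat -> nat) (sg : store) (s : stmt) : store :=
  match s with
  | SSkip => sg
  | SAsg a i e => store_set sg a (teval n rho sg i) (teval n rho sg e)
  | SSeq s1 s2 => sexec n rho (sexec n rho sg s1) s2
  | SIf e s1 s2 => if teval n rho sg e != 0 then sexec n rho sg s1 else sexec n rho sg s2
  | SFor x s1 => iteri n (fun i sg' => sexec n (update rho x i) sg' s1) sg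
  end.

Lemma while_loop (n T : nat) (c : expr) (P : program) (inv : nat -> memory -> Prop) :
    (forall i m, i < n -> inv i m -> eval m c <> 0 /\
       exists t m', [/\ runs P m t m', t <= T & inv i.+1 m']) ->
    (forall m, inv n m -> eval m c = 0) ->
  forall m, inv 0 m -> exists t m', [/\ runs (While c P) m t m', t <= n * T.+1 + 1 & inv n m'].
Proof.
move=> step stop.
have main k : forall i m, i + k = n -> inv i m ->
    exists t m', [/\ runs (While c P) m t m', t <= k * T.+1 + 1 & inv n m'].
  elim: k => [|k IH] i m.
    rewrite addn0 => -> hm; exists 1, m; split=> //; exact/RunWhileFalse/stop.
  move=> ik hm; have [c0 [t [m1 [r1 t1 i1]]]] := step i m ltac:(lia) hm.
  have [t' [m2 [r2 t2 i2]]] := IH i.+1 m1 ltac:(lia) i1.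
  exists (t + t').+1, m2; split=> //; first exact: RunWhileTrue r1 r2.
  rewrite mulSn; lia.
by move=> m; exact: main.
Qed.

Section Compiler.

(* Array [a] (of [K]) has its entry [i] at address [B + K * i + a], where register 1 holds [B].
  Array 0 is an evaluation stack, array 1 holds the bound variables. *)
Variable K : nat.
Hypothesis K_gt1 : 1 < K.

(** Array [a] sits at offset [a.+2], above the stack and the variables. A bound variable must be
    fresh because it would overwrite the cell of an enclosing binder. *)
Fixpoint scope_term (sc : seq nat) (e : term) : bool :=
  match e with
  | TCst _ | TSize => true
  | TVar x => x \in sc
  | TArr a e1 => (a.+2 < K) && scope_term sc e1
  | TAdd e1 e2 | TSub e1 e2 => scope_term sc e1 && scope_term sc e2
  | TIf e1 e2 e3 => [&& scope_term sc e1, scope_term sc e2 & scope_term sc e3]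
  | TSum x e1 => (x \notin sc) && scope_term (x :: sc) e1
  end.

Fixpoint scope_stmt (sc : seq nat) (s : stmt) : bool :=
  match s with
  | SSkip => true
  | SAsg a i e => [&& a.+2 < K, scope_term sc i & scope_term sc e]
  | SSeq s1 s2 => scope_stmt sc s1 && scope_stmt sc s2
  | SIf e s1 s2 => [&& scope_term sc e, scope_stmt sc s1 & scope_stmt sc s2]
  | SFor x s1 => (x \notin sc) && scope_stmt (x :: sc) s1
  end.

(** Expressions have no product, but [K] is fixed before the input is known, so a [K]-fold sum is a
    legitimate expression. *)
Fixpoint scale (k : nat) (e : expr) : expr :=
  if k is k'.+1 then Add e (scale k' e) else Const 0.

Definition entry (a : nat) (e : expr) : expr :=
  Add (Read (Const 1)) (Add (scale K e) (Const a)).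

Definition stack_addr d := entry 0 (Const d).
Definition var_addr x := entry 1 (Const x).
Definition stack d := Read (stack_addr d).
Definition var x := Read (var_addr x).
Definition size_reg := Read (Const 0).

Definition count_loop x P :=
  Seq (Write (var_addr x) (Const 0))
    (While (Defs.Sub size_reg (var x)) (Seq P (Write (var_addr x) (Add (var x) (Const 1))))).

(** Code for depth [d] leaves its value in stack cell [d] and may spoil the cells above; the cells
    below hold pending operands and are protected by [frame]. *)
Fixpoint compile_term (e : term) (d : nat) : program :=
  match e with
  | TCst c => Write (stack_addr d) (Const c)
  | TVar x => Write (stack_addr d) (var x)
  | TSize => Write (stack_addr d) size_reg
  | TArr a e1 => Seq (compile_term e1 d)
      (Write (stack_addr d) (Read (entry a.+2 (stack d))))
  | TAdd e1 e2 => Seq (compile_term e1 d) (Seq (compile_term e2 d.+1)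
      (Write (stack_addr d) (Add (stack d) (stack d.+1))))
  | TSub e1 e2 => Seq (compile_term e1 d) (Seq (compile_term e2 d.+1)
      (Write (stack_addr d) (Defs.Sub (stack d) (stack d.+1))))
  | TIf e1 e2 e3 => Seq (compile_term e1 d)
      (If (stack d) (compile_term e2 d) (compile_term e3 d))
  | TSum x e1 => Seq (Write (stack_addr d) (Const 0))
      (count_loop x (Seq (compile_term e1 d.+1)
         (Write (stack_addr d) (Add (stack d) (stack d.+1)))))
  end.

Fixpoint compile_stmt (s : stmt) : program :=
  match s with
  | SSkip => Skip
  | SAsg a i e => Seq (compile_term i 0) (Seq (compile_term e 1)
      (Write (entry a.+2 (stack 0)) (stack 1)))
  | SSeq s1 s2 => Seq (compile_stmt s1) (compile_stmt s2)
  | SIf e s1 s2 => Seq (compile_term e 0) (If (stack 0) (compile_stmt s1) (compile_stmt s2))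
  | SFor x s1 => count_loop x (compile_stmt s1)
  end.

Definition cell (B a i : nat) : nat := B + (K * i + a).

Lemma eval_scale m k e : eval m (scale k e) = k * eval m e.
Proof. by elim: k => //= k ->; rewrite mulSn. Qed.

Lemma eval_entry m a e : eval m (entry a e) = cell (m 1) a (eval m e).
Proof. by rewrite /= eval_scale. Qed.

Lemma cell_inj B a b i j : a < K -> b < K -> (cell B a i == cell B b j) = (a == b) && (i == j).
Proof.
move=> aK bK; rewrite /cell eqn_add2l; apply/eqP/andP => [h|[/eqP-> /eqP->] //].
have := congr1 (modn^~ K) h; rewrite ![K * _]mulnC !modnMDl !modn_small // => ab.
move: h; rewrite ab => /addIn/eqP; rewrite eqn_mul2l => /orP[/eqP K0|//].
by have := K_gt1; rewrite K0.
Qed.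

(** Stack cells are left unconstrained, as scratch space. The condition [1 < B] keeps all cells away
    from registers 0 and 1. *)
Record represents (n B : nat) (sc : seq nat) (rho : nat -> nat) (sg : store) (m : memory) :
    Prop := Represents {
  rep_size : m 0 = n;
  rep_base : m 1 = B;
  rep_base_ge : 1 < B;
  rep_var : forall x, x \in sc -> m (cell B 1 x) = rho x;
  rep_arr : forall a i, a.+2 < K -> m (cell B a.+2 i) = sg a i
}.

Lemma cell_gt B a i : 1 < B -> (cell B a i == 0) = false /\ (cell B a i == 1) = false.
Proof. by rewrite /cell; lia. Qed.

Section Rules.
Variables (n B : nat).

Lemma represents_stack sc rho sg m d v : represents n B sc rho sg m ->
  represents n B sc rho sg (update m (cell B 0 d) v).
Proof.
case=> h0 h1 hB hv ha; have [c0 c1] := cell_gt 0 d hB.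
split=> // [||x xs|a i aK]; rewrite /update.
- by rewrite eq_sym c0.
- by rewrite eq_sym c1.
- by rewrite cell_inj ?hv // ltnW.
- by rewrite cell_inj ?ha // ltnW.
Qed.

Lemma represents_bind sc rho sg m x v : represents n B sc rho sg m -> x \notin sc ->
  represents n B (x :: sc) (update rho x v) sg (update m (cell B 1 x) v).
Proof.
case=> h0 h1 hB hv ha xs; have [c0 c1] := cell_gt 1 x hB.
split=> // [||y|a i aK]; rewrite /update.
- by rewrite eq_sym c0.
- by rewrite eq_sym c1.
- rewrite inE cell_inj // eqxx /=; case: eqP => //= _; exact: hv.
- by rewrite cell_inj ?ha.
Qed.

Lemma represents_unbind sc rho sg m x v :
  represents n B (x :: sc) (update rho x v) sg m -> x \notin sc ->
  represents n B sc rho sg m.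
Proof.
case=> h0 h1 hB hv ha xs; split=> // y ys.
rewrite hv ?inE ?ys ?orbT // /update ifN //.
by apply: contra xs => /eqP<-.
Qed.

Lemma represents_set sc rho sg m a i v : represents n B sc rho sg m -> a.+2 < K ->
  represents n B sc rho (store_set sg a i v) (update m (cell B a.+2 i) v).
Proof.
case=> h0 h1 hB hv ha aK; have [c0 c1] := cell_gt a.+2 i hB.
split=> // [||x xs|b j bK]; rewrite /update.
- by rewrite eq_sym c0.
- by rewrite eq_sym c1.
- by rewrite cell_inj ?hv // ltnW.
- by rewrite cell_inj // /store_set eqSS; case: ifP => // _; exact: ha.
Qed.

End Rules.

Definition frame (B d : nat) (m m' : memory) : Prop :=
  forall d', d' < d -> m' (cell B 0 d') = m (cell B 0 d').

Lemma frame_stack B d m v : frame B d m (update m (cell B 0 d) v).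
Proof. by move=> d' lt; rewrite /update cell_inj ?(ltnW K_gt1) //= ifN // neq_ltn lt. Qed.

Lemma frame_trans B d m m1 m2 : frame B d m m1 -> frame B d m1 m2 -> frame B d m m2.
Proof. by move=> h1 h2 d' lt; rewrite h2 // h1. Qed.

Lemma frame_le B d d' m m1 : d <= d' -> frame B d' m m1 -> frame B d m m1.
Proof. by move=> le h k lt; apply: h; apply: leq_trans lt le. Qed.

Lemma eval_stack B d m : m 1 = B -> eval m (stack d) = m (cell B 0 d).
Proof. by move=> <-; rewrite /stack [eval _ _]/= eval_scale. Qed.

Lemma eval_var B x m : m 1 = B -> eval m (var x) = m (cell B 1 x).
Proof. by move=> <-; rewrite /var [eval _ _]/= eval_scale. Qed.

Lemma run_write n B sc rho sg m a i v : represents n B sc rho sg m ->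
  runs (Write (entry a i) v) m 1 (update m (cell B a (eval m i)) (eval m v)).
Proof.
move=> r; have := RunWrite (entry a i) v m.
by rewrite eval_entry (rep_base r).
Qed.

Definition term_spec (n B : nat) sc (e : term) (c k d : nat) : Prop :=
  forall rho sg m, represents n B sc rho sg m ->
    exists t m', [/\ runs (compile_term e d) m t m', t <= c * n.+1 ^ k,
      represents n B sc rho sg m', m' (cell B 0 d) = teval n rho sg e & frame B d m m'].

Lemma expn_mono n k l : k <= l -> n.+1 ^ k <= n.+1 ^ l.
Proof. by move=> kl; rewrite leq_pexp2l. Qed.

Lemma bound_le n c k c' k' : c <= c' -> k <= k' -> c * n.+1 ^ k <= c' * n.+1 ^ k'.
Proof. by move=> cc kk; apply: leq_mul => //; exact: expn_mono. Qed.

(** [inv i] is to hold once the counter cell contains [i], hence the updates around it. The final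
    store is left open because a loop in a term preserves the store while one in a statement changes
    it; [inv] carries that information. *)
Lemma count_loop_spec n B sc x P T (inv : nat -> memory -> Prop) rho :
    x \notin sc ->
    (forall i m sg, i < n -> inv i m -> represents n B (x :: sc) (update rho x i) sg m ->
       exists t m' sg', [/\ runs P m t m', t <= T,
         represents n B (x :: sc) (update rho x i) sg' m'
         & inv i.+1 (update m' (cell B 1 x) i.+1)]) ->
  forall sg m, represents n B sc rho sg m -> inv 0 (update m (cell B 1 x) 0) ->
    exists t m' sg', [/\ runs (count_loop x P) m t m', t <= n * T.+2 + 2,
      represents n B sc rho sg' m' & inv n m'].
Proof.
move=> xs step sg m r i0.
pose J i m := inv i m /\ exists sg, represents n B (x :: sc) (update rho x i) sg m.
have xin : x \in x :: sc by rewrite inE eqxx.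
have upx i : update rho x i x = i by rewrite /update eqxx.
have [|||t [m' [rw tw [iw [sg' rw']]]]] := @while_loop n T.+1 (Defs.Sub size_reg (var x))
    (Seq P (Write (var_addr x) (Add (var x) (Const 1)))) J _ _ (update m (cell B 1 x) 0).
- move=> i m1 lt [i1 [sg1 r1]]; split.
    have e1 : eval m1 (var x) = i by rewrite (eval_var _ (rep_base r1)) (rep_var r1) // upx.
    have e2 : eval m1 size_reg = n by exact: (rep_size r1).
    by rewrite -[eval m1 (Defs.Sub _ _)]/(eval m1 size_reg - eval m1 (var x)) e1 e2; lia.
  have [t [m2 [sg2 [r2 t2 rep2 i2]]]] := step i m1 sg1 lt i1 r1.
  exists (t + 1), (update m2 (cell B 1 x) i.+1); split.
  + apply: RunSeq r2 _; have := run_write 1 (Const x) (Add (var x) (Const 1)) rep2.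
    have -> : eval m2 (Add (var x) (Const 1)) = i.+1.
      rewrite -[LHS]/(eval m2 (var x) + 1) (eval_var _ (rep_base rep2)) (rep_var rep2) //.
      by rewrite upx addn1.
    by [].
  + by rewrite addn1.
  + split=> //; exists sg2.
    have := represents_bind i.+1 (represents_unbind rep2 xs) xs.
    by [].
- move=> m1 [_ [sg1 r1]].
  have e1 : eval m1 (var x) = n by rewrite (eval_var _ (rep_base r1)) (rep_var r1) // upx.
  have e2 : eval m1 size_reg = n by exact: (rep_size r1).
  by rewrite -[eval m1 (Defs.Sub _ _)]/(eval m1 size_reg - eval m1 (var x)) e1 e2 subnn.
- by split=> //; exists sg; exact: represents_bind.
exists (1 + t), m', sg'; split=> //.
- apply: RunSeq rw; exact: (run_write 1 (Const x) (Const 0) r).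
- by rewrite addnC; lia.
- exact: represents_unbind rw' xs.
Qed.

Lemma compile_term_correct e : forall sc, scope_term sc e ->
  exists c k, forall n B d, term_spec n B sc e c k d.
Proof.
elim: e => [c|x||a e IH|e1 IH1 e2 IH2|e1 IH1 e2 IH2|e1 IH1 e2 IH2 e3 IH3|x e IH] sc /=.
- move=> _; exists 1, 0 => n B d rho sg m r.
  exists 1, (update m (cell B 0 d) c); split=> //.
  + exact: (run_write 0 (Const d) (Const c) r).
  + exact: represents_stack.
  + by rewrite /update eqxx.
  + exact: (@frame_stack _ _ _ _).
- move=> xs; exists 1, 0 => n B d rho sg m r.
  exists 1, (update m (cell B 0 d) (rho x)); split=> //.
  + have := run_write 0 (Const d) (var x) r.
    by rewrite (eval_var _ (rep_base r)) (rep_var r).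
  + exact: represents_stack.
  + by rewrite /update eqxx.
  + exact: (@frame_stack _ _ _ _).
- move=> _; exists 1, 0 => n B d rho sg m r.
  exists 1, (update m (cell B 0 d) n); split=> //.
  + have := run_write 0 (Const d) size_reg r.
    by rewrite [eval m size_reg]/= (rep_size r).
  + exact: represents_stack.
  + by rewrite /update eqxx.
  + exact: (@frame_stack _ _ _ _).
- move=> /andP[aK /IH[c [k hc]]]; exists c.+1, k => n B d rho sg m r.
  have [t [m1 [r1 t1 rep1 v1 f1]]] := hc n B d rho sg m r.
  exists (t + 1), (update m1 (cell B 0 d) (sg a (teval n rho sg e))); split=> //.
  + apply: RunSeq r1 _; have := run_write 0 (Const d) (Read (entry a.+2 (stack d))) rep1.
    rewrite -[eval m1 (Read _)]/(m1 (eval m1 (entry a.+2 (stack d)))) eval_entry.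
    by rewrite (eval_stack _ (rep_base rep1)) v1 (rep_base rep1) (rep_arr rep1).
  + by rewrite addnC mulSn leq_add // expn_gt0.
  + exact: represents_stack.
  + by rewrite /update eqxx.
  + exact: frame_trans f1 (@frame_stack _ _ _ _).
- move=> /andP[/IH1[c1 [k1 hc1]] /IH2[c2 [k2 hc2]]].
  exists (c1 + c2).+1, (k1 + k2) => n B d rho sg m r.
  have [t1 [m1 [r1 b1 rep1 v1 f1]]] := hc1 n B d rho sg m r.
  have [t2 [m2 [r2 b2 rep2 v2 f2]]] := hc2 n B d.+1 rho sg m1 rep1.
  exists (t1 + (t2 + 1)), (update m2 (cell B 0 d) (teval n rho sg e1 + teval n rho sg e2)).
  split=> //.
  + apply: RunSeq r1 _; apply: RunSeq r2 _.
    have := run_write 0 (Const d) (Add (stack d) (stack d.+1)) rep2.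
    rewrite -[eval m2 (Add _ _)]/(eval m2 (stack d) + eval m2 (stack d.+1)).
    by rewrite !(eval_stack _ (rep_base rep2)) v2 f2 // v1.
  + have h1 := bound_le n (leqnn c1) (leq_addr k2 k1).
    have h2 := bound_le n (leqnn c2) (leq_addl k1 k2).
    rewrite mulSn mulnDl; have := expn_gt0 n.+1 (k1 + k2); rewrite /=; lia.
  + exact: represents_stack.
  + by rewrite /update eqxx.
  + apply: frame_trans f1 (frame_trans (frame_le (leqnSn d) f2) (@frame_stack _ _ _ _)).
- move=> /andP[/IH1[c1 [k1 hc1]] /IH2[c2 [k2 hc2]]].
  exists (c1 + c2).+1, (k1 + k2) => n B d rho sg m r.
  have [t1 [m1 [r1 b1 rep1 v1 f1]]] := hc1 n B d rho sg m r.
  have [t2 [m2 [r2 b2 rep2 v2 f2]]] := hc2 n B d.+1 rho sg m1 rep1.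
  exists (t1 + (t2 + 1)), (update m2 (cell B 0 d) (teval n rho sg e1 - teval n rho sg e2)).
  split=> //.
  + apply: RunSeq r1 _; apply: RunSeq r2 _.
    have := run_write 0 (Const d) (Defs.Sub (stack d) (stack d.+1)) rep2.
    rewrite -[eval m2 (Defs.Sub _ _)]/(eval m2 (stack d) - eval m2 (stack d.+1)).
    by rewrite !(eval_stack _ (rep_base rep2)) v2 f2 // v1.
  + have h1 := bound_le n (leqnn c1) (leq_addr k2 k1).
    have h2 := bound_le n (leqnn c2) (leq_addl k1 k2).
    rewrite mulSn mulnDl; have := expn_gt0 n.+1 (k1 + k2); rewrite /=; lia.
  + exact: represents_stack.
  + by rewrite /update eqxx.
  + apply: frame_trans f1 (frame_trans (frame_le (leqnSn d) f2) (@frame_stack _ _ _ _)).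
- move=> /and3P[/IH1[c1 [k1 hc1]] /IH2[c2 [k2 hc2]] /IH3[c3 [k3 hc3]]].
  exists (c1 + c2 + c3).+1, (k1 + k2 + k3) => n B d rho sg m r.
  have [t1 [m1 [r1 b1 rep1 v1 f1]]] := hc1 n B d rho sg m r.
  have l1 := bound_le n (leqnn c1) (leq_trans (leq_addr k2 k1) (leq_addr k3 _)).
  have l2 := bound_le n (leqnn c2) (leq_trans (leq_addl k1 k2) (leq_addr k3 _)).
  have l3 := bound_le n (leqnn c3) (leq_addl (k1 + k2) k3).
  have pos := expn_gt0 n.+1 (k1 + k2 + k3).
  have es : eval m1 (stack d) = teval n rho sg e1 by rewrite (eval_stack _ (rep_base rep1)).
  rewrite -[teval n rho sg (TIf e1 e2 e3)]/(if teval n rho sg e1 != 0 then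
    teval n rho sg e2 else teval n rho sg e3).
  case: (eqVneq (teval n rho sg e1) 0) => [z|/eqP nz] /=.
    have [t3 [m3 [r3 b3 rep3 v3 f3]]] := hc3 n B d rho sg m1 rep1.
    exists (t1 + t3.+1), m3; split=> //.
    + by apply: RunSeq r1 _; apply: RunIfFalse r3; rewrite es.
    + rewrite mulSn !mulnDl; rewrite /= in pos; lia.
    + exact: frame_trans f1 f3.
  have [t2 [m2 [r2 b2 rep2 v2 f2]]] := hc2 n B d rho sg m1 rep1.
  exists (t1 + t2.+1), m2; split=> //.
  + by apply: RunSeq r1 _; apply: RunIfTrue r2; rewrite es.
  + rewrite mulSn !mulnDl; rewrite /= in pos; lia.
  + exact: frame_trans f1 f2.
- move=> /andP[xs /IH[c [k hc]]]; exists (c + 6), k.+1 => n B d rho sg m r.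
  (* The partial sum waits in cell [d] while the next summand is evaluated at depth [d.+1]. *)
  pose inv i m' := m' (cell B 0 d) = \sum_(j < i) teval n (update rho x j) sg e /\
    frame B d m m' /\ forall a i, a.+2 < K -> m' (cell B a.+2 i) = sg a i.
  have vs y v d' m' : update m' (cell B 1 y) v (cell B 0 d') = m' (cell B 0 d').
    by rewrite /update cell_inj // ltnW.
  have va y v a i m' : a.+2 < K -> update m' (cell B 1 y) v (cell B a.+2 i) = m' (cell B a.+2 i).
    by move=> aK; rewrite /update cell_inj.
  have r0 := represents_stack d 0 r.
  have [||t [m' [sg' [rl tl repl [vl [fl al]]]]]] := @count_loop_spec n B sc x
      (Seq (compile_term e d.+1) (Write (stack_addr d) (Add (stack d) (stack d.+1))))
      (c * n.+1 ^ k + 1) inv rho xs _ sg _ r0.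
  + move=> i m1 sg1 lt [v1 [f1 a1]] rep1.
    have rep1' : represents n B (x :: sc) (update rho x i) sg m1.
      by case: rep1 => *; split.
    have [t2 [m2 [r2 b2 rep2 v2 f2]]] := hc n B d.+1 _ _ _ rep1'.
    exists (t2 + 1), (update m2 (cell B 0 d) (\sum_(j < i.+1) teval n (update rho x j) sg e)), sg.
    split.
    * apply: RunSeq r2 _.
      have := run_write 0 (Const d) (Add (stack d) (stack d.+1)) rep2.
      rewrite -[eval m2 (Add _ _)]/(eval m2 (stack d) + eval m2 (stack d.+1)).
      by rewrite !(eval_stack _ (rep_base rep2)) v2 f2 // v1 big_ord_recr.
    * by rewrite leq_add2r.
    * exact: represents_stack.
    * split; last split.
      - by rewrite vs /update eqxx.
      - move=> d' lt'; rewrite vs; apply: (frame_trans f1) lt'.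
        exact: frame_trans (frame_le (leqnSn d) f2) (@frame_stack _ _ _ _).
      - by move=> a j aK; rewrite va // (rep_arr (represents_stack d _ rep2)).
  + split; last split.
    * by rewrite vs /update eqxx big_ord0.
    * by move=> d' lt; rewrite vs; exact: (@frame_stack _ _ _ _).
    * by move=> a j aK; rewrite va // (rep_arr r0).
  exists (1 + t), m'; split=> //.
  + apply: RunSeq rl; exact: (run_write 0 (Const d) (Const 0) r).
  + have := expn_gt0 n.+1 k; rewrite /= expnS mulnDl => pos.
    move: tl; move: (n.+1 ^ k) pos => w pos tl.
    have : 1 + t <= 1 + (n * (c * w + 1).+2 + 2) by rewrite leq_add2l.
    nia.
  + by case: repl => *; split.
Qed.

Lemma compile_stmt_correct s : forall sc, scope_stmt sc s ->
  exists c k, forall n B rho sg m, represents n B sc rho sg m ->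
    exists t m', [/\ runs (compile_stmt s) m t m', t <= c * n.+1 ^ k
      & represents n B sc rho (sexec n rho sg s) m'].
Proof.
elim: s => [|a i e|s1 IH1 s2 IH2|e s1 IH1 s2 IH2|x s IH] sc /=.
- by move=> _; exists 1, 0 => n B rho sg m r; exists 1, m; split=> //; exact: RunSkip.
- move=> /and3P[aK /compile_term_correct[c1 [k1 hc1]] /compile_term_correct[c2 [k2 hc2]]].
  exists (c1 + c2).+1, (k1 + k2) => n B rho sg m r.
  have [t1 [m1 [r1 b1 rep1 v1 f1]]] := hc1 n B 0 rho sg m r.
  have [t2 [m2 [r2 b2 rep2 v2 f2]]] := hc2 n B 1 rho sg m1 rep1.
  exists (t1 + (t2 + 1)); eexists; split.
  + apply: RunSeq r1 _; apply: RunSeq r2 _; exact: (run_write a.+2 (stack 0) (stack 1) rep2).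
  + have h1 := bound_le n (leqnn c1) (leq_addr k2 k1).
    have h2 := bound_le n (leqnn c2) (leq_addl k1 k2).
    rewrite mulSn mulnDl; have := expn_gt0 n.+1 (k1 + k2); rewrite /=; lia.
  + by rewrite !(eval_stack _ (rep_base rep2)) v2 f2 // v1; exact: represents_set.
- move=> /andP[/IH1[c1 [k1 hc1]] /IH2[c2 [k2 hc2]]].
  exists (c1 + c2), (k1 + k2) => n B rho sg m r.
  have [t1 [m1 [r1 b1 rep1]]] := hc1 n B rho sg m r.
  have [t2 [m2 [r2 b2 rep2]]] := hc2 n B rho _ m1 rep1.
  exists (t1 + t2), m2; split=> //; first exact: RunSeq r1 r2.
  have h1 := bound_le n (leqnn c1) (leq_addr k2 k1).
  have h2 := bound_le n (leqnn c2) (leq_addl k1 k2).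
  rewrite mulnDl; lia.
- move=> /and3P[/compile_term_correct[c1 [k1 hc1]] /IH1[c2 [k2 hc2]] /IH2[c3 [k3 hc3]]].
  exists (c1 + c2 + c3).+1, (k1 + k2 + k3) => n B rho sg m r.
  have [t1 [m1 [r1 b1 rep1 v1 f1]]] := hc1 n B 0 rho sg m r.
  have l1 := bound_le n (leqnn c1) (leq_trans (leq_addr k2 k1) (leq_addr k3 _)).
  have l2 := bound_le n (leqnn c2) (leq_trans (leq_addl k1 k2) (leq_addr k3 _)).
  have l3 := bound_le n (leqnn c3) (leq_addl (k1 + k2) k3).
  have pos := expn_gt0 n.+1 (k1 + k2 + k3).
  have es : eval m1 (stack 0) = teval n rho sg e by rewrite (eval_stack _ (rep_base rep1)).
  case: (eqVneq (teval n rho sg e) 0) => [z|/eqP nz] /=.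
    have [t3 [m3 [r3 b3 rep3]]] := hc3 n B rho sg m1 rep1.
    exists (t1 + t3.+1), m3; split=> //.
    + by apply: RunSeq r1 _; apply: RunIfFalse r3; rewrite es.
    + rewrite mulSn !mulnDl; rewrite /= in pos; lia.
  have [t2 [m2 [r2 b2 rep2]]] := hc2 n B rho sg m1 rep1.
  exists (t1 + t2.+1), m2; split=> //.
  + by apply: RunSeq r1 _; apply: RunIfTrue r2; rewrite es.
  + rewrite mulSn !mulnDl; rewrite /= in pos; lia.
- move=> /andP[xs /IH[c [k hc]]]; exists (c + 4), k.+1 => n B rho sg m r.
  pose sgi i := iteri i (fun j sg' => sexec n (update rho x j) sg' s) sg.
  pose inv i m' := forall a j, a.+2 < K -> m' (cell B a.+2 j) = sgi i a j.
  have va y v a i m' : a.+2 < K -> update m' (cell B 1 y) v (cell B a.+2 i) = m' (cell B a.+2 i).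
    by move=> aK; rewrite /update cell_inj.
  have [||t [m' [sg' [rl tl repl al]]]] := @count_loop_spec n B sc x
      (compile_stmt s) (c * n.+1 ^ k) inv rho xs _ sg _ r.
  + move=> i m1 sg1 lt a1 rep1.
    have rep1' : represents n B (x :: sc) (update rho x i) (sgi i) m1.
      by case: rep1 => *; split.
    have [t2 [m2 [r2 b2 rep2]]] := hc n B _ _ _ rep1'.
    exists t2, m2, (sgi i.+1); split=> // a j aK.
    by rewrite va // (rep_arr rep2).
  + by move=> a j aK; rewrite va // (rep_arr r).
  exists t, m'; split=> //; last by case: repl => *; split.
  have := expn_gt0 n.+1 k; rewrite /= expnS mulnDl => pos.
  move: tl; move: (n.+1 ^ k) pos => w pos tl; nia.
Qed.

End Compiler.

Definition adjacency_code (n : nat) (e : rel 'I_n) (b : nat) : nat :=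
  nat_of_bool [exists u : 'I_n, exists v : 'I_n, (b == u * n + v) && e u v].

(* Arrays: 0 adjacency matrix, 1 number of rounds, 2 output, 3 and 4 scratch. *)
Definition input_store (n : nat) (e : rel 'I_n) : store :=
  fun a i => if a == 0 then adjacency_code e i else 0.

Lemma adjacency_codeE n (e : rel 'I_n) (u v : 'I_n) : adjacency_code e (u * n + v) = e u v.
Proof.
rewrite /adjacency_code; congr nat_of_bool; apply/existsP/idP => [[x /existsP[y]]|uv].
  case/andP=> /eqP h.
  have := congr1 (modn^~ n) h; rewrite !modnMDl !modn_small // => /val_inj->.
  have := congr1 (divn^~ n) h; have n0 : 0 < n by exact: leq_ltn_trans (ltn_ord u).
  by rewrite !divnMDl // !divn_small // !addn0 => /val_inj->.
by exists u; apply/existsP; exists v; rewrite eqxx.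
Qed.

Lemma adjacency_code_ge n (e : rel 'I_n) b : n * n <= b -> adjacency_code e b = 0.
Proof.
move=> nb; rewrite /adjacency_code; case: existsP => // -[u /existsP[v /andP[/eqP h _]]].
have := ltn_ord u; have := ltn_ord v; nia.
Qed.

(** * Reading the adjacency matrix and writing the schedule *)

Section Machine.
Variable K : nat.
Hypothesis K_ge : 6 < K.

Let K_gt1 : 1 < K. Proof. exact: leq_ltn_trans K_ge. Qed.

Let pc := Read (Const 0).
Let spare := Add pc (Const 2).

(** The end of the input is not known before [n * n] is computed, and this takes two registers at
    known addresses. Irreflexivity provides them: registers 1 and [n + 2] hold the diagonal entries
    (0,0) and (1,1), hence 0; for [n <= 1] register [n + 2] lies beyond the matrix. The matrix is
    then copied above itself into array 0. *)
Definition load_program : program :=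
  Seq (While (Defs.Sub pc (Read spare))
        (Seq (Write (Const 1) (Add (Read (Const 1)) pc))
             (Write spare (Add (Read spare) (Const 1)))))
  (Seq (Write spare (Const 0))
  (Seq (Write (Const 1) (Add (Read (Const 1)) (Const 2)))
  (Seq (While (Defs.Sub (Read (Const 1)) (Add (Const 2) (var K 0)))
        (Seq (Write (entry K 2 (var K 0)) (Read (Add (Const 1) (var K 0))))
             (Write (var_addr K 0) (Add (var K 0) (Const 1)))))
    (Write (entry K 2 (Const 0)) (Const 0))))).

Lemma load_program_correct n (e : rel 'I_n) : irreflexive e ->
  exists t m, [/\ runs load_program (graph_memory e) t m, t <= 20 * n.+1 ^ 2
    & represents K n (n * n + 2) [::] (fun=> 0) (input_store e) m].
Proof.
move=> irr; set m0 := graph_memory e.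
have m0S b : m0 b.+1 = adjacency_code e b by [].
have diag u : u < n -> adjacency_code e (u * n + u) = 0.
  by move=> un; rewrite -[u]/(nat_of_ord (Ordinal un)) adjacency_codeE irr.
have m01 : m0 1 = 0.
  rewrite m0S; case: (posnP n) => [n0|n0]; first by rewrite adjacency_code_ge ?n0.
  exact: (diag 0).
have m02 : m0 (n + 2) = 0.
  rewrite addn2 m0S; case: (ltnP 1 n) => [n1|n1]; last by rewrite adjacency_code_ge //; nia.
  by have := diag 1 n1; rewrite mul1n addn1.
pose inv1 i (m : memory) := forall b, m b =
  if b == 1 then i * n else if b == n + 2 then i else m0 b.
have n21 : (n + 2 == 1) = false by lia.
have n20 : (0 == n + 2) = false by lia.
have [|||t1 [m1 [r1 b1 i1]]] := @while_loop n 2 (Defs.Sub pc (Read spare))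
    (Seq (Write (Const 1) (Add (Read (Const 1)) pc))
         (Write spare (Add (Read spare) (Const 1)))) inv1 _ _ m0.
- move=> i m lt im.
  have [q0 q1 q2] : [/\ m 0 = n, m 1 = i * n & m (n + 2) = i].
    by split; rewrite im ?eqxx ?n21 ?n20.
  split; first by rewrite /= q0 q2; lia.
  exists (1 + 1), (update (update m 1 (i.+1 * n)) (n + 2) i.+1); split=> //.
    apply: (RunSeq (m' := update m 1 (i.+1 * n))).
      by have := RunWrite (Const 1) (Add (Read (Const 1)) pc) m; rewrite /= q0 q1 addnC -mulSn.
    set m' := update m 1 _.
    have e0 : m' 0 = n by rewrite /m' /update /= q0.
    have e2 : m' (n + 2) = i by rewrite /m' /update n21 q2.
    have := RunWrite spare (Add (Read spare) (Const 1)) m'.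
    by rewrite /= e0 e2 addn1.
  move=> b; rewrite /update; case: (eqVneq b 1) => [->|b1]; first by rewrite eq_sym n21.
  by case: eqP => // b2; rewrite im (negbTE b1); case: eqP.
- by move=> m im; rewrite /= (im 0) /= n20 /= im n21 eqxx subnn.
- by move=> b; rewrite mul0n; case: eqP => [->//|_]; case: eqP => [->|].
pose B := n * n + 2.
pose m3 := update (update m1 (n + 2) 0) 1 B.
have m3E b : m3 b = if b == 1 then B else m0 b.
  rewrite /m3 /update; case: (eqVneq b 1) => // nb1.
  by case: (eqVneq b (n + 2)) => [->//|nb2]; rewrite i1 (negbTE nb1) (negbTE nb2).
have m1_0 : m1 0 = n by rewrite i1 /= n20.
have r2 : runs (Write spare (Const 0)) m1 1 (update m1 (n + 2) 0).
  by have := RunWrite spare (Const 0) m1; rewrite /= m1_0.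
have r3 : runs (Write (Const 1) (Add (Read (Const 1)) (Const 2))) (update m1 (n + 2) 0) 1 m3.
  have := RunWrite (Const 1) (Add (Read (Const 1)) (Const 2)) (update m1 (n + 2) 0).
  rewrite /= /update /=; have -> : (1 == n + 2) = false by lia.
  by rewrite i1.
(* Register 1 now holds the base, so the copy of entry 0 is wrong until the last instruction resets
   it to 0. *)
pose sgi i : store := fun a j =>
  if (a == 0) && (j < i) then (if j == 0 then B else adjacency_code e j) else 0.
pose inv2 i m := represents K n B [:: 0] (update (fun=> 0) 0 i) (sgi i) m /\
  (forall b, 0 < b < n * n -> m (1 + b) = adjacency_code e b).
have cellB a j : B <= cell K B a j by rewrite leq_addr.
have upd0 i : update (fun=> 0) 0 i 0 = i by [].
have [|||t4 [m4 [r4 b4 [rep4 _]]]] := @while_loop (n * n) 2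
    (Defs.Sub (Read (Const 1)) (Add (Const 2) (var K 0)))
    (Seq (Write (entry K 2 (var K 0)) (Read (Add (Const 1) (var K 0))))
             (Write (var_addr K 0) (Add (var K 0) (Const 1)))) inv2 _ _ m3.
- move=> i m lt [rep low].
  have ev : eval m (var K 0) = i by rewrite (eval_var _ _ (rep_base rep)) (rep_var rep) ?inE.
  split.
    rewrite -[eval m _]/(m 1 - (2 + eval m (var K 0))) ev (rep_base rep) /B; lia.
  have rdl : m (1 + i) = (if i == 0 then B else adjacency_code e i).
    by case: eqP => [->|i0]; [rewrite (rep_base rep)|rewrite low //; lia].
  set v := m (1 + i) in rdl.
  have K2 : 2 < K by apply: leq_ltn_trans K_ge.
  have rep1 := represents_set K_gt1 i v rep K2.
  set m' := update m (cell K B 2 i) v in rep1.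
  have rep2 : represents K n B [:: 0] (update (fun=> 0) 0 i.+1) (store_set (sgi i) 0 i v)
      (update m' (cell K B 1 0) i.+1).
    exact: (represents_bind K_gt1 i.+1 (represents_unbind rep1 isT) isT).
  exists (1 + 1), (update m' (cell K B 1 0) i.+1); split=> //.
    apply: (RunSeq (m' := m')).
      have := run_write 2 (var K 0) (Read (Add (Const 1) (var K 0))) rep.
      by rewrite -[eval m (Read _)]/(m (1 + eval m (var K 0))) ev.
    have := run_write 1 (Const 0) (Add (var K 0) (Const 1)) rep1.
    rewrite -[eval m' (Add _ _)]/(eval m' (var K 0) + 1).
    by rewrite (eval_var _ _ (rep_base rep1)) (rep_var rep1) ?inE // upd0 addn1.
  split.
    case: rep2 => h0 h1 hB hv ha; split=> // a j aK; rewrite ha // /store_set /sgi.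
    case: (eqVneq a 0) => //= a0; case: (eqVneq j i) => [->|ji]; first by rewrite ltnSn rdl.
    by rewrite ltnS [j <= i]leq_eqVlt (negbTE ji).
  move=> b hb; rewrite /m' /update !ifN ?low //; have := cellB 1 0; have := cellB 2 i.
    by rewrite /B; lia.
  by rewrite /B; lia.
- move=> m [rep _].
  have ev : eval m (var K 0) = n * n.
    by rewrite (eval_var _ _ (rep_base rep)) (rep_var rep) ?inE.
  by rewrite -[eval m _]/(m 1 - (2 + eval m (var K 0))) ev (rep_base rep) /B addnC subnn.
- have far b : B <= b -> m3 b = 0.
    rewrite m3E /B; case: b => [|b] hb; first by lia.
    have -> : (b.+1 == 1) = false by lia.
    by rewrite m0S adjacency_code_ge //; lia.
  split; last by move=> b hb; rewrite m3E /=; have -> : (1 + b == 1) = false by lia.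
  split=> //; rewrite ?m3E //.
  + by rewrite /B addnC.
  + by move=> x; rewrite inE => /eqP->; rewrite far.
  + by move=> a j aK; rewrite far // /sgi andbF.
have K2 : 2 < K by apply: leq_ltn_trans K_ge.
have rep5 := represents_set K_gt1 0 0 (represents_unbind rep4 isT) K2.
exists (t1 + (1 + (1 + (t4 + 1)))); eexists; split.
- apply: RunSeq r1 _; apply: RunSeq r2 _; apply: RunSeq r3 _; apply: RunSeq r4 _.
  exact: (run_write 2 (Const 0) (Const 0) rep4).
- by move: b1 b4; nia.
case: rep5 => h0 h1 hB hv ha; split=> // a j aK; rewrite ha // /store_set /sgi /input_store.
case: (eqVneq a 0) => //= a0; case: (eqVneq j 0) => [->|j0] /=.
  case: (posnP n) => [n0|n0]; first by rewrite adjacency_code_ge // n0.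
  by rewrite -[0]/(0 * n + 0) diag.
by case: ltnP => // jn; rewrite adjacency_code_ge.
Qed.

(* The loop variables live beyond the end of the output, at the address held by register 0,
  since the output overwrites all registers used so far. *)
Definition store_program : program :=
  let total := Read (entry K 6 (Const 0)) in
  let z k := entry K 5 (Add total (Const k)) in
  let p k := Read (Add pc (Const (K * k))) in
  Seq (Write (z 1) (Const 0))
  (Seq (Write (z 2) total)
  (Seq (Write (z 3) (entry K 4 (Const 0)))
  (Seq (Write (z 4) (Read (entry K 3 (Const 0))))
  (Seq (Write (Const 0) (z 1))
  (Seq (While (Defs.Sub (p 1) (p 0))
    (Seq (Write (Add (Const 1) (p 0)) (Read (Add (p 2) (scale K (p 0)))))
         (Write pc (Add (p 0) (Const 1)))))
    (Write (Const 0) (p 3))))))).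

Lemma store_program_correct n B sg m : represents K n B [::] (fun=> 0) sg m ->
  exists t m', [/\ runs store_program m t m', t <= 3 * sg 4 0 + 8, m' 0 = sg 1 0
    & forall x, x < sg 4 0 -> m' (1 + x) = sg 2 x].
Proof.
move=> rep; set T := sg 4 0.
have K5 : 3.+2 < K by apply: leq_ltn_trans K_ge.
have K6 : 4.+2 < K by [].
have K3 : 1.+2 < K by apply: leq_ltn_trans K_ge.
have K4 : 2.+2 < K by apply: leq_ltn_trans K_ge.
pose total := Read (entry K 6 (Const 0)).
pose z k := entry K 5 (Add total (Const k)).
have ztot sg' m' : represents K n B [::] (fun=> 0) sg' m' -> sg' 4 0 = T ->
    eval m' total = T.
  by move=> r' e4; rewrite -[LHS]/(m' (eval m' (entry K 6 (Const 0)))) eval_entry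
    (rep_base r') (rep_arr r').
have step sg' m' k (v : expr) : represents K n B [::] (fun=> 0) sg' m' -> sg' 4 0 = T ->
    exists m'', [/\ runs (Write (z k) v) m' 1 m'',
      represents K n B [::] (fun=> 0) (store_set sg' 3 (T + k) (eval m' v)) m''
      & m'' = update m' (cell K B 5 (T + k)) (eval m' v)].
  move=> r' e4; have := run_write 5 (Add total (Const k)) v r'.
  rewrite -[eval m' (Add _ _)]/(eval m' total + k) (ztot _ _ r' e4) => w.
  by eexists; split; [exact: w|exact: represents_set|].
have [m1 [r1 rep1 _]] := step _ _ 1 (Const 0) rep erefl.
have [m2 [r2 rep2 _]] := step _ _ 2 total rep1 erefl.
have [m3 [r3 rep3 _]] := step _ _ 3 (entry K 4 (Const 0)) rep2 erefl.
have [m4 [r4 rep4 _]] := step _ _ 4 (Read (entry K 3 (Const 0))) rep3 erefl.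
rewrite (ztot _ _ rep1 erefl) in rep2.
rewrite (ztot _ _ rep1 erefl) eval_entry (rep_base rep2) [eval m2 _]/= in rep3.
rewrite (ztot _ _ rep1 erefl) eval_entry (rep_base rep2) [eval m2 _]/= in rep4.
rewrite -[eval m3 (Read _)]/(m3 (eval m3 (entry K 3 (Const 0)))) eval_entry in rep4.
rewrite (rep_base rep3) [eval m3 _]/= (rep_arr rep3 0 K3) in rep4.
pose Z := cell K B 5 (T + 1).
pose m5 := update m4 0 Z.
have r5 : runs (Write (Const 0) (z 1)) m4 1 m5.
  have := RunWrite (Const 0) (z 1) m4; rewrite eval_entry (rep_base rep4).
  by rewrite -[eval m4 (Add _ _)]/(eval m4 total + 1) (ztot _ _ rep4 erefl).
have B1 := rep_base_ge rep.
have ZK k : Z + K * k = cell K B 5 (T + 1 + k) by rewrite /Z /cell; nia.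
have Zbig k : T + 1 < cell K B 5 (T + 1 + k) by rewrite /cell; nia.
(* Entry [x] is read from an address above [x + 2], so writing register [1 + i] destroys no entry
   that is still to be read. *)
have outbig x : x + 2 < cell K B 4 x by rewrite /cell; nia.
have ne k x : (cell K B 4 x == cell K B 5 k) = false by rewrite cell_inj.
pose inv i (m' : memory) := [/\ m' 0 = Z,
  [/\ m' Z = i, m' (Z + K * 1) = T, m' (Z + K * 2) = cell K B 4 0 & m' (Z + K * 3) = sg 1 0],
  forall x, i <= x -> m' (cell K B 4 x) = sg 2 x & forall x, x < i -> m' (1 + x) = sg 2 x].
pose p k := Read (Add pc (Const (K * k))).
have [|||t6 [m6 [r6 b6 [i0 [i1 i2 i3 i4] i5 i6]]]] := @while_loop T 2 (Defs.Sub (p 1) (p 0))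
  (Seq (Write (Add (Const 1) (p 0)) (Read (Add (p 2) (scale K (p 0)))))
         (Write pc (Add (p 0) (Const 1)))) inv _ _ m5.
- move=> i m' lt [i0 [i1 i2 i3 i4] i5 i6].
  have ep0 : eval m' (p 0) = i by rewrite /= i0 muln0 addn0.
  have ep1 : eval m' (p 1) = T by rewrite /= i0.
  split; first by rewrite -[eval m' _]/(eval m' (p 1) - eval m' (p 0)) ep0 ep1; lia.
  have ev : eval m' (Read (Add (p 2) (scale K (p 0)))) = sg 2 i.
    rewrite -[LHS]/(m' (eval m' (p 2) + eval m' (scale K (p 0)))) eval_scale ep0.
    rewrite [eval m' (p 2)]/= i0 i3 -(i5 i) //; congr (m' _); rewrite /cell; lia.
  set m1' := update m' (1 + i) (sg 2 i).
  have Zbig0 := Zbig 0; rewrite addn0 -/Z in Zbig0.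
  have Zb1 := Zbig 1; have Zb2 := Zbig 2; have Zb3 := Zbig 3.
  rewrite -ZK in Zb1; rewrite -ZK in Zb2; rewrite -ZK in Zb3.
  have m10 : m1' 0 = Z by rewrite /m1' /update /= i0.
  have m1Z : m1' Z = i by rewrite /m1' /update ifN //; lia.
  exists (1 + 1), (update m1' Z i.+1); split=> //.
    apply: (RunSeq (m' := m1')).
      have := RunWrite (Add (Const 1) (p 0)) (Read (Add (p 2) (scale K (p 0)))) m'.
      by rewrite ev -[eval m' (Add _ _)]/(1 + eval m' (p 0)) ep0.
    have := RunWrite pc (Add (p 0) (Const 1)) m1'.
    by rewrite -[eval m1' (Add _ _)]/(m1' (m1' 0 + K * 0) + 1) muln0 addn0 m10 m1Z addn1 /= m10.
  have Kpos : 0 < K by exact: leq_ltn_trans K_ge.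
  split; first by rewrite /update ifN ?m10 //; lia.
  + split; first by rewrite /update eqxx.
    * by rewrite /update ifN /m1' /update ?ifN ?i2 //; lia.
    * by rewrite /update ifN /m1' /update ?ifN ?i3 //; lia.
    * by rewrite /update ifN /m1' /update ?ifN ?i4 //; lia.
  + move=> x ix; rewrite /update /Z ne /m1' /update ifN ?i5 //; first exact: ltnW.
    by have := outbig x; lia.
  + move=> x; rewrite ltnS leq_eqVlt /update => /orP[/eqP->|xi].
      by rewrite ifN /m1' /update ?eqxx //; lia.
    by rewrite ifN /m1' /update ?ifN ?i6 //; lia.
- by move=> m' [i0 [i1 i2 i3 i4] _ _]; rewrite /= i0 i2 muln0 addn0 i1 subnn.
- have arr4 a j : a.+2 < K -> m5 (cell K B a.+2 j) = _ := fun aK =>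
    etrans (ifN _ _ (negbT (cell_gt K_gt1 a.+2 j B1).1)) (rep_arr rep4 j aK).
  split; first by rewrite /m5 /update eqxx.
  + by split; rewrite ?ZK /Z arr4 // /store_set /= -?addnA ?eqn_add2l //=.
  + by move=> x _; rewrite arr4.
  + by [].
exists (1 + (1 + (1 + (1 + (1 + (t6 + 1)))))), (update m6 0 (sg 1 0)); split.
- do 5![apply: RunSeq; first eassumption]; apply: RunSeq r6 _.
  by have := RunWrite (Const 0) (p 3) m6; rewrite /= i0 i4.
- by move: b6; lia.
- by rewrite /update eqxx.
- by move=> x xT; rewrite /update /= i6.
Qed.

End Machine.

(* [s] computes the number of rounds and the concatenated rows of a schedule. *)
Theorem machine (K : nat) (s : stmt) (C D : nat) : 6 < K -> scope_stmt K [::] s ->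
  exists (P : program) (c d : nat), forall n (e : rel 'I_n), irreflexive e ->
    let sg := sexec n (fun=> 0) (input_store e) s in
    sg 1 0 <= C * n.+1 ^ D ->
    exists t m, [/\ runs P (graph_memory e) t m, t <= c * n.+1 ^ d, m 0 = sg 1 0
      & forall x, x < n * sg 1 0 -> m (1 + x) = sg 2 x].
Proof.
move=> K6 scs.
(* The number of output cells is the number of rounds times [n]; a sum of [n] equal terms stands for
   this product. *)
pose s' := SSeq s (SAsg 4 (TCst 0) (TSum 0 (TArr 1 (TCst 0)))).
have K1 : 1 < K by exact: leq_ltn_trans K6.
have K2 : 3 < K by exact: leq_ltn_trans K6.
have [|c [k hc]] := @compile_stmt_correct K K1 s' [::]; first by rewrite /= scs K6 K2.
exists (Seq (load_program K) (Seq (compile_stmt K s') (store_program K))).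
exists (20 + c + 3 * C + 8), (2 + k + D.+1) => n e irr sg small.
have [t1 [m1 [r1 b1 rep1]]] := load_program_correct K6 irr.
have [t2 [m2 [r2 b2 rep2]]] := hc _ _ _ _ _ rep1.
have [t3 [m3 [r3 b3 h0 h1]]] := store_program_correct K6 rep2.
have tot : sexec n (fun=> 0) (input_store e) s' 4 0 = n * sg 1 0.
  by rewrite /= /store_set /= sum_nat_const card_ord.
exists (t1 + (t2 + t3)), m3; split.
- exact: RunSeq r1 (RunSeq r2 r3).
- have [l1 l2 l3] : [/\ n.+1 ^ 2 <= n.+1 ^ (2 + k + D.+1), n.+1 ^ k <= n.+1 ^ (2 + k + D.+1)
      & n.+1 ^ D.+1 <= n.+1 ^ (2 + k + D.+1)].
    by split; rewrite leq_pexp2l //; lia.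
  have l4 : n * sg 1 0 <= C * n.+1 ^ D.+1.
    rewrite expnS mulnCA; apply: leq_mul => //.
  have pos := expn_gt0 n.+1 (2 + k + D.+1); move: b1 b2 b3 l1 l2 l3 l4; rewrite tot /= in pos *.
  by nia.
- by rewrite h0.
- by move=> x xn; rewrite h1 ?tot.
Qed.

(** * Gathering schedules *)

Section Gathering.
Variables (V : finType) (e : rel V).
Hypothesis esym : symmetric e.

(** Stable under reversing all arcs, as [e] is symmetric. So the same set serves as a round in which
    the sources transmit and, when time runs backwards, as one in which the targets do. *)
Definition conflict_free (A : {set V * V}) : Prop :=
  (forall a, a \in A -> e a.1 a.2) /\
  (forall a b, a \in A -> b \in A -> a != b -> ~~ e a.1 b.2).

Definition sources (A : {set V * V}) : {set V} := [set a.1 | a in A].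
Definition targets (A : {set V * V}) : {set V} := [set a.2 | a in A].

Fixpoint flow (As : seq {set V * V}) (x z : V) : bool :=
  if As is A :: As' then [exists y, ((y == x) || ((x, y) \in A)) && flow As' y z]
  else x == z.

Lemma flow_cat As Bs x y z : flow As x y -> flow Bs y z -> flow (As ++ Bs) x z.
Proof.
elim: As x => [|A As IH] x /=; first by move/eqP->.
case/existsP => w /andP[xw wy] yz; apply/existsP; exists w.
by rewrite xw IH.
Qed.

Lemma flow_refl As x : flow As x x.
Proof. by elim: As => //= A As IH; apply/existsP; exists x; rewrite eqxx. Qed.

Lemma flow_step (As : seq {set V * V}) A x y : A \in As -> (x, y) \in A -> flow As x y.
Proof.
elim: As => // B As IH; rewrite inE => /orP[/eqP<-|AAs] xy; apply/existsP.
  by exists y; rewrite xy orbT; exact: flow_refl.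
by exists x; rewrite eqxx; exact: IH.
Qed.

Lemma hears_sources (A : {set V * V}) u v : conflict_free A -> (u, v) \in A ->
  hears e (sources A) u v.
Proof.
move=> [eA cA] uv; have euv := eA _ uv.
apply/and3P; split=> //; first by apply/imsetP; exists (u, v).
apply/cards1P; exists u; apply/setP => w; rewrite !inE.
apply/andP/eqP => [[/imsetP[[w1 w2] wA /= ->] ewv]|->]; last first.
  by split=> //; apply/imsetP; exists (u, v).
have [[] //|ne] := eqVneq (w1, w2) (u, v).
by have := cA _ _ wA uv ne; rewrite ewv.
Qed.

Lemma hears_targets (A : {set V * V}) u v : conflict_free A -> (u, v) \in A ->
  hears e (targets A) v u.
Proof.
move=> [eA cA] uv; have euv := eA _ uv.
apply/and3P; split; [by apply/imsetP; exists (u, v)|by rewrite esym|].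
apply/cards1P; exists v; apply/setP => w; rewrite !inE.
apply/andP/eqP => [[/imsetP[[w1 w2] wA /= ->] ewv]|->]; last first.
  by split; [apply/imsetP; exists (u, v)|rewrite esym].
have [[] //|ne] := eqVneq (u, v) (w1, w2).
by have := cA _ _ uv wA ne; rewrite /= esym ewv.
Qed.

Lemma knowledge_forward (As : seq {set V * V}) (K : V -> {set V}) w x z : (forall A, A \in As ->
  conflict_free A) ->
  flow As x z -> w \in K x -> w \in foldl (radio_round e) K [seq sources A | A <- As] z.
Proof.
elim: As K x => [|A As IH] K x cf /=; first by move/eqP->.
case/existsP => y /andP[xy yz] wK; apply: (IH _ y) => //.
  by move=> B BAs; apply: cf; rewrite inE BAs orbT.
rewrite /radio_round inE; case/orP: xy => [/eqP->|xy]; first by rewrite wK.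
apply/orP; right; apply/bigcupP; exists x => //.
by apply: hears_sources => //; apply: cf; rewrite inE eqxx.
Qed.

Lemma knowledge_backward (As : seq {set V * V}) (K : V -> {set V}) w x z : (forall A, A \in As ->
  conflict_free A) ->
  flow As x z -> w \in K z ->
  w \in foldl (radio_round e) K (rev [seq targets A | A <- As]) x.
Proof.
elim: As x => [|A As IH] x cf /=; first by move/eqP->.
case/existsP => y /andP[xy yz] wK; rewrite rev_cons foldl_rcons.
have cf' B : B \in As -> conflict_free B by move=> BAs; apply: cf; rewrite inE BAs orbT.
have {}IH := IH y cf' yz wK.
rewrite /radio_round inE; case/orP: xy => [/eqP<-|xy]; first by rewrite IH.
apply/orP; right; apply/bigcupP; exists y.
  by apply: hears_targets => //; apply: cf; rewrite inE eqxx.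
exact: IH.
Qed.

Lemma gather_gossip (As : seq {set V * V}) z : (forall A, A \in As -> conflict_free A) ->
  (forall x, flow As x z) ->
  completes_gossip e ([seq sources A | A <- As] ++ rev [seq targets A | A <- As]).
Proof.
move=> cf fl u v; rewrite /knowledge foldl_cat.
apply: (knowledge_backward cf (fl v)); apply: (knowledge_forward cf (fl u)).
by rewrite inE.
Qed.

(** Knowledge evolves linearly in the initial knowledge. The rounds after the first can therefore be
    treated as a schedule of their own that starts from singletons. *)
Lemma foldl_round_linear s (K : V -> {set V}) r :
  foldl (radio_round e) K s r = \bigcup_(y in knowledge e s r) K y.
Proof.
elim: s K r => [|T s IH] K r; first by rewrite /knowledge /= big_set1.
rewrite /knowledge /= !IH; apply/setP => w; apply/bigcupP/bigcupP => -[y].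
  move=> yk; rewrite /radio_round inE => /orP[wK|/bigcupP[u uy wK]].
    by exists y => //; apply/bigcupP; exists y => //; rewrite !inE eqxx.
  exists u => //; apply/bigcupP; exists y => //; rewrite inE; apply/orP; right.
  by apply/bigcupP; exists u; rewrite ?inE.
case/bigcupP => z zk; rewrite /radio_round inE => /orP[|/bigcupP[u uz]].
  by rewrite inE => /eqP-> wK; exists z => //; rewrite inE wK.
rewrite inE => /eqP-> wK; exists z => //; rewrite inE; apply/orP; right.
by apply/bigcupP; exists u.
Qed.

Lemma knowledge_cons T s r u : u \in knowledge e (T :: s) r ->
  exists2 y, y \in knowledge e s r & (y == u) || hears e T u y.
Proof.
rewrite /knowledge /= foldl_round_linear => /bigcupP[y yk].
rewrite /radio_round !inE => /orP[/eqP->|/bigcupP[u' uy]]; first by exists y => //; rewrite eqxx.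
by rewrite inE => /eqP->; exists y => //; rewrite uy orbT.
Qed.

Lemma foldl_round_ext s (K K' : V -> {set V}) : K =1 K' ->
  foldl (radio_round e) K s =1 foldl (radio_round e) K' s.
Proof. by move=> h r; rewrite !foldl_round_linear; apply: eq_bigr => y _; rewrite h. Qed.

(* Rounds in which nobody learns anything can be dropped. *)
Lemma prune_schedule s (K : V -> {set V}) : exists s',
  foldl (radio_round e) K s' =1 foldl (radio_round e) K s /\
  size s' + \sum_v #|K v| <= \sum_v #|foldl (radio_round e) K s v|.
Proof.
elim: s K => [|T s IH] K; first by exists [::].
have sub v : K v \subset radio_round e K T v by exact: subsetUl.
have [/forallP same|] := boolP [forall v, K v == radio_round e K T v].
  have eqK : K =1 radio_round e K T by move=> v; apply/eqP.
  have [s' [h1 h2]] := IH K; exists s'; split=> [v|].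
    by rewrite h1 /= -(foldl_round_ext s eqK).
  apply: leq_trans h2 _; apply: leq_sum => v _.
  by rewrite /= (foldl_round_ext s eqK).
rewrite negb_forall => /existsP[v nv].
have [s' [h1 h2]] := IH (radio_round e K T); exists (T :: s'); split=> [w|]; first exact: h1.
apply: leq_trans h2; rewrite /= addSn -addnS leq_add2l.
rewrite (bigD1 v) //= [leqRHS](bigD1 v) //= -addSn leq_add //.
  by apply: proper_card; rewrite properEneq nv sub.
by apply: leq_sum => w _; rewrite subset_leq_card.
Qed.

(** There are [#|V| * #|V|] pairs of a node and a message; [#|V|] of them are known initially and
    every round kept by pruning adds at least one. Hence the optimum is among the guesses below
    [n * n]. *)
Lemma optimal_length_bound k : is_optimal_length e k -> k + #|V| <= #|V| * #|V|.
Proof.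
move=> [[s cs <-] opt]; have [s' [h1 h2]] := prune_schedule s (fun v => [set v]).
have /opt le : completes_gossip e s' by move=> u v; rewrite /knowledge h1; exact: cs.
have e1 : \sum_v #|[set v] : {set V}| = #|V|.
  by rewrite -sum1_card; apply: eq_bigr => v _; rewrite cards1.
rewrite e1 in h2; apply: leq_trans (leq_add le (leqnn _)) (leq_trans h2 _).
by rewrite -sum_nat_const; apply: leq_sum => v _; exact: max_card.
Qed.

Definition stay_or_move : rel V := fun u v => (u == v) || e u v.

Fixpoint walk_cost (W : nat -> V -> nat) (x : V) (p : seq V) : nat :=
  W 0 x + (if p is y :: p' then walk_cost (fun t => W t.+1) y p' else 0).

Lemma walk_cost_rcons W x p v :
  walk_cost W x (rcons p v) = walk_cost W x p + W (size p).+1 v.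
Proof. by elim: p W x => [|y p IH] W x /=; rewrite ?addn0 // IH addnA. Qed.

(* Following an optimal schedule, the tokens in [X] merge in pairs; the pairs use disjoint
  nodes of the time-expanded graph, so some pair of tokens meets cheaply.  The induction
  carries the cost [a x] already paid by token [x]. *)
Lemma cheap_pair c s r (X : {set V}) (W : nat -> V -> nat) (a : V -> nat) :
    {subset X <= knowledge e s r} ->
    (forall x x' p p', x \in X -> x' \in X -> x != x' ->
       path stay_or_move x p -> path stay_or_move x' p' ->
       size p = size p' -> size p <= size s -> last x p = last x' p' ->
       c <= a x + a x' + (walk_cost W x p + walk_cost W x' p')) ->
  c * #|X|.-1 <= 2 * (\sum_(x in X) (a x + W 0 x)
                     + 2 * \sum_(1 <= t < (size s).+1) \sum_v W t v).
Proof.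
elim: s X W a => [|T s IH] X W a know pairs.
  have : #|X| <= 1.
    apply: leq_trans (_ : #|[set r]| <= 1); last by rewrite cards1.
    by apply/subset_leq_card/subsetP => x /know; rewrite /knowledge /= inE.
  by case: #|X| => [|[]] //; rewrite muln0.
(* The token [x] waits or moves to a node that hears it in the first round, chosen so that the
   remaining rounds still bring it to [r]. *)
pose nxt x := odflt x [pick y in knowledge e s r | (y == x) || hears e T x y].
have nxtP x : x \in X -> nxt x \in knowledge e s r /\
    ((nxt x == x) || hears e T x (nxt x)).
  move=> /know/knowledge_cons[y yk xy]; rewrite /nxt; case: pickP => [z /andP[]//|/(_ y)].
  by rewrite yk xy.
have nxt_step x : x \in X -> stay_or_move x (nxt x).
  move=> /nxtP[_ /orP[/eqP->|/and3P[_ h _]]]; first by rewrite /stay_or_move eqxx.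
  by rewrite /stay_or_move h orbT.
pose pre y := [set x in X | nxt x == y].
(* A node receives from one neighbour at most, so only its own token and one other can end up
   there. *)
have pre_le y : #|pre y| <= 2.
  have [u hu|nohear] := pickP (fun u => hears e T u y).
    apply: leq_trans (_ : #|[set y; u]| <= 2); last by rewrite cards2; case: eqP.
    apply/subset_leq_card/subsetP => x; rewrite !inE => /andP[xX /eqP xy].
    have [_] := nxtP x xX; rewrite xy => /orP[/eqP->|]; first by rewrite eqxx.
    case/and3P: hu => uT uy /cards1P[w ew] /and3P[xT xy' _].
    have : u \in [set w] by rewrite -ew inE uT.
    have : x \in [set w] by rewrite -ew inE xT.
    by rewrite !inE => /eqP-> /eqP->; rewrite eqxx orbT.
  apply: leq_trans (_ : #|[set y]| <= 2); last by rewrite cards1.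
  apply/subset_leq_card/subsetP => x; rewrite !inE => /andP[xX /eqP xy].
  by have [_] := nxtP x xX; rewrite xy nohear orbF => /eqP->.
pose G y := \sum_(x in pre y) (a x + W 0 x).
pose Y1 := [set y | #|pre y| == 1]; pose Y2 := [set y | #|pre y| == 2].
have sumX (g : V -> nat) : \sum_(x in X) g x = \sum_y \sum_(x in pre y) g x.
  rewrite (partition_big nxt predT) //=; apply: eq_bigr => y _.
  by apply: eq_bigl => x; rewrite inE.
have split12 (g : V -> nat) : (forall y, #|pre y| = 0 -> g y = 0) ->
    \sum_y g y = \sum_(y in Y1) g y + \sum_(y in Y2) g y.
  move=> g0; rewrite [\sum_(y in Y1) _]big_mkcond [\sum_(y in Y2) _]big_mkcond -big_split /=.
  apply: eq_bigr => y _; rewrite !inE; have := pre_le y; have := g0 y.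
  by case: #|pre y| => [|[|[|]]] //= h _; rewrite ?addn0 //; exact: h.
have cardX : #|X| = #|Y1| + 2 * #|Y2|.
  rewrite -sum1_card sumX split12 => [|y /eqP]; last first.
    by rewrite cards_eq0 => /eqP->; rewrite big_set0.
  congr (_ + _); first by rewrite -sum1_card; apply: eq_bigr => y; rewrite inE sum1_card => /eqP.
  rewrite mulnC -sum_nat_const; apply: eq_bigr => y; rewrite inE sum1_card => /eqP//.
have sumG : \sum_(x in X) (a x + W 0 x) = \sum_(y in Y1) G y + \sum_(y in Y2) G y.
  rewrite sumX split12 // => y /eqP.
  by rewrite cards_eq0 => /eqP->; rewrite big_set0.
(* Two tokens at the same node form a pair and leave the game. Only lone tokens are followed
   further, so a node at a given time is charged by at most two tokens. *)
have pair2 y : y \in Y2 -> c <= G y + 2 * W 1 y.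
  rewrite inE => /cards2P[x [x' [xx' prey]]].
  have [] : x \in pre y /\ x' \in pre y by rewrite prey !inE !eqxx orbT.
  rewrite !inE => /andP[xX /eqP xy] /andP[x'X /eqP x'y].
  have := pairs x x' [:: y] [:: y] xX x'X xx'.
  rewrite /= -{1}xy nxt_step // -{1}x'y nxt_step //= => /(_ isT isT erefl isT erefl).
  rewrite /G prey big_setU1 ?inE //= big_set1; lia.
have sub1 : {subset Y1 <= knowledge e s r}.
  move=> y; rewrite inE => /cards1P[x prey].
  have : x \in pre y by rewrite prey inE.
  by rewrite inE => /andP[xX /eqP<-]; have [] := nxtP x xX.
have := IH Y1 (fun t => W t.+1) G sub1 _.
have -> : \sum_(1 <= t < (size s).+1) \sum_v W t.+1 v = \sum_(2 <= t < (size s).+2) \sum_v W t v.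
  by rewrite [RHS]big_add1.
move=> /(_ _)-bound.
have {bound} : c * #|Y1|.-1 <= 2 * (\sum_(x in Y1) (G x + W 1 x) +
    2 * \sum_(2 <= t < (size s).+2) \sum_v W t v).
  apply: bound => y y' p p'; rewrite !inE => /cards1P[x prey] /cards1P[x' prey'] ny py py' sp lp
    lst.
  have : x \in pre y by rewrite prey inE.
  rewrite inE => /andP[xX /eqP xy].
  have : x' \in pre y' by rewrite prey' inE.
  rewrite inE => /andP[x'X /eqP x'y'].
  have nx : x != x' by apply: contra ny => /eqP E; rewrite -xy -x'y' E.
  have := pairs x x' (y :: p) (y' :: p') xX x'X nx.
  rewrite /= py py' -{1}xy nxt_step // -{1}x'y' nxt_step // sp.
  move=> /(_ isT isT erefl); rewrite -sp ltnS => /(_ lp lst).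
  rewrite /G prey prey' !big_set1; lia.
have h2 : c * #|Y2| <= \sum_(y in Y2) G y + 2 * \sum_(y in Y2) W 1 y.
  rewrite mulnC -sum_nat_const big_distrr -big_split /=; exact: leq_sum.
have h1 : \sum_(y in Y1) W 1 y + \sum_(y in Y2) W 1 y <= \sum_v W 1 v.
  rewrite [\sum_(y in Y1) _]big_mkcond [\sum_(y in Y2) _]big_mkcond -big_split /=.
  by apply: leq_sum => y _; rewrite !inE; case: #|pre y| => [|[|[|]]] //=; rewrite addn0.
rewrite big_split /= [\sum_(1 <= t < _) _]big_ltn // sumG cardX.
have : c * (#|Y1| + 2 * #|Y2|).-1 <= c * #|Y1|.-1 + 2 * (c * #|Y2|).
  case: #|Y1| => [|k] /=; last by rewrite mulnDr; lia.
  by rewrite add0n muln0 add0n mulnCA leq_mul2l leq_pred orbT.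
move: h1 h2; move: (\sum_(y in Y1) G y) (\sum_(y in Y2) G y) (c * #|Y2|).
move: (\sum_(y in Y1) W 1 y) (\sum_(y in Y2) W 1 y) (\sum_v W 1 v); lia.
Qed.

End Gathering.

(** * Degenerate graphs and their sparse conflict graphs *)

Definition degenerate (d : nat) (V : finType) (e : rel V) : Prop :=
  forall U : {set V}, U != set0 -> exists2 u, u \in U & #|[set v in U | e u v]| <= d.

Section Degenerate.
Variables (V : finType) (e : rel V) (d : nat).
Hypotheses (esym : symmetric e) (eirr : irreflexive e) (deg : degenerate d e).

(** Remove a vertex [u] with at most [d] remaining neighbours: the terms that contain [u] sum to at
    most [d * l * (a u + b u)]. *)
Lemma degenerate_sum (a b : V -> nat) l :
    (forall v, a v <= l) -> (forall v, b v <= l) ->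
  \sum_u \sum_v e u v * (a u * b v) <= d * l * \sum_u (a u + b u).
Proof.
move=> al bl.
suff main m : forall U : {set V}, #|U| = m ->
    \sum_(u in U) \sum_(v in U) e u v * (a u * b v) <= d * l * \sum_(u in U) (a u + b u).
  have sumT (g : V -> nat) : \sum_(u in [set: V]) g u = \sum_u g u.
    by apply: eq_bigl => u; rewrite inE.
  have := main _ [set: V] erefl; rewrite !sumT.
  by under eq_bigr do rewrite sumT.
elim: m => [|m IH] U.
  by move/cards0_eq->; rewrite !big_set0.
move=> cU; have [|u uU low] := deg (U := U).
  by rewrite -card_gt0 cU.
have cU' : #|U :\ u| = m by move: (cardsD1 u U); rewrite uU cU => -[].
have {}IH := IH _ cU'.
have nu : u \notin U :\ u by rewrite !inE eqxx.
rewrite -(setD1K uU) !big_setU1 //= eirr mul0n add0n.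
have -> : \sum_(i in U :\ u) \sum_(v in u |: U :\ u) e i v * (a i * b v) =
    \sum_(i in U :\ u) e u i * (a i * b u) +
    \sum_(i in U :\ u) \sum_(v in U :\ u) e i v * (a i * b v).
  rewrite -big_split /=; apply: eq_bigr => i _.
  by rewrite big_setU1 //= (esym i u).
have bound (g : V -> nat) (w : nat) : (forall v, g v <= l) ->
    \sum_(i in U :\ u) e u i * (g i * w) <= d * l * w.
  move=> gl; apply: leq_trans (_ : \sum_(i in [set v in U | e u v]) l * w <= _).
    rewrite [leqLHS]big_mkcond [leqRHS]big_mkcond /=; apply: leq_sum => i _.
    rewrite !inE; case: (i == u) => //=; case: (i \in U) => //=.
    by case: (e u i) => //=; rewrite mul1n leq_mul.
  by rewrite sum_nat_const mulnA leq_mul // leq_mul.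
have h1 := bound a (b u) al; have h2 := bound b (a u) bl.
have e2 : \sum_(i in U :\ u) e u i * (a u * b i) = \sum_(i in U :\ u) e u i * (b i * a u).
  by apply: eq_bigr => i _; rewrite (mulnC (a u)).
rewrite e2 !mulnDr; move: IH h1 h2; lia.
Qed.

Variables (T : finType) (x y : T -> V).

Definition interferes (s s' : T) : bool := e (x s) (y s') || e (x s') (y s).

(* The conflict graph of a set of transmissions inherits the sparsity of the graph. *)
Lemma few_conflicts (I : {set T}) l : I != set0 ->
    (forall v, #|[set s in I | x s == v]| <= l) ->
    (forall v, #|[set s in I | y s == v]| <= l) ->
  exists2 s, s \in I & #|[set s' in I | interferes s s']| <= 4 * d * l.
Proof.
move=> I0 xl yl.
apply/exists_inP; apply: contraT; rewrite negb_exists => /forallP high.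
pose a v := #|[set s in I | x s == v]|; pose b v := #|[set s in I | y s == v]|.
have card_fiber (g : T -> V) : \sum_v #|[set s in I | g s == v]| = #|I|.
  rewrite -[RHS]sum1_card (partition_big g predT) //=; apply: eq_bigr => v _.
  by rewrite -sum1_card; apply: eq_bigl => s; rewrite inE.
have total : \sum_(s in I) \sum_(s' in I) e (x s) (y s') = \sum_u \sum_v e u v * (a u * b v).
  rewrite (partition_big x predT) //=; apply: eq_bigr => u _.
  have -> : \sum_(s in I | x s == u) \sum_(s' in I) e (x s) (y s') =
      \sum_(s in [set s in I | x s == u]) \sum_(s' in I) (e u (y s') : nat).
    rewrite big_set /=; apply: eq_big => [s|s /andP[_ /eqP->]] //.
  rewrite sum_nat_const -/(a u) (partition_big y predT) //= big_distrr /=.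
  apply: eq_bigr => v _; rewrite mulnCA; congr (_ * _).
  transitivity (\sum_(s in [set s in I | y s == v]) (e u v : nat)).
    by rewrite [RHS]big_set /=; apply: eq_bigr => s /andP[_ /eqP->].
  by rewrite sum_nat_const mulnC.
(* One factor 2 comes from the two ways to interfere, the other from
   [\sum_u (a u + b u) = 2 * #|I|]. *)
have up : \sum_(s in I) #|[set s' in I | interferes s s']| <= 4 * d * l * #|I|.
  apply: leq_trans (_ : 2 * \sum_(s in I) \sum_(s' in I) e (x s) (y s') <= _); last first.
    rewrite total; apply: leq_trans (leq_mul (leqnn 2) (degenerate_sum xl yl)) _.
    by rewrite big_split /= !card_fiber; nia.
  rewrite mul2n -addnn [X in _ <= X + _]exchange_big -big_split /=; apply: leq_sum => s _.
  rewrite -sum1_card big_set /= big_mkcondr -big_split /=; apply: leq_sum => s' _.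
  by rewrite /interferes; case: (e (x s) (y s')); case: (e (x s') (y s)).
have low : \sum_(s in I) #|[set s' in I | interferes s s']| >= #|I| * (4 * d * l).+1.
  rewrite -sum_nat_const; apply: leq_sum => s sI.
  by have := high s; rewrite sI /= -ltnNge.
have : 0 < #|I| by rewrite card_gt0.
move: (leq_trans low up); rewrite mulnC mulSn; lia.
Qed.

End Degenerate.

(** * Token routings and exponential prices *)

Section Routing.
Variables (V : finType) (e : rel V) (k : nat) (S : {set V}).

(* [X t s] is the position of token [s] at time [t], [W t v] the price of being at [v] at
  time [t], and [F] the set of tokens that have not been paired yet. *)
Record routing (X : nat -> V -> V) (W : nat -> V -> nat) : Prop := Routing {
  rt_start : forall s, X 0 s = s;
  rt_step : forall t s, t < k -> stay_or_move e (X t s) (X t.+1 s);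
  rt_pos : forall t v, 0 < W t v;
  rt_out : forall t v, t < k -> 2 ^ #|[set s | (X t s == v) && (X t.+1 s != v)]| <= W t v;
  rt_in : forall t v, t < k -> 2 ^ #|[set s | (X t.+1 s == v) && (X t s != v)]| <= W t.+1 v
}.

Definition reroute (X : nat -> V -> V) (q : V) (bt : nat) (P : nat -> V) t s :=
  if s == q then P (minn t bt) else X t s.

(** Only times up to the meeting are charged: afterwards the token rests, and a resting token
    neither leaves nor enters a node. *)
Definition raise (W : nat -> V -> nat) (bt : nat) (P : nat -> V) t v :=
  if (t <= bt) && (v == P t) then 2 * W t v else W t v.

Definition total_price (W : nat -> V -> nat) : nat := \sum_(t < k.+1) \sum_v W t v.

Definition route (q : V) (bt : nat) (P : nat -> V) : Prop :=
  P 0 = q /\ forall t, t < bt -> stay_or_move e (P t) (P t.+1).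

(** While at rest, [q] contributes to no departure or arrival. Sending it along [P] adds at most one
    to the counts on its walk, and the doubled price makes room for that. *)
Lemma routing_reroute X W q bt P : routing X W -> (forall t, X t q = q) -> route q bt P ->
  routing (reroute X q bt P) (raise W bt P).
Proof.
move=> [st stp pos out inn] Xq [P0 Ps].
have cmp t : (t < bt) \/ (bt <= t) by case: leqP => _; [right|left].
have before t : t <= bt -> P (minn t bt) = P t by move=> h; rewrite (minn_idPl h).
have after t : bt <= t -> P (minn t bt) = P bt by move=> h; rewrite (minn_idPr h).
have grow (A A' : {set V}) w (cnd : bool) : A' \subset (if cnd then q |: A else A) ->
    2 ^ #|A| <= w -> 2 ^ #|A'| <= (if cnd then 2 * w else w).
  move=> sub h; apply: leq_trans (_ : 2 ^ (cnd + #|A|) <= _).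
    rewrite leq_exp2l //; apply: leq_trans (subset_leq_card sub) _.
    by case: cnd {sub} => //; rewrite cardsU1 leq_add2r; case: (_ \notin _).
  by case: cnd {sub} => //; rewrite add1n expnS leq_mul2l.
split=> [s|t s tk|t v|t v tk|t v tk].
- by rewrite /reroute min0n; case: eqP => [->|_].
- rewrite /reroute; case: eqP => _; last exact: stp.
  case: (cmp t) => [tb|bt_t]; first by rewrite (before t (ltnW tb)) (before t.+1 tb); exact: Ps.
  by rewrite (after t bt_t) (after t.+1 (leqW bt_t)) /stay_or_move eqxx.
- by rewrite /raise; case: ifP => _; rewrite ?muln_gt0 pos.
- apply: grow (out t v tk); apply/subsetP => s; rewrite inE /reroute.
  case: (eqVneq s q) => [->|nsq].
    case: (cmp t) => [tb|bt_t]; last first.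
      by rewrite (after t bt_t) (after t.+1 (leqW bt_t)) => /andP[->].
    by rewrite (before t (ltnW tb)) (ltnW tb) => /andP[/eqP-> _]; rewrite eqxx !inE eqxx.
  by move=> h; case: ifP => _; rewrite !inE h ?orbT.
- apply: grow (inn t v tk); apply/subsetP => s; rewrite inE /reroute.
  case: (eqVneq s q) => [->|nsq].
    case: (cmp t) => [tb|bt_t]; last first.
      by rewrite (after t bt_t) (after t.+1 (leqW bt_t)) => /andP[->].
    by rewrite (before t.+1 tb) tb => /andP[/eqP-> _]; rewrite eqxx !inE eqxx.
  by move=> h; case: ifP => _; rewrite !inE h ?orbT.
Qed.

Lemma total_price_raise W bt P : bt <= k ->
  total_price (raise W bt P) = total_price W + \sum_(t < bt.+1) W t (P t).
Proof.
move=> bk; rewrite /total_price.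
have -> : \sum_(t < bt.+1) W t (P t) = \sum_(t < k.+1) (if t <= bt then W t (P t) else 0).
  rewrite (big_ord_widen _ (fun t => W t (P t)) (_ : bt.+1 <= k.+1)) // big_mkcond /=.
  by apply: eq_bigr => t _; rewrite ltnS.
rewrite -big_split /=; apply: eq_bigr => t _; rewrite /raise.
case: (leqP t bt) => tb /=; last by rewrite addn0.
rewrite (bigD1 (P t)) //= [in RHS](bigD1 (P t)) //= eqxx.
rewrite (eq_bigr (fun v => W t v)) => [|v /negbTE->] //; lia.
Qed.

Lemma raise_le W bt P t v : raise W bt P t v <= 2 * W t v.
Proof. by rewrite /raise; case: ifP => // _; rewrite leq_pmull. Qed.

(** Positions are defined for all nodes; those outside [S] carry no token and rest, so they put no
    load on any node. *)
Record pairing (X : nat -> V -> V) (W : nat -> V -> nat) (F : {set V}) : Prop := Pairing {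
  pr_routing : routing X W;
  pr_free : F \subset S;
  pr_id : forall s t, (s \in F) || (s \notin S) -> X t s = s;
  pr_merge : 2 * #|[set X k s | s in S :\: F]| <= #|S :\: F|
}.

Lemma pairing_step X W F q q' bt P P' : pairing X W F -> q \in F -> q' \in F -> q != q' ->
    bt <= k -> route q bt P -> route q' bt P' -> P bt = P' bt ->
  pairing (reroute (reroute X q bt P) q' bt P') (raise (raise W bt P) bt P') (F :\ q :\ q').
Proof.
move=> [rt fr xid mg] qF q'F nq bk rP rP' meet.
have X1 : forall t, reroute X q bt P t q' = q'.
  by move=> t; rewrite /reroute eq_sym (negbTE nq) xid // q'F.
have [qS q'S] : q \in S /\ q' \in S by split; apply: (subsetP fr).
split.
- apply: routing_reroute => //; apply: routing_reroute => // t.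
  by rewrite xid // qF.
- apply: subset_trans fr; apply: subset_trans (subD1set _ _) (subD1set _ _).
- move=> s t; rewrite /reroute !inE => h.
  have ns : s != q /\ s != q'.
    case/orP: h => [/and3P[-> -> _] //|nS]; split; apply: contra nS => /eqP->//.
  case: ns => [/negbTE-> /negbTE->]; apply: xid.
  by case/orP: h => [/and3P[_ _ ->]|->]; rewrite ?orbT.
- have eD : S :\: (F :\ q :\ q') = q |: (q' |: (S :\: F)).
    apply/setP => s; rewrite !inE; case: (eqVneq s q) => [->|_]; first by rewrite qS andbF.
    by case: (eqVneq s q') => [->|_]; rewrite ?q'S.
  have n1 : q' \notin S :\: F by rewrite !inE q'F.
  have n2 : q \notin q' |: (S :\: F) by rewrite !inE (negbTE nq) qF.
  rewrite eD !cardsU1 n1 n2 /=.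
  apply: leq_trans (_ : 2 * #|P bt |: [set X k s | s in S :\: F]| <= _).
    rewrite leq_mul2l /=; apply/subset_leq_card/subsetP => v /imsetP[s].
    rewrite !inE => h ->; rewrite /reroute (minn_idPr bk).
    case: (eqVneq s q') => [_|nsq']; first by rewrite -meet eqxx.
    case: (eqVneq s q) => [_|nsq]; first by rewrite eqxx.
    apply/orP; right; apply/imsetP; exists s => //; rewrite !inE.
    by move: h; rewrite (negbTE nsq) (negbTE nsq').
  rewrite cardsU1; case: (_ \notin _); move: mg; lia.
Qed.

(** Chosen so that [potential N / potential (N - 2) = (N + 7) / (N - 1) = 1 + 8 / (N - 1)]. By this
    factor the prices can grow in one step: a pair of cost [c <= 4 Z / (N - 1)] raises the total [Z]
    by at most [2 c]. *)
Definition potential N := (N + 7) * (N + 5) * (N + 3) * (N + 1).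

Lemma potential_step Z Z' c N : 1 < N -> Z' <= Z + 2 * c -> c * N.-1 <= 4 * Z ->
  Z' * potential N.-2 <= Z * potential N.
Proof.
case: N => [|[|N]] //= _ h1 h2; rewrite /potential.
have h3 : Z' * N.+1 <= Z * (N + 9).
  apply: leq_trans (leq_mul h1 (leqnn _)) _; rewrite mulnDl; nia.
have -> : N.+2 + 7 = N + 9 by lia.
have -> : N.+2 + 5 = N + 7 by lia.
have -> : N.+2 + 3 = N + 5 by lia.
have -> : N.+2 + 1 = N + 3 by lia.
have -> : N + 1 = N.+1 by lia.
pose w := (N + 7) * (N + 5) * (N + 3); rewrite -/w (mulnC w) mulnA.
have -> : Z * ((N + 9) * (N + 7) * (N + 5) * (N + 3)) = Z * (N + 9) * w by rewrite /w !mulnA.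
by rewrite leq_mul2r h3 orbT.
Qed.

End Routing.

(** * The algorithm *)

(** Bound occurrences count too, so freshness is a coarse condition, decided by computation. *)
Fixpoint occurs (x : nat) (e : term) : bool :=
  match e with
  | TCst _ | TSize => false
  | TVar y => x == y
  | TArr _ e1 => occurs x e1
  | TAdd e1 e2 | TSub e1 e2 => occurs x e1 || occurs x e2
  | TIf e1 e2 e3 => [|| occurs x e1, occurs x e2 | occurs x e3]
  | TSum _ e1 => occurs x e1
  end.

Fixpoint reads (a : nat) (e : term) : bool :=
  match e with
  | TCst _ | TSize | TVar _ => false
  | TArr b e1 => (a == b) || reads a e1
  | TAdd e1 e2 | TSub e1 e2 => reads a e1 || reads a e2
  | TIf e1 e2 e3 => [|| reads a e1, reads a e2 | reads a e3]
  | TSum _ e1 => reads a e1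
  end.

Fixpoint writes (a : nat) (s : stmt) : bool :=
  match s with
  | SSkip => false
  | SAsg b _ _ => a == b
  | SSeq s1 s2 | SIf _ s1 s2 => writes a s1 || writes a s2
  | SFor _ s1 => writes a s1
  end.

Lemma teval_ext n rho rho' sg sg' e : (forall x, occurs x e -> rho x = rho' x) ->
  (forall a, reads a e -> sg a =1 sg' a) -> teval n rho sg e = teval n rho' sg' e.
Proof.
elim: e rho rho' => [c|x||a e IH|e1 IH1 e2 IH2|e1 IH1 e2 IH2|e1 IH1 e2 IH2 e3 IH3|x e IH]
  rho rho' hr hs //=.
- by apply: hr; rewrite /= eqxx.
- rewrite (IH rho rho') // => [|b rb]; first by apply: hs; rewrite /= eqxx.
  by apply: hs; rewrite /= rb orbT.
- rewrite (IH1 rho rho') ?(IH2 rho rho') // => x h; by [apply: hr; rewrite /= h ?orbT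
    |apply: hs; rewrite /= h ?orbT].
- rewrite (IH1 rho rho') ?(IH2 rho rho') // => x h; by [apply: hr; rewrite /= h ?orbT
    |apply: hs; rewrite /= h ?orbT].
- rewrite (IH1 rho rho') ?(IH2 rho rho') ?(IH3 rho rho') // => x h;
  by [apply: hr; rewrite /= h ?orbT|apply: hs; rewrite /= h ?orbT].
- apply: eq_bigr => i _; apply: IH => // y oy; rewrite /update; case: eqP => // _.
  exact: hr.
Qed.

Lemma teval_fresh n rho sg e x v : ~~ occurs x e ->
  teval n (update rho x v) sg e = teval n rho sg e.
Proof.
move=> nx; apply: teval_ext => // y oy; rewrite /update; case: eqP => // yx.
by rewrite -yx oy in nx.
Qed.

Lemma teval_frame n rho sg sg' e a : (forall b, b != a -> sg' b =1 sg b) -> ~~ reads a e ->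
  teval n rho sg' e = teval n rho sg e.
Proof.
move=> h na; apply: teval_ext => // b rb; apply: h.
by apply: contra na => /eqP <-.
Qed.

Lemma sexec_frame n rho sg s a : ~~ writes a s -> sexec n rho sg s a =1 sg a.
Proof.
elim: s rho sg => [|b i e|s1 IH1 s2 IH2|e s1 IH1 s2 IH2|x s IH] rho sg //=.
- by rewrite /store_set => /negbTE-> j.
- by rewrite negb_or => /andP[h1 h2] j; rewrite IH2 // IH1.
- by rewrite negb_or => /andP[h1 h2] j; case: ifP => _; [rewrite IH1|rewrite IH2].
- move=> h; move: {1}n => m; elim: m => //= m IHm j; by rewrite IH // IHm.
Qed.

Definition holds n rho sg e : bool := teval n rho sg e != 0.

Definition tnot e := TIf e (TCst 0) (TCst 1).
Definition tand e1 e2 := TIf e1 e2 (TCst 0).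
Definition tor e1 e2 := TIf e1 (TCst 1) e2.
Definition tlt e1 e2 := TSub e2 e1.
Definition teq e1 e2 := tnot (TAdd (TSub e1 e2) (TSub e2 e1)).
Definition tcount x e := TSum x (TIf e (TCst 1) (TCst 0)).
(** The least [x] satisfying [e] equals the number of [z] such that no [x <= z] satisfies [e], and
    it comes out as [n] if there is none. So a search needs nothing but sums. *)
Definition tfind z x e := TSum z (tnot (tcount x (tand (tnot (tlt (TVar z) (TVar x))) e))).

Lemma teval_not n rho sg e : teval n rho sg (tnot e) = ~~ holds n rho sg e.
Proof. by rewrite /holds /=; case: ifP. Qed.

Lemma holds_not n rho sg e : holds n rho sg (tnot e) = ~~ holds n rho sg e.
Proof. by rewrite /holds /=; case: ifP. Qed.

Lemma holds_and n rho sg e1 e2 :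
  holds n rho sg (tand e1 e2) = holds n rho sg e1 && holds n rho sg e2.
Proof. by rewrite /holds /=; case: ifP. Qed.

Lemma holds_or n rho sg e1 e2 :
  holds n rho sg (tor e1 e2) = holds n rho sg e1 || holds n rho sg e2.
Proof. by rewrite /holds /=; case: ifP. Qed.

Lemma holds_lt n rho sg e1 e2 :
  holds n rho sg (tlt e1 e2) = (teval n rho sg e1 < teval n rho sg e2).
Proof. by rewrite /holds /= -lt0n subn_gt0. Qed.

Lemma holds_eq n rho sg e1 e2 :
  holds n rho sg (teq e1 e2) = (teval n rho sg e1 == teval n rho sg e2).
Proof. by rewrite /teq holds_not /holds /= negbK addn_eq0 !subn_eq0 -eqn_leq. Qed.

Lemma teval_count n rho sg x e :
  teval n rho sg (tcount x e) = \sum_(i < n) holds n (update rho x i) sg e.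
Proof. by rewrite /=; apply: eq_bigr => i _; rewrite /holds; case: ifP. Qed.

Lemma teval_card n rho sg x e :
  teval n rho sg (tcount x e) = #|[set i : 'I_n | holds n (update rho x i) sg e]|.
Proof. rewrite teval_count -sum1_card [RHS]big_mkcond; apply: eq_bigr => i _; by rewrite inE;
  case: holds. Qed.

Lemma holds_count n rho sg x e :
  holds n rho sg (tcount x e) = [exists i : 'I_n, holds n (update rho x i) sg e].
Proof.
rewrite /holds teval_count sum_nat_eq0 negb_forall; apply: eq_existsb => i /=.
by rewrite eqb0 negbK.
Qed.

Lemma teval_find n rho sg z x e : z != x -> ~~ occurs z e ->
  teval n rho sg (tfind z x e) =
  find (fun i => holds n (update rho x i) sg e) (iota 0 n).
Proof.
move=> zx nz; set p := fun i => _.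
transitivity (\sum_(j < n) ~~ has p (iota 0 j.+1)).
  rewrite -[LHS]/(\sum_(j < n) teval n (update rho z j) sg
    (tnot (tcount x (tand (tnot (tlt (TVar z) (TVar x))) e)))).
  apply: eq_bigr => j _; rewrite teval_not; congr (nat_of_bool (~~ _)).
  have agree i : holds n (update (update rho z j) x i) sg
      (tand (tnot (tlt (TVar z) (TVar x))) e) = (i <= j) && p i.
    rewrite holds_and holds_not holds_lt -leqNgt; congr (_ && _).
      by rewrite [teval _ _ _ _]/= [teval _ _ _ _]/= /update eqxx (negbTE zx) eqxx.
    rewrite /p /holds; congr (_ != _); apply: teval_ext => // y oy.
    by rewrite /update; case: (y == x) => //; case: eqP => // yz; rewrite -yz oy in nz.
  rewrite holds_count; apply/existsP/hasP => [[i]|[i]].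
    by rewrite agree => /andP[ij pi]; exists (i : nat) => //; rewrite mem_iota.
  rewrite mem_iota add0n /= ltnS => ij pi.
  by exists (Ordinal (leq_ltn_trans ij (ltn_ord j))); rewrite agree ij.
have fl : find p (iota 0 n) <= n by have := find_size p (iota 0 n); rewrite size_iota.
transitivity (\sum_(j < n | j < find p (iota 0 n)) 1).
  rewrite [RHS]big_mkcond; apply: eq_bigr => j _.
  have -> : iota 0 j.+1 = take j.+1 (iota 0 n) by rewrite take_iota (minn_idPl _).
  by rewrite has_take_leq ?size_iota // ltnS ltnNge; case: leqP.
by rewrite -(big_ord_widen n (fun=> 1) fl) sum1_card card_ord.
Qed.

Lemma find_iotaP n (p : pred nat) : let r := find p (iota 0 n) in
  [/\ r <= n, r < n -> p r, forall i, i < r -> ~~ p i & r = n -> forall i, i < n -> ~~ p i].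
Proof.
move=> r; have rn : r <= n by have := find_size p (iota 0 n); rewrite size_iota.
have before i : i < r -> ~~ p i.
  move=> ir; have := before_find 0 ir; rewrite nth_iota ?add0n => [->//|].
  exact: leq_trans ir rn.
split=> // [lt|rn' i lt]; last by apply: before; rewrite rn'.
have : has p (iota 0 n) by rewrite has_find size_iota.
by move/(nth_find 0); rewrite nth_iota.
Qed.

Lemma find_lt n (p : pred nat) i : i < n -> p i -> find p (iota 0 n) <= i.
Proof.
move=> lt pi; have [_ _ h _] := find_iotaP n p.
by rewrite leqNgt; apply/negP => /h; rewrite pi.
Qed.

Fixpoint loops (xs : seq nat) (s : stmt) : stmt :=
  if xs is x :: xs' then SFor x (loops xs' s) else s.

Fixpoint binds (rho : nat -> nat) (xs vals : seq nat) : nat -> nat :=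
  match xs, vals with
  | x :: xs', v :: vals' => binds (update rho x v) xs' vals'
  | _, _ => rho
  end.

Definition tuple_in (n : nat) (xs vals : seq nat) : bool :=
  (size vals == size xs) && all (fun v => v < n) vals.

(** Neither the index nor the value reads the array written, so all iterations can be evaluated in
    the initial store: the nest of loops is a simultaneous assignment. *)
Lemma loops_asg n a ix e xs rho sg : ~~ reads a ix -> ~~ reads a e ->
  let sg' := sexec n rho sg (loops xs (SAsg a ix e)) in
  let f vals := teval n (binds rho xs vals) sg ix in
  let g vals := teval n (binds rho xs vals) sg e in
  forall j, (sg' a j = sg a j /\ forall vals, tuple_in n xs vals -> f vals <> j) \/
    exists2 vals, tuple_in n xs vals & f vals = j /\ sg' a j = g vals.
Proof.
move=> na ne.
suff main : forall sg0, (forall b, b != a -> sg0 b =1 sg b) ->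
  let sg' := sexec n rho sg0 (loops xs (SAsg a ix e)) in
  let f vals := teval n (binds rho xs vals) sg ix in
  let g vals := teval n (binds rho xs vals) sg e in
  forall j, (sg' a j = sg0 a j /\ forall vals, tuple_in n xs vals -> f vals <> j) \/
    exists2 vals, tuple_in n xs vals & f vals = j /\ sg' a j = g vals by exact: main.
elim: xs rho => [|x xs IH] rho sg0 fr sg' f g j.
  rewrite /sg' /= /store_set eqxx /=.
  rewrite !(teval_frame _ _ fr) //; case: eqP => [->|ne'].
    by right; exists [::].
  by left; split=> // -[|? ?] //= _ h; apply: ne'.
pose it m := iteri m (fun i sg'' => sexec n (update rho x i) sg'' (loops xs (SAsg a ix e))) sg0.
suff main m : m <= n -> (it m a j = sg0 a j /\
      forall vals, tuple_in n (x :: xs) vals -> head 0 vals < m -> f vals <> j) \/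
    exists2 vals, tuple_in n (x :: xs) vals & f vals = j /\ it m a j = g vals.
  case: (main n (leqnn n)) => [[h1 h2]|h]; last by right.
  left; split=> // vals tv; apply: h2 => //.
  by move: tv; case: vals => [|v vals] // /andP[_ /= /andP[]].
elim: m => [|m IHm] mn; first by left; split.
have frm b : b != a -> it m b =1 sg b.
  move=> ba i; rewrite -fr // /it; move: {mn IHm} m => m; elim: m => //= m <-.
  apply: sexec_frame; elim: (xs) => //=; by rewrite ba.
have := IH (update rho x m) (it m) frm j; rewrite -[sexec _ _ _ _ a j]/(it m.+1 a j).
case=> [[h1 h2]|[vals tv [h1 h2]]]; last first.
  right; exists (m :: vals) => //; move: tv => /andP[/eqP sv av].
  by rewrite /tuple_in /= sv eqxx mn av.
rewrite h1; case: (IHm (ltnW mn)) => [[k1 k2]|[vals tv [k1 k2]]]; last first.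
  by right; exists vals.
left; split=> // vals tv; rewrite ltnS leq_eqVlt => /orP[/eqP hv|]; last exact: k2.
move: tv hv; case: vals => [|v vals] //= /andP[sv /= /andP[_ av]] vm; rewrite /f /= vm.
by apply: h2; rewrite /tuple_in av andbT.
Qed.

Lemma for_inv n rho x s (P : nat -> store -> Prop) sg : P 0 sg ->
  (forall i sg, i < n -> P i sg -> P i.+1 (sexec n (update rho x i) sg s)) ->
  P n (sexec n rho sg (SFor x s)).
Proof.
move=> p0 step; rewrite /=.
suff main m : m <= n -> P m (iteri m (fun i sg' => sexec n (update rho x i) sg' s) sg).
  exact: main.
by elim: m => //= m IH mn; apply: step => //; apply: IH; exact: ltnW.
Qed.

Lemma for2_inv n rho x y s (P : nat -> store -> Prop) sg : P 0 sg ->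
  (forall i j sg, i < n -> j < n -> P (n * i + j) sg ->
     P (n * i + j).+1 (sexec n (update (update rho x i) y j) sg s)) ->
  P (n * n) (sexec n rho sg (SFor x (SFor y s))).
Proof.
move=> p0 step; apply: (for_inv (P := fun i => P (n * i))) => [|i sg1 iN h1].
  by rewrite muln0.
rewrite mulnSr; apply: (for_inv (P := fun j => P (n * i + j))) => [|j sg2 jN h2].
  by rewrite addn0.
by rewrite addnS; apply: step.
Qed.

Lemma row_index_inj n r c r' c' : c < n -> c' < n -> n * r + c = n * r' + c' -> r = r' /\ c = c'.
Proof.
move=> cn cn' h; have n0 : 0 < n by exact: leq_ltn_trans cn.
have := congr1 (modn^~ n) h; rewrite !(mulnC n) !modnMDl !modn_small // => cc.
have := congr1 (divn^~ n) h; rewrite !(mulnC n) !divnMDl // !divn_small // !addn0 => rr.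
by split.
Qed.

(* [aE] is the adjacency matrix; [aLen] and [aOut] are the output; [aS] and [aF] are the tokens of
  the phase and those not paired yet; [aW] prices; [aX] positions; [aD] and [aP] cheapest walks
  ([aD] is 0 when there is none) and their last but one nodes; [aBest], [aQ1], [aQ2], [aBt], [aBv]
  the cheapest meeting; [aEl] and [aCo] elimination order and colours, both counted from 1;
  [aTx] and [aRx] the transmitters and receivers of all rounds made so far, [aM] in number;
  [aK] the guess; [aRun] the first round of the current run; [aBs] the first round of the shortest
  successful run. *)
Notation aE := 0 (only parsing).
Notation aLen := 1 (only parsing).
Notation aOut := 2 (only parsing).
Notation aS := 5 (only parsing).
Notation aW := 6 (only parsing).
Notation aX := 7 (only parsing).
Notation aF := 8 (only parsing).
Notation aD := 9 (only parsing).
Notation aP := 10 (only parsing).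
Notation aBest := 11 (only parsing).
Notation aCur := 12 (only parsing).
Notation aEl := 13 (only parsing).
Notation aCo := 14 (only parsing).
Notation aTx := 15 (only parsing).
Notation aRx := 16 (only parsing).
Notation aK := 17 (only parsing).
Notation aT := 18 (only parsing).
Notation aM := 19 (only parsing).
Notation aBl := 20 (only parsing).
Notation aBs := 21 (only parsing).
Notation aRun := 22 (only parsing).
Notation aQ1 := 23 (only parsing).
Notation aQ2 := 24 (only parsing).
Notation aBt := 25 (only parsing).
Notation aBv := 26 (only parsing).
Notation aPick := 27 (only parsing).
Notation aD' := 28 (only parsing).
Notation aQ := 29 (only parsing).

Declare Scope stmt_scope.
Delimit Scope stmt_scope with stmt.
Bind Scope stmt_scope with stmt.
Notation "s1 ;; s2" := (SSeq s1 s2) (at level 70, right associativity) : stmt_scope.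
Open Scope stmt_scope.

(* There is no product in the term language: multiplication by [n] is a sum over a fresh variable.
  Times range up to [n * n] and are run through by the pair of variables 0 and 1. *)
Definition tix2 r c := TAdd (TSum 21 r) c.
Definition tix3 t s v := TAdd (TSum 22 (TAdd (TSum 21 t) s)) v.
Definition ttime := TAdd (TSum 20 (TVar 0)) (TVar 1).
Definition tnext := TAdd ttime (TCst 1).

Definition tscalar a := TArr a (TCst 0).
Definition set_scalar a e := SAsg a (TCst 0) e.
Definition swhen e s := SIf e s SSkip.

Definition tedge u v := TArr aE (TAdd (TSum 24 u) v).
Definition tnear u v := tor (teq u v) (tedge u v).
Definition tdist t s v := TArr aD (tix3 t s v).

Definition init_phase :=
  loops [:: 0; 1; 3] (SAsg aW (tix2 ttime (TVar 3)) (TCst 1)) ;;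
  loops [:: 0; 1; 2] (SAsg aX (tix2 ttime (TVar 2)) (TVar 2)) ;;
  loops [:: 2] (SAsg aF (TVar 2) (TArr aS (TVar 2))).

Definition tcandidate u := tand (tnear (TVar u) (TVar 3)) (tdist ttime (TVar 2) (TVar u)).

Definition tbest_candidate := tand (tcandidate 4)
  (tnot (tcount 5 (tand (tcandidate 5)
    (tlt (tdist ttime (TVar 2) (TVar 5)) (tdist ttime (TVar 2) (TVar 4)))))).

Definition tnext_index := tix3 tnext (TVar 2) (TVar 3).

(** The new row passes through [aD'] because [table_asg] does not admit a value that reads the array
    being written. *)
Definition distance_step :=
  loops [:: 2; 3] (SAsg aP tnext_index (tfind 7 4 tbest_candidate)) ;;
  loops [:: 2; 3] (SAsg aD' tnext_index
    (TIf (tlt (TArr aP tnext_index) TSize)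
      (TAdd (tdist ttime (TVar 2) (TArr aP tnext_index)) (TArr aW (tix2 tnext (TVar 3))))
      (TCst 0))) ;;
  loops [:: 2; 3] (SAsg aD tnext_index (TArr aD' tnext_index)).

Definition distances :=
  loops [:: 2; 3] (SAsg aD (tix3 (TCst 0) (TVar 2) (TVar 3))
    (TIf (teq (TVar 2) (TVar 3)) (TArr aW (tix2 (TCst 0) (TVar 3))) (TCst 0))) ;;
  SFor 0 (SFor 1 (swhen (tlt ttime (tscalar aK)) distance_step)).

Definition tpair_cost := TAdd (tdist ttime (TVar 2) (TVar 3)) (tdist ttime (TVar 6) (TVar 3)).

Definition tbetter :=
  tand (TArr aF (TVar 2)) (tand (TArr aF (TVar 6)) (tand (tnot (teq (TVar 2) (TVar 6)))
  (tand (tdist ttime (TVar 2) (TVar 3)) (tand (tdist ttime (TVar 6) (TVar 3))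
  (tor (tnot (tscalar aBest)) (tlt tpair_cost (tscalar aBest))))))).

Definition record_best :=
  set_scalar aBest tpair_cost ;; set_scalar aQ1 (TVar 2) ;; set_scalar aQ2 (TVar 6) ;;
  set_scalar aBt ttime ;; set_scalar aBv (TVar 3).

Definition search_pair :=
  set_scalar aBest (TCst 0) ;;
  SFor 0 (SFor 1 (swhen (tnot (tlt (tscalar aK) ttime))
    (SFor 3 (SFor 2 (SFor 6 (swhen tbetter record_best)))))).

Definition tback := TSub (tscalar aK) ttime.

(** Walks are known through last but one nodes, so they are written backwards, from time [k] down to
    0. At times after the meeting the current node stays at the meeting point and no price
    changes. *)
Definition trace_body q :=
  SAsg aX (tix2 tback (tscalar q)) (tscalar aCur) ;;
  swhen (tnot (tlt (tscalar aBt) tback))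
    (SAsg aW (tix2 tback (tscalar aCur))
       (TAdd (TArr aW (tix2 tback (tscalar aCur))) (TArr aW (tix2 tback (tscalar aCur)))) ;;
     set_scalar aCur (TArr aP (tix3 tback (tscalar q) (tscalar aCur)))).

Definition trace q :=
  set_scalar aCur (tscalar aBv) ;;
  SFor 0 (SFor 1 (swhen (tnot (tlt (tscalar aK) ttime)) (trace_body q))).

Definition pair_up :=
  distances ;; search_pair ;;
  swhen (tscalar aBest)
    (trace aQ1 ;; trace aQ2 ;;
     SAsg aF (tscalar aQ1) (TCst 0) ;; SAsg aF (tscalar aQ2) (TCst 0)).

Definition tpos s := TArr aX (tix2 ttime s).
Definition tpos' s := TArr aX (tix2 tnext s).
Definition tmoves s := tnot (teq (tpos s) (tpos' s)).
Definition tinterferes s s' := tor (tedge (tpos s) (tpos' s')) (tedge (tpos s') (tpos' s)).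
Definition talive x := tand (tmoves (TVar x)) (tnot (TArr aEl (TVar x))).
Definition tdegree x := tcount 9 (tand (talive 9) (tinterferes (TVar x) (TVar 9))).
Definition tlowest := tand (talive 2)
  (tnot (tcount 6 (tand (talive 6) (tlt (tdegree 6) (tdegree 2))))).

(** Greedy colouring along a degeneracy order: [peel] removes a moving token with fewest conflicts
    among those left, and [paint] treats the tokens in the opposite order, so that each faces only
    the conflicts it had when it was removed. *)
Definition peel :=
  set_scalar aPick (tfind 7 2 tlowest) ;;
  swhen (tlt (tscalar aPick) TSize) (SAsg aEl (tscalar aPick) (TAdd (TVar 15) (TCst 1))).

Definition tfree_color := tnot (tcount 6 (tand
  (teq (TArr aCo (TVar 6)) (TAdd (TVar 14) (TCst 1))) (tinterferes (tscalar aPick) (TVar 6)))).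

Definition paint :=
  set_scalar aPick (tfind 7 2 (teq (TArr aEl (TVar 2)) (TSub TSize (TVar 15)))) ;;
  swhen (tlt (tscalar aPick) TSize)
    (SAsg aCo (tscalar aPick) (TAdd (tfind 7 14 tfree_color) (TCst 1))).

Definition coloring :=
  loops [:: 2] (SAsg aEl (TVar 2) (TCst 0)) ;;
  loops [:: 2] (SAsg aCo (TVar 2) (TCst 0)) ;;
  SFor 15 peel ;; SFor 15 paint ;;
  set_scalar aQ (tfind 7 14 (tnot (tcount 6 (tlt (TVar 14) (TArr aCo (TVar 6)))))).

Definition write_rows a pos :=
  loops [:: 14; 3] (SAsg a (tix2 (TAdd (tscalar aM) (TVar 14)) (TVar 3))
    (tcount 6 (tand (teq (TArr aCo (TVar 6)) (TAdd (TVar 14) (TCst 1))) (teq pos (TVar 3))))).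

Definition emit :=
  coloring ;; write_rows aTx (tpos (TVar 6)) ;; write_rows aRx (tpos' (TVar 6)) ;;
  set_scalar aM (TAdd (tscalar aM) (tscalar aQ)).

(** The detour through [aT] has the same reason as the one through [aD'] in [distance_step]. *)
Definition survivors :=
  loops [:: 3] (SAsg aT (TVar 3) (tcount 2 (tand (TArr aS (TVar 2))
    (teq (TArr aX (tix2 (tscalar aK) (TVar 2))) (TVar 3))))) ;;
  loops [:: 3] (SAsg aS (TVar 3) (TArr aT (TVar 3))).

Definition phase :=
  init_phase ;; SFor 13 pair_up ;;
  SFor 0 (SFor 1 (swhen (tlt ttime (tscalar aK)) emit)) ;;
  survivors.

Definition gather :=
  loops [:: 3] (SAsg aS (TVar 3) (TCst 1)) ;; set_scalar aRun (tscalar aM) ;; SFor 12 phase.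

(** A guess below the optimum may leave several tokens, or succeed by luck. Neither does harm, since
    only the shortest run that ends with a single token is kept. *)
Definition timprovement := tand (teq (tcount 3 (TArr aS (TVar 3))) (TCst 1))
  (tor (tnot (tscalar aBl))
    (tlt (TAdd (TSub (tscalar aM) (tscalar aRun)) (TCst 1)) (tscalar aBl))).

Definition try_bound :=
  gather ;;
  swhen timprovement
    (set_scalar aBl (TAdd (TSub (tscalar aM) (tscalar aRun)) (TCst 1)) ;;
     set_scalar aBs (tscalar aRun)) ;;
  set_scalar aK (TAdd (tscalar aK) (TCst 1)).

Definition tlen := TSub (tscalar aBl) (TCst 1).
(** Twice the length of a run is at most [n ^ 5], so five digits in base [n] number all rounds. *)
Definition tround := TAdd (TSum 28 (TAdd (TSum 27 (TAdd (TSum 26 (TAdd (TSum 25 (TVar 16))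
  (TVar 17))) (TVar 18))) (TVar 19))) (TVar 23).

Definition output :=
  set_scalar aLen (TAdd tlen tlen) ;;
  loops [:: 16; 17; 18; 19; 23; 3] (SAsg aOut (tix2 tround (TVar 3))
    (TIf (tlt tround tlen) (TArr aTx (tix2 (TAdd (tscalar aBs) tround) (TVar 3)))
      (TArr aRx (tix2 (TAdd (tscalar aBs) (TSub (TAdd tlen tlen) (TAdd tround (TCst 1))))
        (TVar 3))))).

Definition gossip_program := SFor 10 (SFor 11 try_bound) ;; output.

(** The largest array number is 29, at offset 31, hence 32 cells per index. *)
Lemma gossip_program_scope : scope_stmt 32 [::] gossip_program.
Proof. by []. Qed.

Lemma teval_row n rho sg x e : ~~ occurs x e ->
  teval n rho sg (TSum x e) = n * teval n rho sg e.
Proof.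
move=> h; rewrite -[LHS]/(\sum_(i < n) teval n (update rho x i) sg e).
under eq_bigr do rewrite teval_fresh //.
by rewrite sum_nat_const card_ord.
Qed.

Lemma teval_add n rho sg e1 e2 :
  teval n rho sg (TAdd e1 e2) = teval n rho sg e1 + teval n rho sg e2.
Proof. by []. Qed.

Lemma teval_ix2 n rho sg r c : ~~ occurs 21 r ->
  teval n rho sg (tix2 r c) = n * teval n rho sg r + teval n rho sg c.
Proof. by move=> h; rewrite /tix2 teval_add teval_row. Qed.

Lemma teval_ix3 n rho sg t s v : ~~ occurs 21 t -> ~~ occurs 22 t -> ~~ occurs 22 s ->
  teval n rho sg (tix3 t s v) =
  n * (n * teval n rho sg t + teval n rho sg s) + teval n rho sg v.
Proof.
move=> h1 h2 h3; rewrite /tix3 teval_add teval_row ?teval_add ?teval_row //=.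
by rewrite negb_or h2.
Qed.

Lemma teval_time n rho sg : teval n rho sg ttime = n * rho 0 + rho 1.
Proof. by rewrite /ttime teval_add teval_row. Qed.

Lemma teval_edge n rho sg u v : ~~ occurs 24 u ->
  teval n rho sg (tedge u v) = sg aE (n * teval n rho sg u + teval n rho sg v).
Proof.
move=> h; rewrite -[LHS]/(sg aE (teval n rho sg (TAdd (TSum 24 u) v))).
by rewrite teval_add teval_row.
Qed.

(** * Correctness of the algorithm *)

Lemma teval_var n rho sg x : teval n rho sg (TVar x) = rho x. Proof. by []. Qed.
Lemma teval_cst n rho sg c : teval n rho sg (TCst c) = c. Proof. by []. Qed.
Lemma teval_size n rho sg : teval n rho sg TSize = n. Proof. by []. Qed.
Lemma teval_arr n rho sg a e : teval n rho sg (TArr a e) = sg a (teval n rho sg e).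
Proof. by []. Qed.
Lemma teval_sub n rho sg e1 e2 :
  teval n rho sg (TSub e1 e2) = teval n rho sg e1 - teval n rho sg e2.
Proof. by []. Qed.
Lemma teval_if n rho sg e1 e2 e3 : teval n rho sg (TIf e1 e2 e3) =
  if holds n rho sg e1 then teval n rho sg e2 else teval n rho sg e3.
Proof. by []. Qed.
Lemma teval_scalar n rho sg a : teval n rho sg (tscalar a) = sg a 0. Proof. by []. Qed.

Definition tevalE := (teval_time, teval_scalar, teval_var, teval_cst, teval_size, teval_arr,
  teval_sub, teval_add).

Lemma table_asg n a ix e xs rho sg : ~~ reads a ix -> ~~ reads a e ->
  let f vals := teval n (binds rho xs vals) sg ix in
  (forall vals vals', tuple_in n xs vals -> tuple_in n xs vals' -> f vals = f vals' ->
     vals = vals') ->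
  forall vals, tuple_in n xs vals ->
    sexec n rho sg (loops xs (SAsg a ix e)) a (f vals) = teval n (binds rho xs vals) sg e.
Proof.
move=> na ne f inj vals tv.
have [[_ /(_ vals tv)]|[vals' tv' [h1 ->]]] // := loops_asg n xs rho sg na ne (f vals).
by rewrite (inj vals' vals).
Qed.

Lemma table_asg_other n a ix e xs rho sg j : ~~ reads a ix -> ~~ reads a e ->
  (forall vals, tuple_in n xs vals -> teval n (binds rho xs vals) sg ix <> j) ->
  sexec n rho sg (loops xs (SAsg a ix e)) a j = sg a j.
Proof.
move=> na ne h; have [[-> _]|[vals tv [h1 _]]] // := loops_asg n xs rho sg na ne j.
by case: (h vals tv).
Qed.

Lemma tuple_in1 n x i : tuple_in n [:: x] [:: i] = (i < n).
Proof. by rewrite /tuple_in /= andbT. Qed.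

Lemma tuple_in2 n x y i j : tuple_in n [:: x; y] [:: i; j] = (i < n) && (j < n).
Proof. by rewrite /tuple_in /= andbT. Qed.

Lemma tuple_in3 n x y z i j l :
  tuple_in n [:: x; y; z] [:: i; j; l] = [&& i < n, j < n & l < n].
Proof. by rewrite /tuple_in /= andbT. Qed.

Lemma tuple_inP1 n x vals : tuple_in n [:: x] vals -> exists2 i, i < n & vals = [:: i].
Proof. by case: vals => [|i [|]] //; rewrite tuple_in1 => h; exists i. Qed.

Lemma tuple_inP2 n x y vals : tuple_in n [:: x; y] vals ->
  exists i j, [/\ i < n, j < n & vals = [:: i; j]].
Proof.
by case: vals => [|i [|j [|]]] //; rewrite tuple_in2 => /andP[h1 h2]; exists i, j.
Qed.

Lemma tuple_inP3 n x y z vals : tuple_in n [:: x; y; z] vals ->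
  exists i j l, [/\ i < n, j < n, l < n & vals = [:: i; j; l]].
Proof.
case: vals => [|i [|j [|l [|]]]] //; rewrite tuple_in3 => /and3P[h1 h2 h3].
by exists i, j, l.
Qed.

(** * Cheapest walks in the time-expanded graph *)

Section Distances.
Variables (n : nat) (e : rel 'I_n).

Definition graph_in (sg : store) : Prop := forall u v : 'I_n, sg aE (n * u + v) = e u v.

Definition price (sg : store) t (v : 'I_n) : nat := sg aW (n * t + v).
Definition dist (sg : store) t (s v : 'I_n) : nat := sg aD (n * (n * t + s) + v).
Definition previous (sg : store) t (s v : 'I_n) : nat := sg aP (n * (n * t + s) + v).

Lemma holds_near rho sg u v (x y : 'I_n) : graph_in sg -> ~~ occurs 24 u ->
  teval n rho sg u = x -> teval n rho sg v = y ->
  holds n rho sg (tnear u v) = stay_or_move e x y.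
Proof.
move=> hE fr eu ev; rewrite /tnear holds_or holds_eq eu ev /stay_or_move; congr (_ || _).
by rewrite /holds teval_edge // eu ev hE; case: (e x y).
Qed.

Definition better_prev (sg : store) t (s v u : 'I_n) : bool :=
  [&& stay_or_move e u v, dist sg t s u != 0 &
    [forall w : 'I_n, stay_or_move e w v ==> (dist sg t s w != 0) ==>
       (dist sg t s u <= dist sg t s w)]].

Lemma distance_step_correct rho sg t : graph_in sg -> n * rho 0 + rho 1 = t ->
  let sg' := sexec n rho sg distance_step in
  [/\ forall a, a \notin [:: 9; 10; 28] -> sg' a =1 sg a,
      forall t' (s v : 'I_n), t' != t.+1 ->
        dist sg' t' s v = dist sg t' s v /\ previous sg' t' s v = previous sg t' s v
    & forall s v : 'I_n,
        (exists u : 'I_n, [/\ previous sg' t.+1 s v = u, better_prev sg t s v u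
           & dist sg' t.+1 s v = dist sg t s u + price sg t.+1 v]) \/
        (dist sg' t.+1 s v = 0 /\
          forall u : 'I_n, stay_or_move e u v -> dist sg t s u = 0)].
Proof.
move=> hE ht sg'.
have fr a : a \notin [:: 9; 10; 28] -> sg' a =1 sg a.
  move=> na; apply: sexec_frame; move: na; rewrite !inE /= !negb_or.
  by case/and3P => /negbTE-> /negbTE-> /negbTE->.
pose ixv s v := n * (n * t.+1 + s) + v.
have ixE sg1 vals s v : vals = [:: s; v] ->
    teval n (binds rho [:: 2; 3] vals) sg1 tnext_index = ixv s v.
  move=> ->; rewrite /tnext_index teval_ix3 // !tevalE /= /update /= ht.
  by rewrite addn1.
have inj s v s' v' : s < n -> v < n -> s' < n -> v' < n -> ixv s v = ixv s' v' ->
    [:: s; v] = [:: s'; v'].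
  move=> sn vn sn' vn' h; have [h1 ->] := row_index_inj vn vn' h.
  by have [_ ->] := row_index_inj sn sn' h1.
pose sg1 := sexec n rho sg (loops [:: 2; 3] (SAsg aP tnext_index (tfind 7 4 tbest_candidate))).
pose sg2 := sexec n rho sg1 (loops [:: 2; 3] (SAsg aD' tnext_index
    (TIf (tlt (TArr aP tnext_index) TSize)
      (TAdd (tdist ttime (TVar 2) (TArr aP tnext_index)) (TArr aW (tix2 tnext (TVar 3))))
      (TCst 0)))).
have eq3 : sg' = sexec n rho sg2 (loops [:: 2; 3] (SAsg aD tnext_index (TArr aD' tnext_index))).
  by [].
have f1 a : a != aP -> sg1 a =1 sg a by move=> na; rewrite /sg1; apply: sexec_frame; rewrite /=
  (negbTE na).
have f2 a : a != aD' -> sg2 a =1 sg1 a by move=> na; rewrite /sg2; apply: sexec_frame; rewrite /=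
  (negbTE na).
have f3 a : a != aD -> sg' a =1 sg2 a by move=> na; rewrite eq3; apply: sexec_frame; rewrite /=
  (negbTE na).
have injP sg0 : forall vals vals', tuple_in n [:: 2; 3] vals -> tuple_in n [:: 2; 3] vals' ->
    teval n (binds rho [:: 2; 3] vals) sg0 tnext_index =
    teval n (binds rho [:: 2; 3] vals') sg0 tnext_index -> vals = vals'.
  move=> vals vals' /tuple_inP2[s [v [sn vn ev]]] /tuple_inP2[s' [v' [sn' vn' ev']]].
  by rewrite (ixE _ _ s v ev) (ixE _ _ s' v' ev') ev ev' => /inj; apply.
have v1 (s v : 'I_n) : sg1 aP (ixv s v) = find (fun u =>
    holds n (update (binds rho [:: 2; 3] [:: s : nat; v : nat]) 4 u) sg tbest_candidate) (iota 0 n).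
  rewrite -(ixE sg [:: s : nat; v : nat]) // /sg1 (table_asg (xs := [:: 2; 3])) //.
  - by rewrite teval_find.
  - exact: injP.
  - by rewrite tuple_in2 !ltn_ord.
have v3 (s v : 'I_n) : sg' aD (ixv s v) =
    if sg1 aP (ixv s v) < n then sg aD (n * (n * t + s) + sg1 aP (ixv s v)) + price sg t.+1 v else
      0.
  have tv : tuple_in n [:: 2; 3] [:: s : nat; v : nat] by rewrite tuple_in2 !ltn_ord.
  rewrite eq3 -(ixE sg2 [:: s : nat; v : nat]) // (table_asg (xs := [:: 2; 3])) //; last exact:
    injP.
  rewrite teval_arr (ixE _ _ s v) // -(ixE sg1 [:: s : nat; v : nat]) // /sg2.
  rewrite (table_asg (xs := [:: 2; 3])) //; last exact: injP.
  rewrite teval_if holds_lt teval_arr teval_size (ixE _ _ s v) //; case: ifP => // _.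
  rewrite teval_add /tdist !teval_arr teval_ix3 // teval_time teval_arr (ixE _ _ s v) //.
  rewrite teval_ix2 //.
  rewrite /tnext teval_add teval_time teval_cst (f1 9) // (f1 6) //= /update /= ht addn1.
  by [].
have cand sg0 (s v u : 'I_n) x rho' : 24 != x -> graph_in sg0 -> rho' 0 = rho 0 -> rho' 1 = rho 1 ->
    rho' 2 = s -> rho' 3 = v -> rho' x = u ->
    holds n rho' sg0 (tcandidate x) = stay_or_move e u v && (dist sg0 t s u != 0).
  move=> nx g0 h0 h1 h2 h3 hx; rewrite /tcandidate holds_and (holds_near (x := u) (y := v)) //.
  by rewrite /holds /tdist teval_arr teval_ix3 // teval_time !teval_var h0 h1 h2 hx ht.
have best (s v u : 'I_n) : holds n (update (binds rho [:: 2; 3] [:: s : nat; v : nat]) 4 u) sg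
    tbest_candidate = better_prev sg t s v u.
  rewrite /tbest_candidate holds_and holds_not holds_count (cand _ s v u) //.
  rewrite /better_prev -andbA; congr (_ && (_ && _)).
  rewrite negb_exists; apply: eq_forallb => w.
  rewrite holds_and holds_lt (cand _ s v w) //.
  rewrite /tdist !teval_arr !teval_ix3 // !teval_time !teval_var /= /update /= ht.
  rewrite -/(dist sg t s w) -/(dist sg t s u) [in RHS]leqNgt.
  by case: (stay_or_move e w v); case: (dist sg t s w != 0).
split=> // [t' s v nt|s v].
- have other : forall vals, tuple_in n [:: 2; 3] vals -> forall sg0,
      teval n (binds rho [:: 2; 3] vals) sg0 tnext_index <> n * (n * t' + s) + v.
    move=> vals /tuple_inP2[s' [v' [sn vn ->]]] sg0; rewrite (ixE _ _ s' v') //.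
    move=> h; have [h1 _] := row_index_inj vn (ltn_ord v) h.
    by have [tt _] := row_index_inj sn (ltn_ord s) h1; rewrite -tt eqxx in nt.
  split.
    rewrite /dist eq3 (table_asg_other (xs := [:: 2; 3])) // => [|vals tv]; last exact: other.
    by rewrite f2 ?f1.
  rewrite /previous f3 // f2 // /sg1 (table_asg_other (xs := [:: 2; 3])) // => vals tv; exact:
    other.
have := v3 s v; rewrite -[sg' aD _]/(dist sg' t.+1 s v).
have ep : previous sg' t.+1 s v = sg1 aP (ixv s v) by rewrite /previous f3 ?f2.
rewrite v1; set p := fun u => _.
have [rn rp _ rnone] := find_iotaP n p.
case: ltnP => [lt|ge] dE.
  left; exists (Ordinal lt); split=> //; first by rewrite ep v1.
  by rewrite -best; exact: rp.
right; split=> // u uv.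
have er : find p (iota 0 n) = n by apply/eqP; rewrite eqn_leq rn ge.
(* If some predecessor were reachable, one at least distance would satisfy [p], but the search has
   found none. *)
apply/eqP; apply: contraT => du.
pose w := [arg min_(w < u | stay_or_move e w v && (dist sg t s w != 0)) dist sg t s w].
have pw : p w.
  rewrite /p best /better_prev /w; case: arg_minnP => [|w' /andP[w1 w2] wmin]; first by rewrite uv.
  rewrite w1 w2 /=; apply/forallP => w''; apply/implyP => h1; apply/implyP => h2.
  by apply: wmin; rewrite h1.
by rewrite (negbTE (rnone er w (ltn_ord w))) in pw.
Qed.

End Distances.

Section DistanceTable.
Variables (n : nat) (e : rel 'I_n).

Lemma swhenE rho sg c s :
  sexec n rho sg (swhen c s) = if holds n rho sg c then sexec n rho sg s else sg.
Proof. by []. Qed.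

Lemma seqE rho sg s1 s2 :
  sexec n rho sg (SSeq s1 s2) = sexec n rho (sexec n rho sg s1) s2.
Proof. by []. Qed.

(** Bellman's recurrence for one row, with a case of its own for unreachable nodes, whose entry is
    0. *)
Definition dist_row (sg : store) (t : nat) : Prop := forall s v : 'I_n,
  if t is t'.+1 then
    (exists u : 'I_n, [/\ previous sg t s v = u, better_prev e sg t' s v u
       & dist sg t s v = dist sg t' s u + price sg t v]) \/
    (dist sg t s v = 0 /\ forall u : 'I_n, stay_or_move e u v -> dist sg t' s u = 0)
  else dist sg 0 s v = if s == v then price sg 0 v else 0.

Lemma dist_row_frame sg sg' t :
    (forall t' (s v : 'I_n), t' <= t ->
       dist sg' t' s v = dist sg t' s v /\ previous sg' t' s v = previous sg t' s v) ->
    sg' aW =1 sg aW -> dist_row sg t -> dist_row sg' t.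
Proof.
move=> same fw row s v; case: t same row => [|t] same row.
  by rewrite (same 0 s v _).1 // row /price fw.
have [ed ep] := same t.+1 s v (leqnn _).
have e' u : dist sg' t s u = dist sg t s u by have [] := same t s u (leqnSn t).
rewrite ed ep; case: (row s v) => [[u [h1 h2 h3]]|[h1 h2]].
  left; exists u; split=> //; last by rewrite e' h3 /price fw.
  move: h2; rewrite /better_prev e' => /and3P[-> -> /forallP h]; apply/forallP => w.
  by rewrite e'; exact: h.
by right; split=> // u uv; rewrite e' h2.
Qed.

(** Waiting is a step, so the size of a walk is its arrival time. Positive prices keep true
    distances apart from 0, the code for an unreachable node. Entries are shown to be lower bounds
    for walks; that they are attained is recovered in [backtrack] from the last two clauses. *)
Lemma distances_correct rho sg : graph_in e sg -> sg aK 0 < n * n ->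
    (forall t (v : 'I_n), t <= sg aK 0 -> 0 < price sg t v) ->
  let sg' := sexec n rho sg distances in
  [/\ forall a, a \notin [:: 9; 10; 28] -> sg' a =1 sg a,
      forall (s v : 'I_n) p, size p <= sg aK 0 -> path (stay_or_move e) s p -> last s p = v ->
        0 < dist sg' (size p) s v <= walk_cost (price sg) s p,
      forall s v : 'I_n, dist sg' 0 s v != 0 -> s = v /\ dist sg' 0 s v = price sg 0 v
    & forall t (s v : 'I_n), t < sg aK 0 -> dist sg' t.+1 s v != 0 ->
        exists u : 'I_n, [/\ previous sg' t.+1 s v = u, stay_or_move e u v, dist sg' t s u != 0
          & dist sg' t.+1 s v = dist sg' t s u + price sg t.+1 v]].
Proof.
move=> hE kn pos sg'.
have fr a : a \notin [:: 9; 10; 28] -> sg' a =1 sg a.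
  move=> na; rewrite /sg'; apply: sexec_frame; move: na; rewrite !inE /= !negb_or.
  by case/and3P => /negbTE-> /negbTE-> /negbTE->.
set k := sg aK 0 in kn pos *.
pose Inv T (sg1 : store) := (forall a, a \notin [:: 9; 10; 28] -> sg1 a =1 sg a) /\
  forall t, t <= minn T k -> dist_row sg1 t.
have rows : Inv (n * n) sg'.
  rewrite /sg' /distances seqE; set sg0 := sexec _ _ _ (loops _ _).
  apply: for2_inv => [|i j sg1 iN jN [fr1 rows]].
    split=> [a|t].
      rewrite !inE => /norP[na _]; rewrite /sg0; apply: sexec_frame => /=.
      by rewrite (negbTE na).
    rewrite min0n leqn0 => /eqP-> s v.
    have -> : price sg0 0 v = price sg 0 v by rewrite /price /sg0 sexec_frame.
    have ixE vals s' v' : vals = [:: s'; v'] ->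
        teval n (binds rho [:: 2; 3] vals) sg (tix3 (TCst 0) (TVar 2) (TVar 3)) =
        n * (n * 0 + s') + v'.
      by move=> ->; rewrite teval_ix3.
    rewrite /dist -(ixE [:: s : nat; v : nat]) // /sg0 (table_asg (xs := [:: 2; 3])) //.
    - by rewrite teval_if holds_eq teval_arr teval_ix2 // !teval_var !teval_cst.
    - move=> vals vals' /tuple_inP2[s' [v' [sn vn ev]]] /tuple_inP2[s'' [v'' [sn' vn' ev']]].
      rewrite (ixE vals s' v') // (ixE vals' s'' v'') // ev ev' => h.
      have [h1 ->] := row_index_inj vn vn' h; by have [_ ->] := row_index_inj sn sn' h1.
    - by rewrite tuple_in2 !ltn_ord.
  rewrite swhenE; set T := n * i + j in rows *.
  have hT : teval n (update (update rho 0 i) 1 j) sg1 ttime = T.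
    by rewrite teval_time /update /=.
  have ek : sg1 aK 0 = k by rewrite fr1.
  rewrite holds_lt hT teval_scalar ek; case: (ltnP T k) => [Tk|kT]; last first.
    by split=> // t; rewrite (minn_idPr (leqW kT)) => tk; apply: rows; rewrite (minn_idPr kT).
  have g1 : graph_in e sg1 by move=> u v; rewrite fr1 // hE.
  have [frs same new] := distance_step_correct (rho := update (update rho 0 i) 1 j) g1
    (erefl : _ = T).
  set sg2 := sexec _ _ _ _ in frs same new *.
  split=> [a na b|t]; first by rewrite frs // fr1.
  have fw : sg2 aW =1 sg1 aW by exact: frs.
  rewrite (minn_idPl Tk) leq_eqVlt => /orP[/eqP->|tT]; last first.
    apply: (dist_row_frame (sg := sg1)) => // [t' s v t't|].
      by apply: same; rewrite neq_ltn (leq_ltn_trans t't tT).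
    by apply: rows; rewrite (minn_idPl (ltnW Tk)).
  move=> s v; have e' u : dist sg2 T s u = dist sg1 T s u.
    by have [] := same T s u; rewrite // neq_ltn ltnSn.
  case: (new s v) => [[u [h1 h2 h3]]|[h1 h2]].
    left; exists u; split=> //; last by rewrite e' h3 /price fw.
    move: h2; rewrite /better_prev e' => /and3P[-> -> /forallP h]; apply/forallP => w.
    by rewrite e'; exact: h.
  by right; split=> // u uv; rewrite e' h2.
have {rows}row t : t <= k -> dist_row sg' t.
  move=> tk; have [_] := rows; apply; rewrite leq_min tk andbT.
  by apply: leq_trans tk _; exact: ltnW.
have row0 (s v : 'I_n) : dist sg' 0 s v = if s == v then price sg' 0 v else 0.
  exact: (row 0 (leq0n k) s v).
have pw t (v : 'I_n) : price sg' t v = price sg t v by rewrite /price fr.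
split=> //.
- move=> s v p; elim/last_ind: p v => [|p w IH] v.
    move=> _ _ /= <-; rewrite row0 eqxx pw addn0 leqnn andbT.
    by apply: pos.
  rewrite size_rcons rcons_path last_rcons walk_cost_rcons => pk /andP[ps st] <-.
  have /andP[d0 dc] := IH (last s p) (ltnW pk) ps erefl.
  case: (row _ pk s w) => [[u [_ /and3P[_ u0 /forallP min] ->]]|[_ /(_ _ st) z]]; last first.
    by rewrite z in d0.
  have := min (last s p); rewrite st -lt0n d0 /= => le.
  rewrite pw addn_gt0 lt0n u0 /= leq_add2r.
  exact: leq_trans le dc.
- by move=> s v; rewrite row0; have [->|_] := eqVneq s v; rewrite ?pw ?eqxx.
- move=> t s v tk d0; case: (row _ tk s v) => [[u [h1 /and3P[h2 h3 _] h4]]|[z _]].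
    by exists u; split=> //; rewrite h4 pw.
  by rewrite z in d0.
Qed.

End DistanceTable.

Lemma row_lt n a b c : b < n -> (n * a + b < n * c) = (a < c).
Proof.
move=> bn; apply/idP/idP => h.
  by rewrite -(ltn_pmul2l (m := n)) ?(leq_ltn_trans _ h) ?leq_addr //; case: (n) bn.
by apply: leq_trans (_ : n * a.+1 <= _); [rewrite mulnSr ltn_add2l|rewrite leq_mul2l h orbT].
Qed.

(** * The cheapest meeting of two unpaired tokens *)

Section Search.
Variable n : nat.

Definition meeting (sg : store) t (s s' v : 'I_n) : bool :=
  [&& t <= sg aK 0, sg aF s != 0, sg aF s' != 0, s != s', dist sg t s v != 0
    & dist sg t s' v != 0].

Definition meeting_cost (sg : store) t (s s' v : 'I_n) : nat := dist sg t s v + dist sg t s' v.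

(** [Q] is the set of meetings examined so far; it grows during the search and contains everything
    at the end. *)
Definition best_meeting (sg sg' : store) (Q : nat -> 'I_n -> 'I_n -> 'I_n -> bool) : Prop :=
  (sg' aBest 0 = 0 /\ forall t s s' v, meeting sg t s s' v -> ~~ Q t s s' v) \/
  exists t (s s' v : 'I_n), [/\ meeting sg t s s' v,
    sg' aBest 0 = meeting_cost sg t s s' v,
    [/\ sg' aQ1 0 = s, sg' aQ2 0 = s', sg' aBt 0 = t & sg' aBv 0 = v]
    & forall t s s' v, meeting sg t s s' v -> Q t s s' v ->
        sg' aBest 0 <= meeting_cost sg t s s' v].

Lemma search_pair_correct rho sg : sg aK 0 < n * n ->
  let sg' := sexec n rho sg search_pair in
  (forall a, a \notin [:: 11; 23; 24; 25; 26] -> sg' a =1 sg a) /\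
  best_meeting sg sg' (fun _ _ _ _ => true).
Proof.
move=> kn sg'.
have fr s a sg1 rho1 : (writes a s -> a \in [:: 11; 23; 24; 25; 26]) ->
    a \notin [:: 11; 23; 24; 25; 26] -> sexec n rho1 sg1 s a =1 sg1 a.
  by move=> h na; apply: sexec_frame; apply: contra na.
split=> [a na|].
  by apply: fr na; rewrite /= !inE; do 5![case: eqP => // _].
(* The rank of a meeting in the order of the five nested loops; after [M] steps the meetings of rank
   below [M] have been examined. *)
pose code t (s s' v : nat) := n * (n * (n * t + v) + s) + s'.
pose Inv M sg1 := (forall a, a \notin [:: 11; 23; 24; 25; 26] -> sg1 a =1 sg a) /\
  best_meeting sg sg1 (fun t s s' v => code t s s' v < M).
have code_lt t (s s' v : 'I_n) m : (code t s s' v < n * (n * (n * m))) = (t < m).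
  by rewrite /code !row_lt.
suff : Inv (n * (n * (n * (n * n)))) sg'.
  case=> _ [[h1 h2]|[t [s [s' [v [h1 h2 h3 h4]]]]]]; [left|right].
    split=> // t s s' v m; have := h2 _ _ _ _ m; rewrite code_lt; apply: contra => _.
    by case/and3P: m => tk _ _; apply: leq_ltn_trans kn.
  exists t, s, s', v; split=> // t0 s0 s0' v0 m _; apply: h4 => //; rewrite code_lt.
  by case/and3P: m => tk _ _; apply: leq_ltn_trans kn.
rewrite /sg' /search_pair seqE; set sg0 := sexec n rho sg (set_scalar _ _).
apply: (for2_inv (P := fun m => Inv (n * (n * (n * m))))) => [|i j sg1 iN jN].
  split=> [a na|]; first by apply: fr na; rewrite /= inE => ->.
  by left; split=> [|t s s' v _]; rewrite ?muln0.
set T := n * i + j; set rho1 := update (update rho 0 i) 1 j; move=> [fr1 inv1].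
have hT sg2 : teval n rho1 sg2 ttime = T by rewrite teval_time /rho1 /update /=.
have ek : sg1 aK 0 = sg aK 0 by rewrite fr1.
rewrite swhenE holds_not holds_lt hT teval_scalar ek -leqNgt.
case: (leqP T (sg aK 0)) => [Tk|kT]; last first.
  split=> //; case: inv1 => [[h1 h2]|[t [s [s' [v [h1 h2 h3 h4]]]]]]; [left|right].
    split=> // t s s' v m; have := h2 _ _ _ _ m; rewrite !code_lt -!leqNgt leq_eqVlt.
    by case/orP=> // /eqP tT; move: m; rewrite -tT => /and3P[]; rewrite leqNgt kT.
  exists t, s, s', v; split=> // t0 s0 s0' v0 m; rewrite code_lt ltnS leq_eqVlt.
  case/orP=> [/eqP tT|lt]; last by apply: h4 => //; rewrite code_lt.
  by move: m; rewrite tT => /and3P[]; rewrite leqNgt kT.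
have [] : Inv (n * (n * (n * T))) sg1 by [].
move: sg1 {fr1 inv1 ek} => sg1 fr1 inv1.
rewrite (mulnSr n T) (mulnDr n (n * T)) (mulnDr n (n * (n * T))).
rewrite -mulnDr -mulnDr.
apply: (for_inv (P := fun v => Inv (n * (n * (n * T + v))))) => [|v sg2 vN inv2].
  by rewrite addn0.
rewrite addnS (mulnSr n (n * T + v)).
apply: (for_inv (P := fun s => Inv (n * (n * (n * T + v) + s)))) => [|s sg3 sN inv3].
  by rewrite addn0.
rewrite addnS (mulnSr n (n * (n * T + v) + s)).
apply: (for_inv (P := fun s' => Inv (n * (n * (n * T + v) + s) + s'))) => [|s' sg4 s'N inv4].
  by rewrite addn0.
rewrite addnS; set rho2 := update _ _ _.
pose vo := Ordinal vN; pose so := Ordinal sN; pose so' := Ordinal s'N.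
have [fr4 best4] := inv4.
have [r0 [r1 [r2 [r3 r6]]]] : rho2 0 = i /\ rho2 1 = j /\ rho2 2 = s /\ rho2 3 = v /\ rho2 6 = s'.
  by [].
have ed x (y : 'I_n) : 22 != x -> rho2 x = y -> teval n rho2 sg4 (tdist ttime (TVar x) (TVar 3)) =
  dist sg T y vo.
  by move=> nx rx; rewrite /tdist teval_arr teval_ix3 // teval_time !teval_var r0 r1 r3 rx /dist
    fr4.
have es x (y : 'I_n) : rho2 x = y -> teval n rho2 sg4 (TArr aF (TVar x)) = sg aF y.
  by move=> rx; rewrite teval_arr teval_var rx fr4.
have ec : teval n rho2 sg4 tpair_cost = meeting_cost sg T so so' vo.
  by rewrite teval_add (ed 2 so) // (ed 6 so').
have eb : holds n rho2 sg4 tbetter = meeting sg T so so' vo &&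
    ((sg4 aBest 0 == 0) || (meeting_cost sg T so so' vo < sg4 aBest 0)).
  rewrite /tbetter !holds_and holds_not holds_eq holds_or holds_not holds_lt ec !teval_var r2 r6.
  rewrite /holds (ed 2 so) // (ed 6 so') // (es 2 so) // (es 6 so') // teval_scalar negbK.
  by rewrite /meeting Tk -!andbA.
have code4 t0 (s0 s0' v0 : 'I_n) : code t0 s0 s0' v0 = code T s s' v ->
    [/\ t0 = T, s0 = so, s0' = so' & v0 = vo].
  move=> h; have [h1 e1] := row_index_inj (ltn_ord s0') s'N h.
  have [h2 e2] := row_index_inj (ltn_ord s0) sN h1.
  have [h3 e3] := row_index_inj (ltn_ord v0) vN h2.
  by split=> //; apply: val_inj.
rewrite swhenE eb; set M := n * (n * (n * T + v) + s) + s' in best4 *.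
have MC : M = code T s s' v by [].
case: ifP => [/andP[mt better]|worse].
  split=> [a na x|].
    rewrite (fr record_best) ?fr4 //.
    by rewrite /= !inE; do 5![case: eqP => // _].
  right; exists T, so, so', vo.
  have eB : sexec n rho2 sg4 record_best aBest 0 = meeting_cost sg T so so' vo by rewrite -ec.
  split=> //; first by split=> //; exact: (teval_time n rho2 sg4).
  move=> t0 s0 s0' v0 m0; rewrite ltnS leq_eqVlt MC => /orP[/eqP/code4[-> -> -> ->]|lt].
    by rewrite eB.
  rewrite eB; case: best4 => [[_ /(_ _ _ _ _ m0)]|[t1 [s1 [s1' [v1 [g1 g2 g3 g4]]]]]].
    by rewrite lt.
  apply: leq_trans (g4 _ _ _ _ m0 lt); case/orP: better => [/eqP z|/ltnW//].
  by move: g1; rewrite /meeting => /and5P[_ _ _ _ /andP[d0 _]]; move: g2 d0; rewrite z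
    /meeting_cost; lia.
split=> //; case: best4 => [[h1 h2]|[t1 [s1 [s1' [v1 [g1 g2 g3 g4]]]]]]; [left|right].
  split=> // t0 s0 s0' v0 m0; rewrite ltnS leq_eqVlt negb_or h2 // andbT.
  apply/eqP => /code4[e1 e2 e3 e4]; move: worse m0; rewrite e1 e2 e3 e4 h1 eqxx andbT => ->.
  by [].
exists t1, s1, s1', v1; split=> // t0 s0 s0' v0 m0; rewrite ltnS leq_eqVlt.
case/orP=> [/eqP/code4[e1 e2 e3 e4]|]; last exact: g4.
move: worse m0; rewrite e1 e2 e3 e4 => + m0; rewrite m0 /= => /negbT.
by rewrite negb_or -leqNgt => /andP[].
Qed.

End Search.

(** * Recovering a cheapest walk *)

Section Trace.
Variables (n : nat) (e : rel 'I_n).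

Lemma row_eq a b c d : b < n -> d < n -> (n * a + b == n * c + d) = (a == c) && (b == d).
Proof.
move=> bn dn; apply/eqP/andP => [h|[/eqP-> /eqP->] //].
by have [-> ->] := row_index_inj bn dn h.
Qed.

Definition backtracks (sg : store) (s : 'I_n) (bt : nat) (P : nat -> 'I_n) : Prop :=
  forall t, t < bt -> previous sg t.+1 s (P t.+1) = P t.

Lemma backtrack sg (s v : 'I_n) bt k : bt <= k ->
    (forall v : 'I_n, dist sg 0 s v != 0 -> s = v /\ dist sg 0 s v = price sg 0 v) ->
    (forall t (v : 'I_n), t < k -> dist sg t.+1 s v != 0 ->
        exists u : 'I_n, [/\ previous sg t.+1 s v = u, stay_or_move e u v, dist sg t s u != 0
          & dist sg t.+1 s v = dist sg t s u + price sg t.+1 v]) ->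
    dist sg bt s v != 0 ->
  exists P : nat -> 'I_n, [/\ P bt = v, route e s bt P, backtracks sg s bt P
    & \sum_(t < bt.+1) price sg t (P t) = dist sg bt s v].
Proof.
move=> bk h0 h1; elim: bt v bk => [|bt IH] v bk d0.
  have [sv dE] := h0 v d0; exists (fun=> v); split=> //.
  by rewrite big_ord1 dE.
have [u [pu uv du dE]] := h1 bt v bk d0.
have [P [P1 [P2 P3] P4 P5]] := IH u (ltnW bk) du.
pose P' t := if t <= bt then P t else v.
have PP t : t <= bt -> P' t = P t by rewrite /P' => ->.
have Pv : P' bt.+1 = v by rewrite /P' ltnn.
exists P'; split=> //.
- split=> [|t]; first by rewrite PP.
  rewrite ltnS leq_eqVlt => /orP[/eqP->|tb]; first by rewrite (PP bt) // Pv P1.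
  by rewrite !PP ?P3 ?(ltnW tb).
- move=> t; rewrite ltnS leq_eqVlt => /orP[/eqP->|tb]; first by rewrite (PP bt) // Pv P1.
  by rewrite !PP ?P4 ?(ltnW tb).
- rewrite big_ord_recr /= Pv dE -P5; congr (_ + _); apply: eq_bigr => t _.
  by rewrite PP // -ltnS.
Qed.

Lemma trace_correct rho (sg : store) (q : nat) (qv : 'I_n) (bt : nat) (P : nat -> 'I_n) : q \in
  [:: 23; 24] ->
    sg q 0 = qv :> nat -> sg aBt 0 = bt -> sg aBv 0 = P bt :> nat -> bt <= sg aK 0 -> sg aK 0 < n
      * n ->
    backtracks sg qv bt P ->
  let sg' := sexec n rho sg (trace q) in
  [/\ forall a, a \notin [:: 6; 7; 12] -> sg' a =1 sg a,
      forall t (v : 'I_n), price sg' t v = raise (price sg) bt P t v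
    & forall t (s : 'I_n), sg' aX (n * t + s) =
        if (s == qv) && (t <= sg aK 0) then (P (minn t bt) : nat) else sg aX (n * t + s)].
Proof.
move=> qin hq hbt hbv; set k := sg aK 0 => bk kn hP sg'.
(* After [T] steps the times above [k - T] are done; writing this as [k < t + T] avoids truncated
   subtraction. *)
pose Inv (T : nat) (sg1 : store) := [/\ forall a, a \notin [:: 6; 7; 12] -> sg1 a =1 sg a,
  forall t (v : 'I_n), price sg1 t v =
    if [&& t <= bt, k < t + T & v == P t] then 2 * price sg t v else price sg t v,
  forall t (s : 'I_n), sg1 aX (n * t + s) =
        if [&& s == qv, t <= k & k < t + T] then (P (minn t bt) : nat) else sg aX (n * t + s)
  & T <= k -> sg1 aCur 0 = P (minn (k - T) bt) :> nat].
have : Inv (n * n) sg'.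
  rewrite /sg' /trace seqE; apply: for2_inv => [|i j sg1 iN jN].
    split=> [a|t v|t s|_].
    - by rewrite !inE !negb_or => /and3P[_ _ na]; apply: sexec_frame; rewrite /= na.
    - rewrite addn0 /price sexec_frame //; case: ifP => // /and3P[h1 h2 _].
      by move: (leq_trans h2 (leq_trans h1 bk)); rewrite ltnn.
    - rewrite addn0 sexec_frame //; case: ifP => // /and3P[_ h1 h2].
      by move: (leq_trans h2 h1); rewrite ltnn.
    - by rewrite subn0 (minn_idPr bk) /= /store_set /= hbv.
  set T := n * i + j; set rho1 := update (update rho 0 i) 1 j; move=> [fr1 w1 x1 c1].
  have hT sg2 : teval n rho1 sg2 ttime = T by rewrite teval_time /rho1 /update /=.
  have ek : sg1 aK 0 = k by rewrite fr1.
  rewrite swhenE holds_not holds_lt hT teval_scalar ek -leqNgt.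
  case: (leqP T k) => [Tk|kT]; last first.
    split=> // [t v|t s|Tk]; last by move: (leq_trans kT (ltnW Tk)); rewrite ltnn.
      by rewrite w1; congr (if _ then _ else _); case: (t <= bt) => //=; congr (_ && _); lia.
    by rewrite x1; congr (if _ then _ else _); case: (s == qv); case: (t <= k) => //=; lia.
  set t0 := k - T; have t0k : t0 <= k by exact: leq_subr.
  have hb sg2 : sg2 aK 0 = k -> teval n rho1 sg2 tback = t0.
    by move=> e2; rewrite teval_sub teval_scalar e2 hT.
  have fq : sg1 q 0 = qv by rewrite fr1 //; move: qin; rewrite !inE => /orP[]/eqP->.
  have q7 : q != 7 by move: qin; rewrite !inE => /orP[]/eqP->.
  have cur1 := c1 Tk; rewrite -/t0 in cur1.
  pose sg2 := store_set sg1 aX (n * t0 + qv) (P (minn t0 bt)).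
  have e2 : sexec n rho1 sg1 (SAsg aX (tix2 tback (tscalar q)) (tscalar aCur)) = sg2.
    rewrite -[LHS]/(store_set sg1 aX (teval n rho1 sg1 (tix2 tback (tscalar q)))
      (teval n rho1 sg1 (tscalar aCur))).
    by rewrite teval_ix2 // !teval_scalar hb // fq cur1.
  have f2 a : a != 7 -> sg2 a =1 sg1 a by move=> na b; rewrite /sg2 /store_set (negbTE na).
  have x2 t (s : 'I_n) : sg2 aX (n * t + s) =
      if [&& s == qv, t <= k & k < t + T.+1] then (P (minn t bt) : nat) else sg aX (n * t + s).
    rewrite /sg2 /store_set eqxx /= row_eq // val_eqE x1.
    case: (eqVneq s qv) => [->|]; rewrite ?andbF //= andbT.
    case: (eqVneq t t0) => [->|nt]; first by rewrite t0k /= /t0 addnS subnK // ltnSn.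
    by case: (leqP t k) => //= tk; congr (if _ then _ else _); move: nt; rewrite /t0; lia.
  have ek2 : sg2 aK 0 = k by rewrite f2.
  have hbt2 : sg2 aBt 0 = bt by rewrite f2 // fr1.
  have cur2 : sg2 aCur 0 = P (minn t0 bt) by rewrite f2.
  rewrite /trace_body seqE e2 swhenE holds_not holds_lt hb // teval_scalar hbt2 -leqNgt.
  case: (leqP t0 bt) => [t0b|bt0]; last first.
    split=> [a na b|t v|t s|Tk'].
    - by rewrite f2 ?fr1 //; apply: contra na => /eqP->.
    - rewrite /price f2 // -/(price sg1 t v) w1; congr (if _ then _ else _).
      by case: (leqP t bt) => //= tb; congr (_ && _); move: bt0; rewrite /t0; lia.
    - exact: x2.
    - rewrite cur2; congr (nat_of_ord (P _)); rewrite (minn_idPr (ltnW bt0)).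
      by apply/esym/minn_idPr; move: bt0; rewrite /t0; lia.
  rewrite (minn_idPl t0b) in cur2.
  pose sg3 := store_set sg2 aW (n * t0 + P t0) (2 * price sg t0 (P t0)).
  have w2 : sg2 aW (n * t0 + P t0) = price sg t0 (P t0).
    rewrite f2 // -/(price sg1 t0 (P t0)) w1; case: ifP => // /and3P[_ h _].
    by move: h; rewrite /t0 subnK // ltnn.
  have e3 : sexec n rho1 sg2 (SAsg aW (tix2 tback (tscalar aCur))
       (TAdd (TArr aW (tix2 tback (tscalar aCur))) (TArr aW (tix2 tback (tscalar aCur))))) = sg3.
    rewrite -[LHS]/(store_set sg2 aW (teval n rho1 sg2 (tix2 tback (tscalar aCur)))
      (sg2 aW (teval n rho1 sg2 (tix2 tback (tscalar aCur))) +
       sg2 aW (teval n rho1 sg2 (tix2 tback (tscalar aCur))))).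
    by rewrite teval_ix2 // teval_scalar hb // cur2 w2 addnn -mul2n.
  have f3 a : a != 6 -> sg3 a =1 sg2 a by move=> na b; rewrite /sg3 /store_set (negbTE na).
  have ek3 : sg3 aK 0 = k by rewrite f3.
  rewrite seqE e3; set sg4 := sexec _ _ _ _.
  have f4 a : a != 12 -> sg4 a =1 sg3 a.
    by move=> na; rewrite /sg4; apply: sexec_frame; rewrite /= (negbTE na).
  have c4 : sg4 aCur 0 = previous sg t0 qv (P t0).
    rewrite -[LHS]/(sg3 aP (teval n rho1 sg3 (tix3 tback (tscalar q) (tscalar aCur)))).
    rewrite teval_ix3 // hb // !teval_scalar f3 // f2 // fr1 // /previous.
    congr (sg _ (_ * (_ + _) + _)); last by rewrite f3.
    by rewrite f3 ?f2 //; move: qin; rewrite !inE => /orP[]/eqP->.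
  split=> [a na b|t v|t s|Tk'].
  - move: (na); rewrite !inE !negb_or => /and3P[n6 n7 n12].
    by rewrite f4 // f3 // f2 // fr1.
  - rewrite /price f4 // /sg3 /store_set eqxx /= row_eq // val_eqE.
    rewrite f2 // -/(price sg1 t v) w1.
    case: (eqVneq t t0) => [->|nt] /=.
      have -> : k < t0 + T.+1 by rewrite /t0 addnS subnK.
      rewrite t0b /=; case: (eqVneq v (P t0)) => [->//|nv].
      by rewrite andbF.
    congr (if _ then _ else _).
    case: (leqP t bt) => //= tb; congr (_ && _); move: nt; rewrite /t0; lia.
  - by rewrite f4 // f3 // x2.
  - rewrite c4; have t1 : t0 = (k - T.+1).+1 by rewrite /t0; lia.
    have l1 : k - T.+1 < bt by rewrite -t1.
    by rewrite (minn_idPl (ltnW l1)) {1}t1 t1 hP.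
case=> fr1 w1 x1 _; split=> // [t v|t s].
  rewrite w1 /raise; congr (if _ then _ else _).
  by case: (leqP t bt) => //= tb; rewrite (leq_trans kn) ?leq_addl.
rewrite x1; congr (if _ then _ else _); congr (_ && _).
by rewrite (leq_trans kn) ?andbT // leq_addl.
Qed.

End Trace.

Lemma potential_gt0 N : 0 < potential N.
Proof. by rewrite /potential !muln_gt0 !addn_gt0 !orbT. Qed.

Lemma leq_potential M N : M <= N -> potential M <= potential N.
Proof. by move=> h; rewrite /potential !leq_mul // leq_add2r. Qed.

(** * Pairing tokens and the growth of prices *)

Section Pairing.
Variables (n : nat) (e : rel 'I_n).
Implicit Types (sg : store) (k : nat).

Lemma walk_cost_ext (W W' : nat -> 'I_n -> nat) s p : (forall t v, W t v = W' t v) ->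
  walk_cost W s p = walk_cost W' s p.
Proof.
elim: p s W W' => [|y p IH] s W W' h /=; rewrite h //.
by rewrite (IH _ _ (fun t => W' t.+1)).
Qed.

Definition positions sg k (X : nat -> 'I_n -> 'I_n) : Prop :=
  forall t (s : 'I_n), t <= k -> sg aX (n * t + s) = X t s.

Definition prices sg k (W : nat -> 'I_n -> nat) : Prop :=
  forall t (v : 'I_n), t <= k -> price sg t v = W t v.

Definition members sg a (S : {set 'I_n}) : Prop :=
  forall s : 'I_n, (sg a s != 0) = (s \in S).

(** The second walk is charged at prices already raised by the first. This doubling is the reason
    why a pair of cost [c] may raise the total by [2 * c]. *)
Lemma price_sum (W : nat -> 'I_n -> nat) (bt : nat) (P P' : nat -> 'I_n) :
  \sum_(t < bt.+1) raise W bt P t (P' t) <= 2 * \sum_(t < bt.+1) W t (P' t).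
Proof. by rewrite big_distrr /=; apply: leq_sum => t _; exact: raise_le. Qed.

Definition feasible k : Prop := exists2 s, completes_gossip e s & size s = k.

(** Any node can serve as common destination in [cheap_pair], since gossip brings all messages
    everywhere. No token has paid anything at time 0, so [a] is 0 there. *)
Lemma meeting_bound sg k c (F : {set 'I_n}) : feasible k -> sg aK 0 = k -> members sg aF F ->
    (forall (s v : 'I_n) p, size p <= k -> path (stay_or_move e) s p -> last s p = v ->
        0 < dist sg (size p) s v <= walk_cost (price sg) s p) ->
    (forall t (s s' v : 'I_n), meeting sg t s s' v -> c <= meeting_cost sg t s s' v) ->
  c * #|F|.-1 <= 4 * \sum_(t < k.+1) \sum_(v < n) price sg t v.
Proof.
case=> sch comp sz ek mem dP min.
have [F0|] := eqVneq F set0; first by rewrite F0 cards0 muln0.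
case/set0Pn => r _.
have := @cheap_pair _ e c sch r F (price sg) (fun=> 0).
have sub : {subset F <= knowledge e sch r} by move=> u _; exact: comp.
move=> /(_ sub) h; apply: leq_trans (h _) _ => [s s' p p' sF s'F nq wp wp' sp lp lst|].
  rewrite sz in lp; rewrite !add0n.
  have /andP[d0 dc] := dP s _ p lp wp erefl.
  have lp' : size p' <= k by rewrite -sp.
  have /andP[d0' dc'] := dP s' _ p' lp' wp' erefl.
  apply: leq_trans (min (size p) s s' (last s p) _) _.
    by rewrite /meeting ek lp !mem sF s'F nq -!lt0n d0 /= sp lst.
  by rewrite /meeting_cost; apply: leq_add => //; rewrite sp lst.
rewrite sz -[leqRHS](mulnA 2 2) leq_mul2l /=.
rewrite -(big_mkord xpredT (fun t => \sum_(v < n) price sg t v)) [in leqRHS]big_ltn //.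
rewrite mulnDr leq_add2r; apply: leq_trans (leq_pmull _ (isT : 0 < 2)).
by rewrite [leqLHS]big_mkcond; apply: leq_sum => v _; case: ifP.
Qed.

(** Feasibility of [k] is assumed for the last clause only: under a wrong guess the walks must still
    be genuine, because the run may succeed nevertheless. *)
Lemma pair_up_correct rho sg k S X W F : graph_in e sg -> sg aK 0 = k -> k < n * n ->
    pairing e k S X W F -> positions sg k X -> prices sg k W -> members sg aF F ->
  let sg' := sexec n rho sg pair_up in
  (forall a, a \notin [:: 6; 7; 8; 9; 10; 11; 12; 23; 24; 25; 26; 28] -> sg' a =1 sg a) /\
  exists X' W' F', [/\ pairing e k S X' W' F', positions sg' k X', prices sg' k W',
    members sg' aF F' & feasible k -> #|F'| <= maxn 1 (#|F| - 2) /\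
      total_price k W' * potential #|F'| <= total_price k W * potential #|F| ].
Proof.
move=> hE ek kn pr hX hW hF sg'.
split=> [a na|].
  apply: sexec_frame; move: na; rewrite !inE !negb_or /=.
  by case/and5P => /negbTE-> /negbTE-> /negbTE-> /negbTE->; case/and5P => /negbTE-> /negbTE->
    /negbTE-> /negbTE-> /and4P[/negbTE-> /negbTE-> /negbTE-> /negbTE->].
have kn' : sg aK 0 < n * n by rewrite ek.
have pos t (v : 'I_n) : t <= sg aK 0 -> 0 < price sg t v.
  by move=> tk; rewrite hW -?ek //; apply: rt_pos (pr_routing pr) _ _.
have := distances_correct rho hE kn' pos.
set sg1 := sexec n rho sg distances => -[fr1 dA dB dC].
rewrite ek in dA dC.
have ek1 : sg1 aK 0 = k by rewrite fr1.
have kn1 : sg1 aK 0 < n * n by rewrite ek1.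
have := search_pair_correct (n := n) rho kn1.
set sg2 := sexec n rho sg1 search_pair => -[fr2 best].
have W1 t (v : 'I_n) : price sg1 t v = price sg t v by rewrite /price fr1.
have W2 t (v : 'I_n) : price sg2 t v = price sg t v by rewrite /price fr2 ?fr1.
have F1 : members sg1 aF F by move=> s; rewrite fr1.
have total : \sum_(t < k.+1) \sum_(v < n) price sg1 t v = total_price k W.
  by apply: eq_bigr => t _; apply: eq_bigr => v _; rewrite W1 hW // -ltnS.
have e' : sg' = if sg2 aBest 0 != 0 then
    sexec n rho sg2 (trace aQ1 ;; trace aQ2 ;;
     SAsg aF (tscalar aQ1) (TCst 0) ;; SAsg aF (tscalar aQ2) (TCst 0)) else sg2 by [].
have mb c : feasible k -> (forall t (s s' v : 'I_n), meeting sg1 t s s' v ->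
    c <= meeting_cost sg1 t s s' v) -> c * #|F|.-1 <= 4 * total_price k W.
  move=> fs h; rewrite -total; apply: (@meeting_bound sg1 k c F) => //.
  move=> s v p h1 h2 h3; rewrite (walk_cost_ext (W' := price sg)) //.
  exact: dA.
case: best => [[b0 none]|[bt [q [q' [v [mt bE [hq1 hq2 hbt hbv] min]]]]]].
  rewrite b0 eqxx /= in e'.
  exists X, W, F; split=> //.
  - by move=> t s tk; rewrite e' fr2 // fr1 // hX.
  - by move=> t w tk; rewrite e' W2 hW.
  - by move=> s; rewrite e' fr2.
  move=> fs; split=> //; apply: leq_trans (leq_maxl _ _).
  (* Without any meeting the bound holds for every [c]; taking [c = 4 Z + 1] leaves at most one
     unpaired token. *)
  have := mb (4 * total_price k W).+1 fs; rewrite mulSn.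
  move=> h; rewrite leqNgt; apply/negP => F2.
  have : (4 * total_price k W).+1 * #|F|.-1 <= 4 * total_price k W.
    by apply: mb => // t s s' w m; have := none _ _ _ _ m.
  by case: #|F| F2 => [|[|N]] //= _; rewrite mulnSr => /(leq_trans (leq_addl _ _)); rewrite ltnn.
have {}min t (s s' w : 'I_n) : meeting sg1 t s s' w -> sg2 aBest 0 <= meeting_cost sg1 t s s' w.
  by move=> m; apply: min m _.
have bk : bt <= k by rewrite -ek1; case/andP: mt.
have [qF q'F nq dq dq'] : [/\ q \in F, q' \in F, q != q', dist sg1 bt q v != 0 &
    dist sg1 bt q' v != 0].
  by case/and5P: mt => _ h1 h2 h3 /andP[h4 h5]; split=> //; rewrite -F1.
have bn : sg2 aBest 0 != 0 by rewrite bE /meeting_cost addn_eq0 negb_and dq.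
rewrite bn in e'.
have dCW t (s w : 'I_n) : t < k -> dist sg1 t.+1 s w != 0 ->
        exists u : 'I_n, [/\ previous sg1 t.+1 s w = u, stay_or_move e u w, dist sg1 t s u != 0
          & dist sg1 t.+1 s w = dist sg1 t s u + price sg1 t.+1 w].
  by move=> tk d; rewrite W1; exact: dC.
have dBW (s w : 'I_n) : dist sg1 0 s w != 0 -> s = w /\ dist sg1 0 s w = price sg1 0 w.
  by rewrite W1; exact: dB.
have [P [Pv rP bP cP]] := backtrack bk (dBW q) (fun t w => @dCW t q w) dq.
have [P' [Pv' rP' bP' cP']] := backtrack bk (dBW q') (fun t w => @dCW t q' w) dq'.
have fP s (w : 'I_n) t : previous sg2 t s w = previous sg1 t s w by rewrite /previous fr2.
have ek2 : sg2 aK 0 = k by rewrite fr2.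
have t1 := @trace_correct n rho sg2 aQ1 q bt P.
set sg3 := sexec n rho sg2 (trace aQ1) in e' t1.
have [|||||||fr3 w3 x3] := t1; rewrite ?ek2 ?Pv //.
  by move=> t tb; rewrite fP bP.
have ek3 : sg3 aK 0 = k by rewrite fr3.
have t2 := @trace_correct n rho sg3 aQ2 q' bt P'.
set sg4 := sexec n rho sg3 (trace aQ2) in t2.
have [|||||||fr4 w4 x4] := t2; rewrite ?ek3 ?Pv' ?fr3 //.
  by move=> t tb; rewrite /previous fr3 // -/(previous sg2 t.+1 q' (P' t.+1)) fP bP'.
have q14 : sg4 aQ1 0 = q by rewrite fr4 // fr3.
have q24 : sg4 aQ2 0 = q' by rewrite fr4 // fr3.
pose sg5 := store_set (store_set sg4 aF q 0) aF q' 0.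
have e5 : sg' = sg5.
  rewrite e' !seqE -/sg4.
  have -> : sexec n rho sg4 (SAsg aF (tscalar aQ1) (TCst 0)) = store_set sg4 aF q 0.
    by rewrite -q14.
  by rewrite /sg5 -q24.
have fr5 a : a != 8 -> sg5 a =1 sg4 a by move=> na b; rewrite /sg5 /store_set (negbTE na).
exists (reroute (reroute X q bt P) q' bt P'), (raise (raise W bt P) bt P'), (F :\ q :\ q').
have prW : prices sg' k (raise (raise W bt P) bt P').
  move=> t w tk; rewrite e5 /price fr5 // -/(price sg4 t w) w4.
  rewrite {1}/raise {2}/raise w3 {1}/raise {1}/raise W2 hW //.
split=> //.
- by apply: pairing_step => //; rewrite Pv Pv'.
- move=> t s tk; rewrite e5 fr5 // x4 ek3 tk andbT /reroute.
  case: eqP => // _; rewrite x3 ek2 tk andbT.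
  by case: eqP => // _; rewrite fr2 // fr1 // hX.
- move=> s; rewrite e5 /sg5 /store_set eqxx /= !val_eqE !inE.
  case: (eqVneq s q') => //= _; case: (eqVneq s q) => //= _.
  by rewrite fr4 // fr3 // fr2.
move=> fs.
have cF : #|F| = #|F :\ q :\ q'|.+2.
  by rewrite (cardsD1 q) qF (cardsD1 q') !inE eq_sym nq q'F.
split; first by apply: leq_trans (leq_maxr _ _); rewrite cF subn2.
have -> : #|F :\ q :\ q'| = #|F|.-2 by rewrite cF.
have h := mb (sg2 aBest 0) fs min.
apply: potential_step h; first by rewrite cF.
rewrite !total_price_raise // -addnA leq_add2l bE /meeting_cost.
have sumW (p : nat -> 'I_n) : \sum_(t < bt.+1) W t (p t) = \sum_(t < bt.+1) price sg1 t (p t).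
  by apply: eq_bigr => t _; rewrite W1 hW // (leq_trans _ bk) // -ltnS.
have := price_sum W bt P P'; rewrite !sumW cP cP'; lia.
Qed.

End Pairing.

Lemma time_table n rho sg a x w t c : x \notin [:: 0; 1; 21] -> ~~ reads a w ->
    t < n * n -> c < n ->
  sexec n rho sg (loops [:: 0; 1; x] (SAsg a (tix2 ttime (TVar x)) w)) a (n * t + c) =
  teval n (binds rho [:: 0; 1; x] [:: t %/ n; t %% n; c]) sg w.
Proof.
rewrite !inE !negb_or => /and3P[x0 x1 x21] na tn cn.
have ixE sg0 vals i j c' : vals = [:: i; j; c'] ->
    teval n (binds rho [:: 0; 1; x] vals) sg0 (tix2 ttime (TVar x)) = n * (n * i + j) + c'.
  move=> ->; rewrite teval_ix2 // teval_time teval_var /= /update.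
  by move: x0 x1; case: (x) => [|[|x']]; rewrite ?eqxx.
have n0 : 0 < n by case: (n) cn.
have tE : n * (t %/ n) + t %% n = t by rewrite mulnC -divn_eq.
rewrite -{1}tE -(ixE sg [:: t %/ n; t %% n; c]) // (table_asg (xs := [:: 0; 1; x])) //.
  move=> vals vals' /tuple_inP3[i [j [l [hi hj hl ev]]]] /tuple_inP3[i' [j' [l' [hi' hj' hl'
    ev']]]].
  rewrite (ixE _ _ _ _ _ ev) (ixE _ _ _ _ _ ev') => h; rewrite ev ev'.
  have [h1 ->] := row_index_inj hl hl' h.
  by have [-> ->] := row_index_inj hj hj' h1.
by rewrite tuple_in3 ltn_mod n0 cn ltn_divLR // tn.
Qed.

Lemma vector_table n rho sg a x w c : ~~ reads a w -> c < n ->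
  sexec n rho sg (loops [:: x] (SAsg a (TVar x) w)) a c = teval n (update rho x c) sg w.
Proof.
move=> na cn.
have ixE sg0 vals c' : vals = [:: c'] -> teval n (binds rho [:: x] vals) sg0 (TVar x) = c'.
  by move=> ->; rewrite teval_var /= /update eqxx.
rewrite -{1}(ixE sg [:: c] c) // (table_asg (xs := [:: x])) ?tuple_in1 //.
move=> vals vals' /tuple_inP1[i hi ev] /tuple_inP1[i' hi' ev'].
by rewrite (ixE _ _ _ ev) (ixE _ _ _ ev') ev ev' => ->.
Qed.

Section PairAll.
Variables (n : nat) (e : rel 'I_n).
Implicit Types (sg : store) (k : nat).

Lemma routing_init k : routing e k (fun _ s => s) (fun _ _ => 1).
Proof.
split=> // [t s _|t v _|t v _]; first by rewrite /stay_or_move eqxx.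
  by rewrite (_ : [set s | _] = set0) ?cards0 //; apply/setP => s; rewrite !inE andbN.
by rewrite (_ : [set s | _] = set0) ?cards0 //; apply/setP => s; rewrite !inE andbN.
Qed.

Lemma pairing_init k S : pairing e k S (fun _ s => s) (fun _ _ => 1) S.
Proof. by split=> //; rewrite ?setDv ?cards0 ?imset0 ?cards0 //; exact: routing_init. Qed.

(** All prices start at 1, so the product of total price and potential is at most
    [k.+1 * n * potential n] initially. It does not grow and the potential stays positive, whence
    the final prices are polynomial. *)
Lemma pair_all_correct rho sg k S : graph_in e sg -> sg aK 0 = k -> k < n * n ->
    members sg aS S ->
  let sg' := sexec n rho sg (init_phase ;; SFor 13 pair_up) in
  (forall a, a \notin [:: 6; 7; 8; 9; 10; 11; 12; 23; 24; 25; 26; 28] -> sg' a =1 sg a) /\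
  exists X W F, [/\ pairing e k S X W F, positions sg' k X &
    feasible e k -> #|F| <= 1 /\ total_price k W <= k.+1 * n * potential n].
Proof.
move=> hE ek kn hS sg'.
split=> [a na|].
  apply: sexec_frame; move: na; rewrite !inE !negb_or /=.
  by case/and5P => /negbTE-> /negbTE-> /negbTE-> /negbTE->; case/and5P => /negbTE-> /negbTE->
    /negbTE-> /negbTE-> /and4P[/negbTE-> /negbTE-> /negbTE-> /negbTE->].
set sg0 := sexec n rho sg init_phase.
have fr0 a : a \notin [:: 6; 7; 8] -> sg0 a =1 sg a.
  move=> na; apply: sexec_frame; move: na; rewrite !inE !negb_or /=.
  by case/and3P => /negbTE-> /negbTE-> /negbTE->.
pose L1 := loops [:: 0; 1; 3] (SAsg aW (tix2 ttime (TVar 3)) (TCst 1)).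
pose L2 := loops [:: 0; 1; 2] (SAsg aX (tix2 ttime (TVar 2)) (TVar 2)).
pose L3 := loops [:: 2] (SAsg aF (TVar 2) (TArr aS (TVar 2))).
have e0 : sg0 = sexec n rho (sexec n rho (sexec n rho sg L1) L2) L3 by [].
have tn t : t <= k -> t < n * n by move=> tk; exact: leq_ltn_trans kn.
have hX0 : positions sg0 k (fun _ (s : 'I_n) => s).
  move=> t s tk; by rewrite e0 sexec_frame // /L2 time_table ?tn.
have hW0 : prices sg0 k (fun _ (_ : 'I_n) => 1).
  by move=> t v tk; rewrite /price e0 sexec_frame // sexec_frame // /L1 time_table ?tn.
have hF0 : members sg0 aF S.
  move=> s; rewrite e0 /L3 vector_table // teval_arr teval_var /update eqxx.
  by rewrite sexec_frame // sexec_frame // hS.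
pose P i sg1 := [/\ graph_in e sg1, sg1 aK 0 = k & exists X W F, [/\ pairing e k S X W F,
  positions sg1 k X, prices sg1 k W, members sg1 aF F & feasible e k ->
    #|F| <= maxn 1 (n - 2 * i) /\ total_price k W * potential #|F| <= k.+1 * n * potential n]].
suff : P n sg'.
  case=> _ _ [X [W [F [h1 h2 h3 h4 h5]]]]; exists X, W, F; split=> // fs; have [c1 c2] := h5 fs.
  split; first by apply: leq_trans c1 _; rewrite geq_max /= leq_subLR; lia.
  by apply: leq_trans c2; rewrite leq_pmulr // potential_gt0.
rewrite /sg' seqE -/sg0; apply: for_inv => [|i sg1 iN [g1 k1 [X [W [F [h1 h2 h3 h4 h5]]]]]].
  split; [by move=> u v; rewrite fr0|by rewrite fr0|].
  exists (fun _ s => s), (fun _ _ => 1), S; split=> //; first exact: pairing_init.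
  move=> _; have cS : #|S| <= n by rewrite -[leqRHS]card_ord max_card.
  split; first by rewrite muln0 subn0 leq_max cS orbT.
  rewrite leq_mul ?leq_potential // /total_price.
  apply: leq_trans (_ : \sum_(t < k.+1) n <= _); last by rewrite sum_nat_const card_ord.
  by apply: leq_sum => t _; rewrite sum_nat_const card_ord muln1.
have [fr [X' [W' [F' [h1' h2' h3' h4' h5']]]]] :=
  pair_up_correct (update rho 13 i) g1 k1 kn h1 h2 h3 h4.
split; [by move=> u v; rewrite fr|by rewrite fr|].
exists X', W', F'; split=> // fs; have [c1 c2] := h5 fs; have [c1' c2'] := h5' fs.
split; last exact: leq_trans c2' c2.
apply: leq_trans c1' _; rewrite geq_max leq_maxl /=; move: #|F| c1 => N; lia.
Qed.

End PairAll.

(** * Greedy colouring of the moves of one time step *)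

Section Coloring.
Variables (n : nat) (e : rel 'I_n) (x y : 'I_n -> 'I_n).
Implicit Types (sg : store) (rho : nat -> nat).

Definition mover s : bool := x s != y s.
Definition clash s s' : bool := interferes e x y s s'.

Lemma clashC s s' : clash s s' = clash s' s.
Proof. by rewrite /clash /interferes orbC. Qed.

(** Degeneracy of the conflict graph, which greedy colouring turns into [D.+1] colours. *)
Definition sparse (D : nat) : Prop := forall I : {set 'I_n}, I != set0 ->
  {in I, forall s, mover s} -> exists2 s, s \in I & #|[set s' in I | clash s s']| <= D.

Definition moves_in sg t : Prop := graph_in e sg /\
  forall s : 'I_n, sg aX (n * t + s) = x s /\ sg aX (n * t.+1 + s) = y s.

Lemma moves_in_frame sg sg' t : sg' aE =1 sg aE -> sg' aX =1 sg aX -> moves_in sg t ->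
  moves_in sg' t.
Proof. by move=> hE hX [h1 h2]; split=> [u v|s]; rewrite ?hE ?hX. Qed.

Section Terms.
Variables (rho : nat -> nat) (sg : store) (t : nat).
Hypotheses (ht : n * rho 0 + rho 1 = t) (hm : moves_in sg t).

Lemma teval_pos u (s : 'I_n) : ~~ occurs 21 u -> teval n rho sg u = s ->
  teval n rho sg (tpos u) = x s.
Proof.
move=> fr us; rewrite /tpos teval_arr teval_ix2 // teval_time us ht.
by case: hm => _ /(_ s) [].
Qed.

Lemma teval_pos' u (s : 'I_n) : ~~ occurs 21 u -> teval n rho sg u = s ->
  teval n rho sg (tpos' u) = y s.
Proof.
move=> fr us; rewrite /tpos' teval_arr teval_ix2 // /tnext teval_add teval_time us ht.
by rewrite teval_cst addn1; case: hm => _ /(_ s) [].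
Qed.

Lemma holds_moves u (s : 'I_n) : ~~ occurs 21 u -> teval n rho sg u = s ->
  holds n rho sg (tmoves u) = mover s.
Proof. by move=> fr us; rewrite /tmoves holds_not holds_eq (teval_pos fr us) (teval_pos' fr us).
  Qed.

Lemma holds_interferes u u' (s s' : 'I_n) : ~~ occurs 21 u -> ~~ occurs 21 u' ->
    ~~ occurs 24 u -> ~~ occurs 24 u' -> teval n rho sg u = s -> teval n rho sg u' = s' ->
  holds n rho sg (tinterferes u u') = clash s s'.
Proof.
move=> f1 f2 f3 f4 us us'; have [hE _] := hm.
have g3 : ~~ occurs 24 (tpos u) by rewrite /= (negbTE f3).
have g4 : ~~ occurs 24 (tpos u') by rewrite /= (negbTE f4).
rewrite /tinterferes holds_or /holds !teval_edge //.
rewrite (teval_pos f1 us) (teval_pos f2 us') (teval_pos' f1 us) (teval_pos' f2 us') !hE.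
by rewrite /clash /interferes; do 2![case: (e _ _)].
Qed.

End Terms.

Definition alive sg s : bool := mover s && (sg aEl s == 0).
Definition degree sg s : nat := #|[set s' | alive sg s' && clash s s']|.

Lemma holds_alive rho sg t z (s : 'I_n) : n * rho 0 + rho 1 = t -> moves_in sg t ->
  21 != z -> rho z = s -> holds n rho sg (talive z) = alive sg s.
Proof.
move=> ht hm nz rz; rewrite /talive holds_and holds_not (@holds_moves _ _ _ ht hm _ s) //.
by rewrite /holds teval_arr teval_var rz negbK.
Qed.

Lemma teval_degree rho sg t z (s : 'I_n) : n * rho 0 + rho 1 = t -> moves_in sg t ->
  z \notin [:: 9; 21; 24] -> rho z = s -> teval n rho sg (tdegree z) = degree sg s.
Proof.
rewrite !inE !negb_or => ht hm /and3P[z9 z21 z24] rz; rewrite /tdegree teval_card.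
apply: eq_card => s'; rewrite !inE holds_and (@holds_alive _ _ t _ s') //.
rewrite (@holds_interferes _ _ t _ _ _ _ s s') //=; try by rewrite eq_sym.
by rewrite /update (negbTE z9).
Qed.

(** Numbers start at 1, and 0 marks a token not eliminated. The last clause records the conflicts of
    [s] at the moment of its removal, with tokens still alive or not removed before it; later this
    bounds the colour of [s]. *)
Definition elimination (sg : store) (i : nat) : Prop := [/\
  forall s : 'I_n, sg aEl s <> 0 -> mover s && (sg aEl s <= i),
  forall s s' : 'I_n, sg aEl s = sg aEl s' -> sg aEl s <> 0 -> s = s',
  #|[set s | alive sg s]| <= n - i
  & forall D, sparse D -> forall s : 'I_n, sg aEl s <> 0 ->
      #|[set s' | [&& mover s', (sg aEl s' == 0) || (sg aEl s <= sg aEl s') & clash s s']]| <= D].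

Lemma peel_correct rho sg t i : n * rho 0 + rho 1 = t -> rho 15 = i -> moves_in sg t ->
    i < n -> elimination sg i ->
  let sg' := sexec n rho sg peel in
  (forall a, a \notin [:: 13; 27] -> sg' a =1 sg a) /\ elimination sg' i.+1.
Proof.
move=> ht ri hm iN [el1 el2 el3 el4] sg'.
have fr a : a \notin [:: 13; 27] -> sg' a =1 sg a.
  move=> na; apply: sexec_frame; move: na; rewrite !inE !negb_or /=.
  by case/andP => /negbTE-> /negbTE->.
split=> //.
pose p z := holds n (update rho 2 z) sg tlowest.
have pE (s : 'I_n) : p s = alive sg s && [forall s' : 'I_n, alive sg s' ==> (degree sg s <= degree
  sg s')].
  rewrite /p /tlowest holds_and holds_not holds_count (@holds_alive _ _ t _ s) //.
  congr (_ && _); rewrite negb_exists; apply: eq_forallb => s'.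
  rewrite holds_and holds_lt (@holds_alive _ _ t _ s') //.
  rewrite (@teval_degree _ _ t 2 s) // (@teval_degree _ _ t 6 s') //.
  by case: (alive sg s') => //=; rewrite -leqNgt.
pose r := find p (iota 0 n).
have [rn rp _ rnone] := find_iotaP n p; rewrite -/r in rn rp rnone.
pose sg1 := store_set sg aPick 0 r.
have e1 : sexec n rho sg (set_scalar aPick (tfind 7 2 tlowest)) = sg1.
  by rewrite /sg1 /r /p -(@teval_find n rho sg 7 2 tlowest).
have e' : sg' = if r < n then store_set sg1 aEl r i.+1 else sg1.
  rewrite /sg' /peel seqE e1 swhenE holds_lt teval_scalar teval_size.
  by rewrite /= ri addn1.
case: (ltnP r n) e' => [lt|ge] e'; last first.
  have none s : ~~ alive sg s.
    apply/negP => a0.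
    pose w := [arg min_(w < s | alive sg w) degree sg w].
    have : p w.
      rewrite pE /w; case: arg_minnP => // w' -> h; apply/forallP => s'; apply/implyP.
      exact: h.
    apply/negP; apply: rnone => //; apply/eqP; by rewrite eqn_leq rn.
  have eE : sg' aEl =1 sg aEl by move=> s; rewrite e'.
  have eA : [set s | alive sg' s] = set0.
    by apply/setP => s; rewrite !inE /alive eE; exact/negbTE/none.
  split=> [s|s s'||D sp s].
  - by rewrite eE => /el1/andP[-> /leqW].
  - by rewrite !eE; exact: el2.
  - by rewrite eA cards0.
  - rewrite eE => h; apply: leq_trans (el4 D sp s h).
    by apply/subset_leq_card/subsetP => s'; rewrite !inE !eE.
pose q := Ordinal lt.
have /andP[aq /forallP min] : alive sg q && [forall s' : 'I_n, alive sg s' ==> (degree sg q <=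
  degree sg s')].
  by rewrite -pE; exact: rp.
have eE (s : 'I_n) : sg' aEl s = if s == q then i.+1 else sg aEl s.
  by rewrite e' /store_set /= -(val_eqE s q) /=; case: eqP.
have /andP[mq /eqP zq] := aq.
have elt (s : 'I_n) : sg aEl s <= i.
  by case: (eqVneq (sg aEl s) 0) => [->//|/eqP/el1/andP[]].
split=> [s|s s'||D sp s].
- by rewrite eE; case: eqP => [->|_ /el1/andP[-> /leqW]] //; rewrite mq ltnSn.
- rewrite !eE; case: eqP => [->|_]; case: eqP => [->|_] // h.
  + by move: (elt s'); rewrite -h ltnn.
  + by move: (elt s); rewrite h ltnn.
  + exact: el2.
- have : #|[set s | alive sg' s]| < #|[set s | alive sg s]|.
    apply: proper_card; apply/properP; split.
      apply/subsetP => s; rewrite !inE /alive eE; case: (eqVneq s q) => [->|//].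
      by rewrite andbF.
    by exists q; rewrite inE // /alive eE eqxx andbF.
  by move: el3; lia.
- rewrite eE; case: (eqVneq s q) => [->|nq] h.
    (* Sparsity of the set of tokens alive yields one with at most [D] conflicts, and [q] has no
       more than that one. *)
    have I0 : [set s | alive sg s] != set0 by apply/set0Pn; exists q; rewrite inE.
    have [|s0 s0I low] := sp _ I0; first by move=> s1; rewrite inE => /andP[].
    rewrite inE in s0I; have := min s0; rewrite s0I /= => le.
    apply: leq_trans low; apply: leq_trans (_ : degree sg q <= _).
      apply/subset_leq_card/subsetP => s'; rewrite !inE eE /alive; case: (eqVneq s' q) => [->|ns'].
        by rewrite mq zq eqxx => /and3P[_ _ ->].
      case/and3P => -> /orP[/eqP-> ->|]; first by rewrite eqxx.
      by move=> h1; move: (leq_trans h1 (elt s')); rewrite ltnn.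
    by apply: leq_trans le _; apply/subset_leq_card/subsetP => s'; rewrite !inE.
  apply: leq_trans (el4 D sp s h); apply/subset_leq_card/subsetP => s'; rewrite !inE eE.
  by case: (eqVneq s' q) => [->|//] /and3P[_ _ ->]; rewrite mq zq eqxx.
Qed.

End Coloring.

(* Every number below the first free one is taken by a different element. *)
Lemma find_free (T : finType) (A : {set T}) (c : T -> nat) n :
    #|A| < n -> (forall s, s \in A -> c s <> 0) ->
    let r := find (fun i => ~~ [exists s in A, c s == i.+1]) (iota 0 n) in
  r <= #|A| /\ forall s, s \in A -> c s <> r.+1.
Proof.
move=> An c0; set p := fun i => _; move=> r.
have [rn rp before _] := find_iotaP n p; rewrite -/r in rn rp before.
have le : r <= #|A|.
  have : {subset iota 1 r <= [seq c s | s in A]}.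
    move=> i; rewrite mem_iota => /andP[i0 ir].
    have : ~~ p i.-1 by apply: before; lia.
    rewrite /p negbK => /exists_inP[s sA /eqP cs]; apply/imageP; exists s => //.
    by rewrite cs prednK.
  by move/(uniq_leq_size (iota_uniq 1 r)); rewrite size_iota size_image.
split=> // s sA cs; have := rp (leq_ltn_trans le An).
by move/exists_inP; case; exists s => //; rewrite cs.
Qed.

Section Painting.
Variables (n : nat) (e : rel 'I_n) (x y : 'I_n -> 'I_n).
Implicit Types (sg : store) (rho : nat -> nat).
Notation clash := (clash e x y).
Notation moves_in := (moves_in e x y).

Definition later (el : 'I_n -> nat) s : {set 'I_n} := [set s' | (el s <= el s') && clash s s'].

(** Step [i] treats the token with elimination number [n - i], so after [i] steps the coloured
    tokens are those numbered above [n - i]; colour 0 means uncoloured. *)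
Definition painted (el : 'I_n -> nat) (sg : store) (i : nat) : Prop := [/\
  forall s : 'I_n, (sg aCo s != 0) = (n - i < el s),
  forall s : 'I_n, sg aCo s <= n,
  forall s s' : 'I_n, s != s' -> sg aCo s <> 0 -> clash s s' -> sg aCo s <> sg aCo s'
  & forall s : 'I_n, sg aCo s <= #|later el s|.+1].

Lemma paint_correct rho sg t i (el : 'I_n -> nat) : n * rho 0 + rho 1 = t -> rho 15 = i ->
    moves_in sg t -> i < n -> (forall s : 'I_n, sg aEl s = el s) ->
    (forall s s', el s = el s' -> el s <> 0 -> s = s') ->
    painted el sg i ->
  let sg' := sexec n rho sg paint in
  (forall a, a \notin [:: 14; 27] -> sg' a =1 sg a) /\ painted el sg' i.+1.
Proof.
move=> ht ri hm iN hel elI [p1 p2 p3 p4] sg'.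
have fr a : a \notin [:: 14; 27] -> sg' a =1 sg a.
  move=> na; apply: sexec_frame; move: na; rewrite !inE !negb_or /=.
  by case/andP => /negbTE-> /negbTE->.
split=> //.
pose p z := holds n (update rho 2 z) sg (teq (TArr aEl (TVar 2)) (TSub TSize (TVar 15))).
have pE (s : 'I_n) : p s = (el s == n - i).
  by rewrite /p holds_eq teval_arr teval_sub teval_size !teval_var /update /= hel ri.
pose r := find p (iota 0 n).
have [rn rp _ rnone] := find_iotaP n p; rewrite -/r in rn rp rnone.
pose sg1 := store_set sg aPick 0 r.
have e1 : sexec n rho sg (set_scalar aPick (tfind 7 2 (teq (TArr aEl (TVar 2)) (TSub TSize (TVar
  15))))) = sg1.
  by rewrite /sg1 /r /p -(@teval_find n rho sg 7 2).
have e' : sg' = if r < n then sexec n rho sg1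
    (SAsg aCo (tscalar aPick) (TAdd (tfind 7 14 tfree_color) (TCst 1))) else sg1.
  by rewrite /sg' /paint seqE e1 swhenE holds_lt teval_scalar teval_size.
have step m : m <> n - i -> (n - i < m) = (n - i.+1 < m) by move: iN; lia.
case: (ltnP r n) e' => [lt|ge] e'; last first.
  have eE : sg' aCo =1 sg aCo by move=> s; rewrite e'.
  have none (s : 'I_n) : el s <> n - i.
    move=> h; have : ~~ p s by apply: rnone => //; apply/eqP; rewrite eqn_leq rn.
    by rewrite pE h eqxx.
  split=> [s|s|s s'|s]; rewrite ?eE //; last exact: p3.
  by rewrite p1 step.
pose q := Ordinal lt.
have elq : el q = n - i by apply/eqP; rewrite -pE; exact: rp.
have q0 : sg aCo q = 0 by apply/eqP; rewrite -[_ == 0]negbK p1 elq ltnn.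
pose A := [set s : 'I_n | (sg aCo s != 0) && clash q s].
have qA : q \notin A by rewrite inE q0.
(* The token [q] is not coloured yet, so one of the [n] colours is free. *)
have An : #|A| < n.
  rewrite -[X in _ < X]card_ord -cardsT; apply: proper_card; apply/properP.
  by split; [exact: subsetT|exists q].
have A0 s : s \in A -> sg aCo s <> 0 by rewrite inE => /andP[/eqP].
have [] := find_free An A0; set c := find _ _ => cA cfree.
have ec : teval n rho sg1 (tfind 7 14 tfree_color) = c.
  rewrite (@teval_find n rho sg1 7 14) //; apply: eq_find => j.
  rewrite /tfree_color holds_not holds_count; congr (~~ _).
  have hm1 : moves_in sg1 t by exact: moves_in_frame hm.
  apply/existsP/exists_inP => [[s]|[s]].
    rewrite holds_and holds_eq (@holds_interferes n e x y _ _ t _ _ _ _ q s) //.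
    rewrite teval_arr teval_add !teval_var teval_cst addn1 => /andP[/eqP h1 h2].
    rewrite /update /= in h1.
    by exists s; [rewrite inE h2 andbT -[sg aCo s]/(sg1 aCo s) h1|rewrite -[sg aCo s]/(sg1 aCo s)
      h1].
  rewrite inE => /andP[_ h2] /eqP h1; exists s.
  rewrite holds_and holds_eq (@holds_interferes n e x y _ _ t _ _ _ _ q s) // h2 andbT.
  by rewrite teval_arr teval_add !teval_var teval_cst addn1 /update /= -h1.
have eE (s : 'I_n) : sg' aCo s = if s == q then c.+1 else sg aCo s.
  rewrite e' -[LHS]/(store_set sg1 aCo (sg1 aPick 0) (teval n rho sg1 (TAdd (tfind 7 14
    tfree_color) (TCst 1))) aCo s).
  by rewrite teval_add ec teval_cst addn1 /store_set /= -(val_eqE s q).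
have noclash (s : 'I_n) : sg aCo s <> 0 -> clash q s -> sg aCo s <> c.+1.
  by move=> h1 h2; apply: cfree; rewrite inE h2 andbT; apply/eqP.
split=> [s|s|s s'|s].
- rewrite eE; case: (eqVneq s q) => [->|nq]; first by rewrite elq /=; move: iN; lia.
  rewrite p1; apply: step => h; case/eqP: nq; apply: elI; rewrite h -elq //.
  by rewrite elq; move: iN; lia.
- by rewrite eE; case: eqP => // _; exact: leq_ltn_trans cA An.
- rewrite !eE => nss; case: (eqVneq s q) => [es|nq]; case: (eqVneq s' q) => [es'|nq'].
  + by rewrite es es' eqxx in nss.
  + rewrite es => _ cl h; have := noclash s' _ cl; rewrite -h; exact.
  + by rewrite es' clashC => h1 h2; apply: noclash.
  + exact: p3.
- rewrite eE; case: (eqVneq s q) => [->|//]; rewrite ltnS; apply: leq_trans cA _.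
  apply/subset_leq_card/subsetP => s'; rewrite !inE p1 elq => /andP[/ltnW-> ->].
  by [].
Qed.

Definition colored (sg : store) (co : 'I_n -> nat) (Q : nat) : Prop := [/\
  forall s : 'I_n, sg aCo s = co s,
  sg aQ 0 = Q,
  forall s, (co s != 0) = mover x y s,
  forall s s', s != s' -> co s <> 0 -> clash s s' -> co s <> co s'
  & [/\ forall s, co s <= Q, Q <= n, forall D, sparse e x y D -> Q <= D.+1
      & (forall s, ~~ mover x y s) -> Q = 0]].

Lemma coloring_correct rho sg t : n * rho 0 + rho 1 = t -> moves_in sg t ->
  let sg' := sexec n rho sg coloring in
  (forall a, a \notin [:: 13; 14; 27; 29] -> sg' a =1 sg a) /\
  exists co Q, colored sg' co Q.
Proof.
move=> ht hm sg'.
have fr a : a \notin [:: 13; 14; 27; 29] -> sg' a =1 sg a.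
  move=> na; apply: sexec_frame; move: na; rewrite !inE !negb_or /=.
  by case/and4P => /negbTE-> /negbTE-> /negbTE-> /negbTE->.
split=> //.
set sg1 := sexec n rho sg (loops [:: 2] (SAsg aEl (TVar 2) (TCst 0))).
set sg2 := sexec n rho sg1 (loops [:: 2] (SAsg aCo (TVar 2) (TCst 0))).
set sg3 := sexec n rho sg2 (SFor 15 peel).
set sg4 := sexec n rho sg3 (SFor 15 paint).
have e' : sg' = sexec n rho sg4 (set_scalar aQ (tfind 7 14 (tnot (tcount 6 (tlt (TVar 14) (TArr
  aCo (TVar 6))))))) by [].
have z1 (s : 'I_n) : sg2 aEl s = 0 by rewrite /sg2 sexec_frame // /sg1 vector_table.
have z2 (s : 'I_n) : sg2 aCo s = 0 by rewrite /sg2 vector_table.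
have fr2 a : a \notin [:: 13; 14; 27; 29] -> sg2 a =1 sg a.
  move=> na s; rewrite /sg2 /sg1 !sexec_frame //; move: na; rewrite !inE !negb_or /=.
    by case/and4P.
  by case/and4P.
have [fr3 el3] : (forall a, a \notin [:: 13; 27] -> sg3 a =1 sg2 a) /\ elimination e x y sg3 n.
  rewrite /sg3; apply: (for_inv (P := fun i sg0 => (forall a, a \notin [:: 13; 27] -> sg0 a =1 sg2
    a) /\ elimination e x y sg0 i)).
    split=> //; split=> [s|s s'||D _ s]; rewrite ?z1 //.
    by rewrite subn0 -[leqRHS]card_ord max_card.
  move=> i sg0 iN [h1 h2].
  have hm0 : moves_in sg0 t.
    by apply: moves_in_frame hm => s; rewrite h1 // fr2.
  have ht' : n * (update rho 15 i) 0 + (update rho 15 i) 1 = t by rewrite /update.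
  have [f0 p0] := peel_correct ht' (erefl _ : update rho 15 i 15 = i) hm0 iN h2.
  by split=> // a na s; rewrite f0 // h1.
pose el (s : 'I_n) := sg3 aEl s.
have [el1 el2 el4 el5] := el3.
have elI s s' : el s = el s' -> el s <> 0 -> s = s' by exact: el2.
have [fr4 p4] : (forall a, a \notin [:: 14; 27] -> sg4 a =1 sg3 a) /\ painted el sg4 n.
  rewrite /sg4; apply: (for_inv (P := fun i sg0 => (forall a, a \notin [:: 14; 27] -> sg0 a =1 sg3
    a) /\ painted el sg0 i)).
    have z3 (s : 'I_n) : sg3 aCo s = 0 by rewrite fr3.
    split=> //; split=> [s|s|s s'|s]; rewrite ?z3 //.
    rewrite subn0 eqxx; apply/esym/negbTE; rewrite -leqNgt.
    by case: (eqVneq (el s) 0) => [->//|/eqP/el1/andP[]].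
  move=> i sg0 iN [h1 h2].
  have hm0 : moves_in sg0 t.
    by apply: moves_in_frame hm => s; rewrite h1 // fr3 // fr2.
  have ht' : n * (update rho 15 i) 0 + (update rho 15 i) 1 = t by rewrite /update.
  have hel (s : 'I_n) : sg0 aEl s = el s by rewrite h1.
  have [f0 p0] := paint_correct ht' (erefl _ : update rho 15 i 15 = i) hm0 iN hel elI h2.
  by split=> // a na s; rewrite f0 // h1.
have [p1 p2 p3 p5] := p4.
pose co (s : 'I_n) := sg4 aCo s.
have elmv (s : 'I_n) : (0 < el s) = mover x y s.
  apply/idP/idP => [h|mv]; first by by case/andP: (el1 s (elimN eqP (lt0n_neq0 h))).
  move: el4; rewrite subnn leqn0 cards_eq0 => /eqP/setP/(_ s).
  by rewrite !inE /alive mv /= lt0n => ->.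
pose p i := [forall s, co s <= i].
pose Q := find p (iota 0 n).
have [Qn Qp _ Qnone] := find_iotaP n p; rewrite -/Q in Qn Qp Qnone.
have eQ : sg' = store_set sg4 aQ 0 Q.
  rewrite e' -[LHS]/(store_set sg4 aQ 0 (teval n rho sg4 (tfind 7 14 (tnot (tcount 6 (tlt (TVar
    14) (TArr aCo (TVar 6)))))))).
  congr store_set; rewrite teval_find //; apply: eq_find => i.
  rewrite holds_not holds_count negb_exists; apply: eq_forallb => s.
  by rewrite holds_lt teval_arr !teval_var /update /= -leqNgt.
have le D : (forall s, co s <= D) -> Q <= D.
  move=> h; case: (ltnP D n) => [Dn|nD]; last exact: leq_trans Qn nD.
  by apply: find_lt => //; apply/forallP.
exists co, Q; split=> //.
- by rewrite eQ /store_set /=.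
- by move=> s; rewrite /co p1 subnn elmv.
- split=> // [s|D sp|none].
  + move: Qn; rewrite leq_eqVlt => /orP[/eqP->|/Qp/forallP//]; exact: p2.
  + apply: le => s; case: (eqVneq (co s) 0) => [->//|c0].
    have es : el s <> 0 by apply/eqP; rewrite -lt0n -[_ < _]/(0 < el s) -(subnn n) -p1.
    apply: leq_trans (p5 s) _; rewrite ltnS; apply: leq_trans (el5 D sp s es).
    apply/subset_leq_card/subsetP => s'; rewrite !inE => /andP[h1 ->]; rewrite h1 orbT andbT.
    by rewrite -elmv andbT; apply: leq_trans h1; rewrite lt0n; apply/eqP.
  + apply/eqP; rewrite -leqn0; apply: le => s; rewrite leqn0; apply: contraT.
    by rewrite /co p1 subnn elmv (negbTE (none s)).
Qed.

End Painting.

(** * Colour classes as interference-free rounds *)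

Section Emit.
Variables (n : nat) (e : rel 'I_n).
Implicit Types (sg : store) (rho : nat -> nat) (As : seq {set 'I_n * 'I_n}).

Definition rows_in sg m As : Prop := forall i (v : 'I_n), i < size As ->
  (sg aTx (n * (m + i) + v) != 0) = (v \in sources (nth set0 As i)) /\
  (sg aRx (n * (m + i) + v) != 0) = (v \in targets (nth set0 As i)).

(** The rounds of all runs lie one after the other in the same arrays, and a later run must not
    disturb the best one recorded. *)
Definition same_rows sg sg' m : Prop := forall r (v : 'I_n), r < m ->
  sg' aTx (n * r + v) = sg aTx (n * r + v) /\ sg' aRx (n * r + v) = sg aRx (n * r + v).

Lemma rows_in_same sg sg' m M As : m + size As <= M -> same_rows sg sg' M ->
  rows_in sg m As -> rows_in sg' m As.
Proof.
move=> le same rows i v iA; have [h1 h2] := rows i v iA.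
have [|-> ->] // := same (m + i) v.
by apply: leq_trans le; rewrite ltn_add2l.
Qed.

Lemma rows_in_cat sg m As Bs : rows_in sg m As -> rows_in sg (m + size As) Bs ->
  rows_in sg m (As ++ Bs).
Proof.
move=> hA hB i v; rewrite size_cat nth_cat; case: (ltnP i (size As)) => iA lt; first exact: hA.
have := hB (i - size As) v; rewrite -addnA subnKC //; apply.
by rewrite ltn_subLR.
Qed.

Lemma write_rows_correct rho sg a (pos : term) (z co : 'I_n -> nat) m :
    ~~ reads a pos -> a != aM -> a != aCo -> sg aM 0 = m ->
    (forall s : 'I_n, sg aCo s = co s) ->
    (forall (s : 'I_n) rho', rho' 0 = rho 0 -> rho' 1 = rho 1 -> rho' 6 = s ->
       teval n rho' sg pos = z s) ->
  let sg' := sexec n rho sg (write_rows a pos) in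
  [/\ forall b, b != a -> sg' b =1 sg b,
      forall r (v : 'I_n), r < m -> sg' a (n * r + v) = sg a (n * r + v)
    & forall c (v : 'I_n), c < n -> (sg' a (n * (m + c) + v) != 0) =
        [exists s, (co s == c.+1) && (z s == v)]].
Proof.
move=> nr aM' aC em hco hpos sg'.
have ixE sg0 vals c v : sg0 aM 0 = m -> vals = [:: c; v] ->
    teval n (binds rho [:: 14; 3] vals) sg0 (tix2 (TAdd (tscalar aM) (TVar 14)) (TVar 3)) =
    n * (m + c) + v.
  by move=> e0 ->; rewrite teval_ix2 // teval_add teval_scalar !teval_var e0.
have n1 : ~~ reads a (tix2 (TAdd (tscalar aM) (TVar 14)) (TVar 3)).
  by rewrite /= !orbF.
have n2 : ~~ reads a (tcount 6 (tand (teq (TArr aCo (TVar 6)) (TAdd (TVar 14) (TCst 1))) (teq pos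
  (TVar 3)))).
  by rewrite /= (negbTE nr) (negbTE aC).
split=> [b nb|r v rm|c v cn].
- by apply: sexec_frame; rewrite /= (negbTE nb).
- apply: (table_asg_other (xs := [:: 14; 3])) => // vals /tuple_inP2[c [v' [cn vn ev]]].
  rewrite (ixE _ _ c v') // => h; have [h1 _] := row_index_inj vn (ltn_ord v) h.
  by move: rm; rewrite -h1 ltnNge leq_addr.
rewrite -(ixE sg [:: c; v : nat] c v) // /sg' /write_rows (table_asg (xs := [:: 14; 3])) //.
- rewrite -[_ != 0]/(holds _ _ _ _) holds_count; apply: eq_existsb => s.
  rewrite holds_and !holds_eq teval_arr teval_add !teval_var teval_cst addn1 (hpos s) //=.
  by rewrite /update /= hco.
- move=> vals vals' /tuple_inP2[c1 [v1 [cn1 vn1 ev1]]] /tuple_inP2[c2 [v2 [cn2 vn2 ev2]]].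
  rewrite (ixE _ _ c1 v1) // (ixE _ _ c2 v2) // ev1 ev2 => h.
  by have [/addnI-> ->] := row_index_inj vn1 vn2 h.
- by rewrite tuple_in2 cn ltn_ord.
Qed.

Lemma emit_correct rho sg t (x y : 'I_n -> 'I_n) m : n * rho 0 + rho 1 = t ->
    moves_in e x y sg t -> sg aM 0 = m -> (forall s, stay_or_move e (x s) (y s)) ->
  let sg' := sexec n rho sg emit in
  [/\ forall a, a \notin [:: 13; 14; 15; 16; 19; 27; 29] -> sg' a =1 sg a,
      same_rows sg sg' m
    & exists As, [/\ sg' aM 0 = m + size As, rows_in sg' m As,
        (forall A, A \in As -> conflict_free e A), (forall s, flow As (x s) (y s)) &
        [/\ size As <= n, forall D, sparse e x y D -> size As <= D.+1 &
          (forall s, x s = y s) -> size As = 0]]].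
Proof.
move=> ht hm em st sg'.
have [fr1 [co [Q]]] := coloring_correct ht hm; set sg1 := sexec n rho sg coloring in fr1 *.
case=> hco hQ conz proper [coQ Qn Qsp Q0].
pose sg2 := sexec n rho sg1 (write_rows aTx (tpos (TVar 6))).
pose sg3 := sexec n rho sg2 (write_rows aRx (tpos' (TVar 6))).
have hm1 : moves_in e x y sg1 t by apply: moves_in_frame hm => s; rewrite fr1.
have em1 : sg1 aM 0 = m by rewrite fr1.
have [||||||fr2 old2 new2] := @write_rows_correct rho sg1 aTx (tpos (TVar 6)) (fun s => x s) co m
  => //.
  move=> s rho' r0 r1 r6; apply: (@teval_pos _ _ _ _ _ _ t) => //; rewrite ?r0 ?r1; eauto.
rewrite -/sg2 in fr2 old2 new2.
have hm2 : moves_in e x y sg2 t by apply: moves_in_frame hm1 => s; rewrite fr2.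
have [||||||fr3 old3 new3] := @write_rows_correct rho sg2 aRx (tpos' (TVar 6)) (fun s => y s) co m
  => //.
- by rewrite fr2.
- by move=> s; rewrite fr2.
- move=> s rho' r0 r1 r6; apply: (@teval_pos' _ _ _ _ _ _ t) => //; rewrite ?r0 ?r1; eauto.
rewrite -/sg3 in fr3 old3 new3.
have e' : sg' = store_set sg3 aM 0 (m + Q).
  rewrite -[LHS]/(store_set sg3 aM 0 (sg3 aM 0 + sg3 aQ 0)).
  by rewrite !fr3 // !fr2 // hQ em1.
have fr a : a \notin [:: 13; 14; 15; 16; 19; 27; 29] -> sg' a =1 sg a.
  move=> na; apply: sexec_frame; move: na; rewrite !inE !negb_or /=.
  by case/and4P => /negbTE-> /negbTE-> /negbTE-> /and4P[/negbTE-> /negbTE-> /negbTE-> /negbTE->].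
(* Clashing tokens have different colours, so the moves of one colour class form a conflict-free
   set. *)
pose arcs c := [set (x s, y s) | s in [set s : 'I_n | co s == c.+1]].
pose As := [seq arcs c | c <- iota 0 Q].
have sA : size As = Q by rewrite size_map size_iota.
have nA i : i < Q -> nth set0 As i = arcs i by move=> iQ; rewrite (nth_map 0) ?size_iota //
  nth_iota.
have tx i v : i < n -> sg' aTx (n * (m + i) + v) = sg2 aTx (n * (m + i) + v).
  by move=> _; rewrite e' /store_set /= fr3.
split=> //.
  move=> r v rm; rewrite e' /store_set /=; split; first by rewrite fr3 // old2 // fr1.
  by rewrite old3 // fr2 // fr1.
have mvco s : co s <> 0 -> e (x s) (y s).
  move/eqP; rewrite conz => mv; have := st s; rewrite /stay_or_move.
  by rewrite (negbTE mv).
exists As; rewrite sA; split=> //.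
- by rewrite e' /store_set /=.
- move=> i v; rewrite sA => iQ; rewrite nA //.
  have iN : i < n by exact: leq_trans Qn.
  rewrite e' /store_set /=; split.
    rewrite fr3 // new2 //; apply/existsP/imsetP => [[s /andP[h1 /eqP h2]]|[a /imsetP[s]]].
      exists (x s, y s); last exact/esym/val_inj.
      by apply/imsetP; exists s; rewrite ?inE.
    by rewrite inE => h1 -> ->; exists s; rewrite h1 /=.
  rewrite new3 //; apply/existsP/imsetP => [[s /andP[h1 /eqP h2]]|[a /imsetP[s]]].
    exists (x s, y s); last exact/esym/val_inj.
    by apply/imsetP; exists s; rewrite ?inE.
  by rewrite inE => h1 -> ->; exists s; rewrite h1 /=.
- move=> A /mapP[c _ ->]; split=> [a /imsetP[s]|a b /imsetP[s]].
    by rewrite inE => /eqP h -> /=; apply: mvco; rewrite h.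
  rewrite inE => /eqP h -> /imsetP[s']; rewrite inE => /eqP h' -> /= ne.
  have nss : s != s' by apply: contra ne => /eqP->.
  apply/negP => ee; apply: (proper s s' nss); rewrite ?h ?h' //.
  by rewrite /clash /interferes ee.
- move=> s; case: (eqVneq (x s) (y s)) => [->|mv]; first exact: flow_refl.
  have c0 : co s != 0 by rewrite conz.
  have le : (co s).-1 < Q by have := coQ s; move: c0; case: (co s).
  apply: (@flow_step _ _ (arcs (co s).-1)); first by apply: map_f; rewrite mem_iota.
  by apply/imsetP; exists s; rewrite // inE prednK // lt0n.
- split=> // h; apply: Q0 => s; by rewrite /mover h eqxx.
Qed.

End Emit.

(** * Logarithmic loads and the halving of tokens *)

Section Phase.
Variables (n : nat) (e : rel 'I_n) (d : nat).
Hypotheses (esym : symmetric e) (eirr : irreflexive e) (deg : degenerate d e).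
Implicit Types (sg : store) (rho : nat -> nat) (As : seq {set 'I_n * 'I_n}).
Implicit Types (S F : {set 'I_n}) (X : nat -> 'I_n -> 'I_n) (W : nat -> 'I_n -> nat).

Lemma price_le_total k W t v : t <= k -> W t v <= total_price k W.
Proof.
move=> tk; rewrite /total_price (bigD1 (Ordinal (tk : t < k.+1))) //= (bigD1 v) //= -addnA.
exact: leq_addr.
Qed.

(** If [l] tokens leave or enter a node, its price is at least [2 ^ l]. Prices are at most [Z], so
    both loads are at most the logarithm of [Z], and [few_conflicts] applies. *)
Lemma routing_sparse k X W Z t : routing e k X W -> total_price k W <= Z -> t < k ->
  sparse e (X t) (X t.+1) (4 * d * trunc_log 2 Z).
Proof.
move=> rt tot tk I I0 mv.
have bound (A : {set 'I_n}) w : 2 ^ #|A| <= w -> w <= Z -> #|A| <= trunc_log 2 Z.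
  by move=> h1 h2; apply: trunc_log_max => //; exact: leq_trans h2.
apply: few_conflicts => // v.
  apply: leq_trans (bound _ _ (rt_out rt v tk) _); last first.
    by apply: leq_trans tot; apply: price_le_total; exact: ltnW.
  apply/subset_leq_card/subsetP => s; rewrite !inE => /andP[/mv m /eqP xv].
  by rewrite xv eqxx /= eq_sym -xv.
apply: leq_trans (bound _ _ (rt_in rt v tk) _); last first.
  by apply: leq_trans tot; apply: price_le_total.
apply/subset_leq_card/subsetP => s; rewrite !inE => /andP[/mv m /eqP xv].
by rewrite xv eqxx /= -xv.
Qed.

(** Counting tokens minus one absorbs the single unpaired token, so the halving can be iterated down
    to 0 without additive loss. *)
Lemma survivors_bound k S X W F : pairing e k S X W F -> #|F| <= 1 ->
  #|[set X k s | s in S]|.-1 <= (#|S|.-1)./2.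
Proof.
move=> [_ FS _ mg] F1.
have : #|[set X k s | s in S]| <= #|[set X k s | s in S :\: F]| + #|F|.
  rewrite -{1}(setID S F) (setIidPr FS) imsetU addnC.
  by apply: leq_trans (leq_card_setU _ _) _; rewrite leq_add2r leq_imset_card.
have : #|S| = #|S :\: F| + #|F| by rewrite -(cardsID F S) (setIidPr FS) addnC.
move: #|[set X k s | s in S]| #|[set X k s | s in S :\: F]| mg F1.
move: #|S| #|S :\: F| #|F|; lia.
Qed.

(** By [pr_merge] a nonempty set of paired tokens has at least two elements. So once a single token
    is left, all further phases emit no rounds, although the program runs [n] phases. *)
Lemma lone_token k S X W F t s : pairing e k S X W F -> #|S| <= 1 -> X t s = s.
Proof.
move=> [_ FS xid mg] S1; apply: xid.
have : #|S :\: F| == 0.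
  case: (posnP #|S :\: F|) => [//|pos].
  have : 0 < #|[set X k s | s in S :\: F]|.
    by case/card_gt0P: pos => r rF; apply/card_gt0P; exists (X k r); apply: imset_f.
  have : #|S :\: F| <= 1 by apply: leq_trans S1; apply: subset_leq_card; exact: subsetDl.
  by move: #|[set X k s | s in S :\: F]| #|S :\: F| mg {pos} => a b; lia.
rewrite cards_eq0 => /eqP/setP/(_ s); rewrite !inE => /negbT.
by rewrite negb_and negbK.
Qed.

Definition load_bound k : nat := 4 * d * trunc_log 2 (k.+1 * n * potential n).

Lemma emit_all_correct rho sg k X m : graph_in e sg -> sg aK 0 = k -> k < n * n ->
    positions sg k X -> (forall t s, t < k -> stay_or_move e (X t s) (X t.+1 s)) ->
    sg aM 0 = m ->
  let sg' := sexec n rho sg (SFor 0 (SFor 1 (swhen (tlt ttime (tscalar aK)) emit))) in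
  [/\ forall a, a \notin [:: 13; 14; 15; 16; 19; 27; 29] -> sg' a =1 sg a,
      same_rows n sg sg' m
    & exists As, [/\ sg' aM 0 = m + size As, rows_in sg' m As,
        (forall A, A \in As -> conflict_free e A), (forall s, flow As (X 0 s) (X k s)) &
        [/\ size As <= k * n,
            forall D, (forall t, t < k -> sparse e (X t) (X t.+1) D) -> size As <= k * D.+1 &
            (forall t s, X t s = s) -> size As = 0]]].
Proof.
move=> hE ek kn hX st em sg'.
pose Inv T sg1 := [/\ forall a, a \notin [:: 13; 14; 15; 16; 19; 27; 29] -> sg1 a =1 sg a,
      same_rows n sg sg1 m
    & exists As, [/\ sg1 aM 0 = m + size As, rows_in sg1 m As,
        (forall A, A \in As -> conflict_free e A), (forall s, flow As (X 0 s) (X (minn T k) s)) &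
        [/\ size As <= minn T k * n,
            forall D, (forall t, t < k -> sparse e (X t) (X t.+1) D) -> size As <= minn T k * D.+1 &
            (forall t s, X t s = s) -> size As = 0]]].
suff : Inv (n * n) sg' by rewrite /Inv (minn_idPr (ltnW kn)).
rewrite /sg'; apply: for2_inv => [|i j sg1 iN jN].
  split=> //; exists [::]; split=> //; first by rewrite addn0.
  by move=> s; rewrite min0n /= eqxx.
set T := n * i + j; set rho1 := update (update rho 0 i) 1 j.
case=> fr1 same1 [As [em1 rows1 cf1 fl1 [sz1 sp1 z1]]].
have hT : n * rho1 0 + rho1 1 = T by [].
have ek1 : sg1 aK 0 = k by rewrite fr1.
rewrite swhenE holds_lt teval_time hT teval_scalar ek1.
case: (ltnP T k) => [Tk|kT]; last first.
  rewrite /Inv (minn_idPr (leqW kT)); rewrite (minn_idPr kT) in fl1 sz1 sp1.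
  by split=> //; exists As.
have hm1 : moves_in e (X T) (X T.+1) sg1 T.
  split=> [u v|s]; first by rewrite fr1 // hE.
  by rewrite !fr1 // !hX // ltnW.
have [fr2 same2 [Bs [em2 rows2 cf2 fl2 [sz2 sp2 z2]]]] :=
  emit_correct hT hm1 em1 (fun s => st T s Tk).
set sg2 := sexec n rho1 sg1 emit in fr2 same2 em2 rows2 *.
rewrite (minn_idPl (ltnW Tk)) in fl1 sz1 sp1.
rewrite /Inv (minn_idPl Tk); split=> [a na b|r v rm|].
- by rewrite fr2 // fr1.
- have [h1 h2] := same1 r v rm; have [|-> ->] // := same2 r v.
  by apply: leq_trans rm _; exact: leq_addr.
exists (As ++ Bs); rewrite size_cat addnA; split=> //.
- by apply: rows_in_cat => //; apply: rows_in_same same2 rows1; exact: leqnn.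
- by move=> A; rewrite mem_cat => /orP[/cf1|/cf2].
- by move=> s; apply: flow_cat (fl1 s) (fl2 s).
- split=> [|D sp|idX].
  + by rewrite mulSn addnC leq_add.
  + by rewrite mulSn addnC leq_add ?sp1 ?sp2 //; exact: sp.
  + by rewrite z1 // z2 // => s; rewrite !idX.
Qed.

Lemma phase_correct rho sg k S m : graph_in e sg -> sg aK 0 = k -> k < n * n ->
    members sg aS S -> sg aM 0 = m ->
  let sg' := sexec n rho sg phase in
  [/\ forall a, a \in [:: 0; 1; 2; 17; 20; 21; 22] -> sg' a =1 sg a,
      same_rows n sg sg' m
    & exists As S', [/\ sg' aM 0 = m + size As, rows_in sg' m As,
        (forall A, A \in As -> conflict_free e A), members sg' aS S' &
        [/\ forall x, x \in S -> exists2 z, z \in S' & flow As x z, size As <= k * n &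
            feasible e k -> size As <= (1 < #|S|) * (k * (load_bound k).+1) /\
              #|S'|.-1 <= (#|S|.-1)./2]]].
Proof.
move=> hE ek kn hS em sg'.
have fr a : a \in [:: 0; 1; 2; 17; 20; 21; 22] -> sg' a =1 sg a.
  by move=> na; apply: sexec_frame; move: na; rewrite !inE; do 7![case: (eqVneq a _) => [->//|_]].
have [fr1 [X [W [F [pr hX tot]]]]] := pair_all_correct rho hE ek kn hS.
set sg1 := sexec n rho sg _ in fr1 hX.
have hE1 : graph_in e sg1 by move=> u v; rewrite fr1 // hE.
have ek1 : sg1 aK 0 = k by rewrite fr1.
have em1 : sg1 aM 0 = m by rewrite fr1.
have rt := pr_routing pr.
have [fr2 same2 [As [em2 rows2 cf2 fl2 [sz2 sp2 z2]]]] :=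
  emit_all_correct rho hE1 ek1 kn hX (rt_step rt) em1.
set sg2 := sexec n rho sg1 _ in fr2 same2 em2 rows2 *.
have e' : sg' = sexec n rho sg2 survivors by [].
have fr3 a : a \notin [:: 5; 18] -> sg' a =1 sg2 a.
  rewrite e' => na; apply: sexec_frame; move: na; rewrite !inE !negb_or /=.
  by case/andP => /negbTE-> /negbTE->.
split=> //.
  move=> r v rm; have [h1 h2] := same2 r v rm.
  by rewrite !fr3 // h1 h2 !fr1.
exists As, [set X k s | s in S]; split=> //.
- by rewrite fr3.
- apply: (rows_in_same (M := m + size As) (leqnn _) _ rows2) => r v _.
  by rewrite !fr3.
- move=> v; rewrite e' /survivors seqE vector_table // teval_arr teval_var {1}/update eqxx.
  rewrite vector_table // -[_ != 0]/(holds _ _ _ _) holds_count.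
  have ek2 : sg2 aK 0 = k by rewrite fr2.
  apply/existsP/imsetP => [[s]|[s sS ->]].
    rewrite holds_and holds_eq /holds !teval_arr teval_ix2 // teval_scalar !teval_var ek2.
    rewrite /update /= fr2 // fr1 // hS fr2 // hX // => /andP[h1 /eqP h2].
    by exists s => //; apply: val_inj.
  exists s; rewrite holds_and holds_eq /holds !teval_arr teval_ix2 // teval_scalar !teval_var ek2.
  by rewrite /update /= fr2 // fr1 // hS sS fr2 // hX // eqxx.
- split=> // [x xS|fs].
    by exists (X k x); [exact: imset_f|have := fl2 x; rewrite (rt_start rt)].
  have [F1 totle] := tot fs; split; last exact: survivors_bound pr F1.
  case: (ltnP 1 #|S|) => S1; last by rewrite z2 // => t s; apply: lone_token pr S1.
  rewrite mul1n; apply: sp2 => t tk; exact: routing_sparse rt totle tk.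
Qed.

End Phase.

(** * The length of a gathering *)

Section Gather.
Variables (n : nat) (e : rel 'I_n) (d : nat).
Hypotheses (esym : symmetric e) (eirr : irreflexive e) (deg : degenerate d e).
Implicit Types (sg : store) (rho : nat -> nat) (As : seq {set 'I_n * 'I_n}).
Implicit Types (S F : {set 'I_n}).

Definition gather_bound k : nat := k * (load_bound n d k).+1 * (trunc_log 2 n).+1.

Lemma gather_correct rho sg k m : graph_in e sg -> sg aK 0 = k -> k < n * n -> sg aM 0 = m ->
  let sg' := sexec n rho sg gather in
  [/\ forall a, a \in [:: 0; 1; 2; 17; 20; 21] -> sg' a =1 sg a,
      same_rows n sg sg' m
    & exists As S', [/\ sg' aM 0 = m + size As /\ sg' aRun 0 = m, rows_in sg' m As,
        (forall A, A \in As -> conflict_free e A), members sg' aS S' &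
        [/\ forall x, exists2 z, z \in S' & flow As x z, size As <= n * (k * n) &
            feasible e k -> size As <= gather_bound k /\ #|S'| <= 1]]].
Proof.
move=> hE ek kn em sg'.
have fr a : a \in [:: 0; 1; 2; 17; 20; 21] -> sg' a =1 sg a.
  by move=> na; apply: sexec_frame; move: na; rewrite !inE; do 6![case: (eqVneq a _) => [->//|_]].
pose L := trunc_log 2 n; pose K := k * (load_bound n d k).+1.
pose Inv i sg1 := [/\ forall a, a \in [:: 0; 1; 2; 17; 20; 21] -> sg1 a =1 sg a,
      same_rows n sg sg1 m
    & exists As S', [/\ sg1 aM 0 = m + size As /\ sg1 aRun 0 = m, rows_in sg1 m As,
        (forall A, A \in As -> conflict_free e A), members sg1 aS S' &
        [/\ forall x, exists2 z, z \in S' & flow As x z, size As <= i * (k * n) &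
            feasible e k -> size As <= K * minn i L.+1 /\ #|S'|.-1 <= n.-1 %/ 2 ^ i]]].
suff : Inv n sg'.
  case=> _ same [As [S' [h1 h2 h3 h4 [h5 h6 h7]]]]; split=> //; exists As, S'; split=> //.
  split=> // fs; have [c1 c2] := h7 fs; split.
    by apply: leq_trans c1 _; rewrite leq_mul2l geq_minr orbT.
  move: c2; rewrite divn_small; first by case: #|S'| => [|[]].
  by apply: leq_ltn_trans (leq_pred n) _; exact: ltn_expl.
rewrite /sg' /gather !seqE; set sg0 := sexec n rho _ (set_scalar _ _).
apply: for_inv => [|i sg1 iN].
  split=> [a na||].
  - move=> b; rewrite /sg0 sexec_frame ?sexec_frame //; move: na; rewrite !inE;
    by do 6![case: (eqVneq a _) => [->//|_]].
  - by move=> r v rm; rewrite /sg0 !sexec_frame.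
  exists [::], [set: 'I_n]; split=> //.
  - by split; [rewrite addn0 /sg0 !sexec_frame|rewrite /sg0 -em -[RHS](@sexec_frame n rho sg
    (loops [:: 3] (SAsg aS (TVar 3) (TCst 1))))].
  - by move=> s; rewrite inE /sg0 sexec_frame // vector_table.
  - split=> // [x|fs]; first by exists x; rewrite ?inE //=.
    by rewrite cardsT card_ord divn1.
case=> fr1 same1 [As [S [[em1 er1] rows1 cf1 hS [fl1 sz1 fs1]]]].
have hE1 : graph_in e sg1 by move=> u v; rewrite fr1 // hE.
have ek1 : sg1 aK 0 = k by rewrite fr1.
have [fr2 same2 [Bs [S' [em2 rows2 cf2 hS' [fl2 sz2 fs2]]]]] :=
  phase_correct esym eirr deg (update rho 12 i) hE1 ek1 kn hS em1.
set sg2 := sexec n _ sg1 phase in fr2 same2 em2 rows2 hS' *.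
split=> [a na b|r v rm|].
- rewrite fr2 ?fr1 //; move: na; rewrite !inE; by do 6![case: (a == _) => //].
- have [h1 h2] := same1 r v rm; have [|-> ->] // := same2 r v.
  by apply: leq_trans rm _; exact: leq_addr.
exists (As ++ Bs), S'; rewrite size_cat addnA; split=> //.
- by split=> //; rewrite fr2.
- by apply: rows_in_cat => //; apply: rows_in_same same2 rows1; exact: leqnn.
- by move=> A; rewrite mem_cat => /orP[/cf1|/cf2].
split=> [x||fs].
- have [z zS xz] := fl1 x; have [z' z'S zz'] := fl2 z zS.
  by exists z' => //; exact: flow_cat xz zz'.
- by rewrite mulSn addnC leq_add.
have [c1 c2] := fs1 fs; have [c3 c4] := fs2 fs.
split; last first.
  rewrite expnSr divnMA -divn2 in c4 *; apply: leq_trans c4 _.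
  exact: leq_div2r.
case: (ltnP 1 #|S|) c3 => S1 c3; last first.
  move: c3; rewrite mul0n leqn0 => /eqP->; rewrite addn0; apply: leq_trans c1 _.
  by rewrite leq_mul2l; apply/orP; right; rewrite leq_min geq_minr andbT (leq_trans (geq_minl _ _)).
(* As long as two tokens remain, [2 ^ i <= n]; so at most [L.+1] phases contribute rounds. *)
have iL : i <= L.
  apply: trunc_log_max => //; rewrite leqNgt; apply/negP => lt.
  by move: c2; rewrite divn_small; [case: #|S| S1 => [|[]]|apply: leq_ltn_trans (leq_pred n) lt].
rewrite mul1n in c3; rewrite (minn_idPl (_ : i.+1 <= L.+1)) // mulnSr.
apply: leq_add c3; apply: leq_trans c1 _.
by rewrite leq_mul2l geq_minl orbT.
Qed.

End Gather.

Lemma row_digits n N r : r < n * N -> exists a b, [/\ a < N, b < n & r = n * a + b].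
Proof.
move=> h; have n0 : 0 < n by case: (n) h.
exists (r %/ n), (r %% n); rewrite ltn_mod n0 ltn_divLR // mulnC h.
by split=> //; rewrite mulnC -divn_eq.
Qed.

(** * The best guess and the complete program *)

Section Main.
Variables (n : nat) (e : rel 'I_n) (d : nat).
Hypotheses (esym : symmetric e) (eirr : irreflexive e) (deg : degenerate d e).
Implicit Types (sg : store) (rho : nat -> nat) (As : seq {set 'I_n * 'I_n}).

Definition gathers As : Prop :=
  (forall A, A \in As -> conflict_free e A) /\ exists z, forall x, flow As x z.

(* [aBl] holds one more than the length of the best run, and 0 if there is none. *)
Definition recorded sg : Prop := sg aBl 0 = 0 \/ exists As, [/\ sg aBl 0 = (size As).+1,
  sg aBs 0 + size As <= sg aM 0, rows_in sg (sg aBs 0) As, gathers As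
  & size As <= n * ((n * n).-1 * n)].

Definition searched K sg : Prop := [/\ graph_in e sg, sg aK 0 = K, recorded sg
  & forall k, k < K -> feasible e k -> 0 < sg aBl 0 <= (gather_bound n d k).+1].

Lemma try_bound_correct rho sg k : 0 < n -> k < n * n -> searched k sg ->
  searched k.+1 (sexec n rho sg try_bound).
Proof.
move=> n0 kn [hE ek rec best].
have [fr1 same1 [As [S [[em1 er1] rows1 cf1 hS [fl1 sz1 fs1]]]]] :=
  gather_correct esym eirr deg rho hE ek kn (erefl (sg aM 0)).
set sg1 := sexec n rho sg gather in fr1 same1 em1 er1 rows1 hS.
pose sg2 := sexec n rho sg1 (swhen timprovement
    (set_scalar aBl (TAdd (TSub (tscalar aM) (tscalar aRun)) (TCst 1)) ;;
     set_scalar aBs (tscalar aRun))).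
have e' : sexec n rho sg try_bound = store_set sg2 aK 0 (sg2 aK 0 + 1) by [].
have S0 : 0 < #|S|.
  by have [z zS _] := fl1 (Ordinal n0); apply/card_gt0P; exists z.
have len1 : sg1 aM 0 - sg1 aRun 0 = size As by rewrite em1 er1 addKn.
have imp : holds n rho sg1 timprovement =
    (#|S| == 1) && ((sg aBl 0 == 0) || ((size As).+1 < sg aBl 0)).
  rewrite /timprovement holds_and holds_eq holds_or holds_not holds_lt teval_cst.
  rewrite /holds teval_add teval_sub !teval_scalar teval_cst len1 addn1 negbK !fr1 //.
  congr (_ && _); congr (_ == 1); rewrite teval_card; apply: eq_card => s.
  by rewrite inE -hS /holds teval_arr teval_var.
have eS : sg2 = if holds n rho sg1 timprovement then
    store_set (store_set sg1 aBl 0 (size As).+1) aBs 0 (sg aM 0) else sg1.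
  rewrite /sg2 swhenE; case: (holds _ _ _ _) => //.
  have -> : (size As).+1 = sg1 aM 0 - sg1 aRun 0 + 1 by rewrite len1 addn1.
  by rewrite -er1.
have fr2 a : a \notin [:: 20; 21] -> sg2 a =1 sg1 a.
  move=> na; apply: sexec_frame; move: na; rewrite !inE !negb_or /=.
  by case/andP => /negbTE-> /negbTE->.
have ek2 : sg2 aK 0 = k by rewrite fr2 // fr1.
have size_bound : size As <= n * ((n * n).-1 * n).
  by apply: leq_trans sz1 _; rewrite leq_mul2l leq_mul2r; apply/orP; right; apply/orP; right; lia.
rewrite e'; set sg' := store_set _ _ _ _.
have fr' a : a != 17 -> sg' a =1 sg2 a by move=> na b; rewrite /sg' /store_set (negbTE na).
split.
- by move=> u v; rewrite fr' // fr2 // fr1.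
- by rewrite /sg' /store_set /= ek2 addn1.
- rewrite /recorded !fr' // eS imp; case: ifP => [/andP[/eqP S1 _]|_].
    right; exists As; rewrite /store_set /= em1 //; split=> //.
      move=> i v iA; rewrite !fr' // eS imp S1 eqxx /=.
      have := rows1 i v iA; rewrite /store_set; case: ifP => _ //.
    split=> //; have /cards1P[z Sz] : #|S| == 1 by apply/eqP.
    by exists z => x; have [z'] := fl1 x; rewrite Sz inE => /eqP->.
  case: rec => [z|[Bs [h1 h2 h3 h4 h5]]]; [left|right]; first by rewrite fr1.
  exists Bs; rewrite (fr1 20) // (fr1 21) // em1; split=> //; first exact: leq_trans h2 (leq_addr
    _ _).
  apply: (rows_in_same (M := sg aM 0) _ _ h3) => // r v rm.
  rewrite !fr' // !fr2 //; exact: same1.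
move=> k' k'k fs; rewrite fr' // eS imp.
have old : k' < k -> 0 < (if (#|S| == 1) && ((sg 20 0 == 0) || ((size As).+1 < sg 20 0))
   then store_set (store_set sg1 20 0 (size As).+1) 21 0 (sg 19 0) else sg1) 20 0 <= (gather_bound
     n d k').+1.
  move=> lt; have /andP[b0 b1] := best k' lt fs.
  case: ifP => [/andP[_ /orP[/eqP z|lt']]|_]; last by rewrite fr1 // b0.
    by rewrite z in b0.
  by rewrite /store_set /=; apply: leq_trans (ltnW lt') b1.
move: k'k; rewrite ltnS leq_eqVlt => /orP[/eqP kk|]; last exact: old.
have [|sA S1] := fs1; first by rewrite -kk.
have -> : #|S| == 1 by rewrite eqn_leq S1.
rewrite /= kk; case: ifP => [_|/negbT]; first by rewrite /store_set /= ltnS.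
by rewrite negb_or -leqNgt fr1 // -lt0n => /andP[-> h]; apply: leq_trans h _.
Qed.

Lemma output_correct rho sg : 0 < n -> (sg aBl 0).-1 <= n * ((n * n).-1 * n) ->
  let len := (sg aBl 0).-1 in
  let sg' := sexec n rho sg output in
  sg' aLen 0 = len + len /\ forall r (v : 'I_n), r < len + len ->
    sg' aOut (n * r + v) = if r < len then sg aTx (n * (sg aBs 0 + r) + v)
      else sg aRx (n * (sg aBs 0 + (len + len - r.+1)) + v).
Proof.
move=> n0 lenb len sg'.
set sg1 := sexec n rho sg (set_scalar aLen (TAdd tlen tlen)).
have fr1 a : a != 1 -> sg1 a =1 sg a.
  by move=> na; apply: sexec_frame; rewrite /= (negbTE na).
have l1 : sg1 aLen 0 = len + len by rewrite /sg1 /= /store_set /= subn1.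
split; first by rewrite /sg' /output seqE -/sg1 sexec_frame.
move=> r v rl.
have rn : r < n * (n * (n * (n * n))).
  apply: leq_trans rl _; rewrite -/len in lenb; apply: leq_trans (leq_add lenb lenb) _.
  case: n n0 {v} => [//|[|N]] _; first by [].
  set N2 := N.+2; have : (N2 * N2).-1 * N2 <= N2 * N2 * N2 by rewrite leq_mul2r leq_pred orbT.
  move=> h; rewrite addnn -mul2n; apply: leq_trans (_ : N2 * (N2 * (N2 * (N2 * N2))) <= _) => //.
  rewrite mulnCA leq_mul2l; apply/orP; right.
  by rewrite leq_mul // mulnA.
have [r1 [d5 [r1n d5n rE]]] := row_digits rn.
have [r2 [d4 [r2n d4n r1E]]] := row_digits r1n.
have [r3 [d3 [r3n d3n r2E]]] := row_digits r2n.
have [d1 [d2 [d1n d2n r3E]]] := row_digits r3n.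
pose rnd a b c d' f := n * (n * (n * (n * a + b) + c) + d') + f.
have rndE sg0 vals a b c d' f w : vals = [:: a; b; c; d'; f; w] ->
    teval n (binds rho [:: 16; 17; 18; 19; 23; 3] vals) sg0 tround = rnd a b c d' f.
  move=> ->; rewrite /tround teval_add teval_row // teval_add teval_row // teval_add.
  by rewrite teval_row // teval_add teval_row.
have ixE sg0 vals a b c d' f w : vals = [:: a; b; c; d'; f; w] ->
    teval n (binds rho [:: 16; 17; 18; 19; 23; 3] vals) sg0 (tix2 tround (TVar 3)) =
    n * rnd a b c d' f + w.
  by move=> ev; rewrite teval_ix2 // (rndE _ _ _ _ _ _ _ _ ev) ev.
have rr : rnd d1 d2 d3 d4 d5 = r by rewrite /rnd -r3E -r2E -r1E -rE.
have tup vals : tuple_in n [:: 16; 17; 18; 19; 23; 3] vals -> exists a b c d' f w,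
    [/\ [/\ a < n, b < n, c < n, d' < n & f < n], w < n & vals = [:: a; b; c; d'; f; w]].
  case: vals => [|a [|b [|c [|d' [|f [|w [|]]]]]]] // /andP[_ /=].
  case/and5P => h1 h2 h3 h4 /and3P[h5 h6 _].
  by exists a, b, c, d', f, w.
have ev : [:: d1; d2; d3; d4; d5; v : nat] = [:: d1; d2; d3; d4; d5; v : nat] by [].
rewrite -{1}rr -(ixE sg1 _ _ _ _ _ _ _ ev) /sg' /output seqE -/sg1.
rewrite (table_asg (xs := [:: 16; 17; 18; 19; 23; 3])) //.
- rewrite teval_if holds_lt (rndE _ _ _ _ _ _ _ _ ev) rr.
  set rho' := binds _ _ _.
  have er : teval n rho' sg1 tround = r by rewrite (rndE _ _ _ _ _ _ _ _ ev) rr.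
  have el : teval n rho' sg1 tlen = len by rewrite teval_sub teval_scalar teval_cst fr1 // subn1.
  rewrite !teval_arr !teval_ix2 // (teval_add _ _ _ (tscalar aBs) tround).
  rewrite (teval_add _ _ _ (tscalar aBs) (TSub _ _)) teval_sub (teval_add _ _ _ tlen tlen).
  rewrite (teval_add _ _ _ tround (TCst 1)) er el teval_cst addn1 teval_scalar !fr1 //.
- move=> vals vals' /tup[a [b [c [d' [f [w [[h1 h2 h3 h4 h5] h6 evs]]]]]]].
  move=> /tup[a' [b' [c' [d'' [f' [w' [[k1 k2 k3 k4 k5] k6 evs']]]]]]].
  rewrite (ixE _ _ _ _ _ _ _ _ evs) (ixE _ _ _ _ _ _ _ _ evs') evs evs' => h.
  have [g1 ->] := row_index_inj h6 k6 h; have [g2 ->] := row_index_inj h5 k5 g1.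
  have [g3 ->] := row_index_inj h4 k4 g2; have [g4 ->] := row_index_inj h3 k3 g3.
  by have [-> ->] := row_index_inj h2 k2 g4.
- by rewrite /tuple_in /= d1n d2n d3n d4n d5n ltn_ord.
Qed.

Lemma program_correct rho sg : 0 < n -> graph_in e sg -> sg aK 0 = 0 -> sg aBl 0 = 0 ->
  let sg' := sexec n rho sg gossip_program in
  sg' aLen 0 <= 2 * (n * ((n * n).-1 * n)) /\
  forall k, k < n * n -> feasible e k -> exists As, [/\ gathers As,
    size As <= gather_bound n d k, sg' aLen 0 = size As + size As
    & forall r (v : 'I_n), r < size As + size As -> (sg' aOut (n * r + v) != 0) =
        (v \in nth set0 ([seq sources A | A <- As] ++ rev [seq targets A | A <- As]) r)].
Proof.
move=> n0 hE k0 b0 sg'.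
pose sg1 := sexec n rho sg (SFor 10 (SFor 11 try_bound)).
have [hE1 ek1 rec best] : searched (n * n) sg1.
  rewrite /sg1; apply: for2_inv => [|i j sg2 iN jN h]; first by split=> //; left.
  apply: try_bound_correct => //.
  by apply: leq_trans (_ : n * i.+1 <= _); [rewrite mulnSr ltn_add2l|rewrite leq_mul2l iN orbT].
have lenb : (sg1 aBl 0).-1 <= n * ((n * n).-1 * n) by case: rec => [->|[As [-> _ _ _ ?]]].
have [l1 out] := output_correct rho n0 lenb.
have e' : sg' = sexec n rho sg1 output by [].
rewrite e'; split; first by rewrite l1 mul2n -addnn leq_add.
move=> k kn fs; have /andP[bpos bk] := best k kn fs.
case: rec => [z|[As [bl _ rows gt _]]]; first by rewrite z in bpos.
have bl' : (sg1 aBl 0).-1 = size As by rewrite bl.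
rewrite bl ltnS in bk; rewrite bl' in l1 out; exists As; split=> //.
move=> r v rl; rewrite out // nth_cat size_map; case: ltnP => h.
  by have [-> _] := rows r v h; rewrite (nth_map set0).
have lt : r - size As < size As by rewrite ltn_subLR.
rewrite nth_rev size_map // (nth_map set0); last by rewrite ltn_subrL /= (leq_ltn_trans _ lt).
have -> : size As - (r - size As).+1 = size As + size As - r.+1 by lia.
by have [|_ ->] := rows (size As + size As - r.+1) v; first by lia.
Qed.

End Main.

(** The argument is at most [n ^ 3 * (8 n) ^ 4 = 2 ^ 12 * n ^ 7]. So its logarithm is below
    [12 + 7 (L + 1)], and [L >= 1] bounds this by [26 L]. *)
Lemma trunc_log_price n k : 1 < n -> k < n * n ->
  trunc_log 2 (k.+1 * n * potential n) <= 26 * trunc_log 2 n.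
Proof.
move=> n1 kn; set L := trunc_log 2 n.
have n0 : 0 < n by exact: ltnW.
have L1 : 0 < L by apply: trunc_log_max.
set N := _ * potential n; have N0 : 0 < N by rewrite (muln_gt0 (_ * _)) (muln_gt0 k.+1) n0
  potential_gt0.
have /andP[le _] := trunc_log_bounds (isT : 1 < 2) N0.
have up : N <= 2 ^ 12 * n ^ 7.
  apply: leq_trans (_ : n * n * n * ((8 * n) * (8 * n) * (8 * n) * (8 * n)) <= _); last first.
    rewrite !expnS expn0 !muln1; move: (n) => m; apply: eq_leq; ring.
  by apply: leq_mul; [rewrite leq_mul2r kn orbT|rewrite /potential !leq_mul //; lia].
have lt : n ^ 7 < 2 ^ (L.+1 * 7).
  by rewrite expnM ltn_exp2r // trunc_log_ltn.
have : 2 ^ trunc_log 2 N < 2 ^ (12 + L.+1 * 7).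
  by rewrite expnD; apply: leq_ltn_trans (leq_trans le up) _; rewrite ltn_pmul2l ?expn_gt0.
by rewrite ltn_exp2l //; lia.
Qed.

(** Origin of the constant: a time step takes at most [4 * d * 26 L + 1 <= (104 * d + 1) * L]
    rounds, at most [L + 1 <= 2 L] phases emit rounds, and spreading doubles the length. A
    disconnected graph may have no gossip schedule, so the time bound is stated for every graph and
    the rest under an optimum. *)
Theorem degenerate_radio_gossip (d : nat) : exists (P : program) (c D C : nat),
  forall (n : nat) (e : rel 'I_n), symmetric e -> irreflexive e -> degenerate d e ->
    exists t m, [/\ runs P (graph_memory e) t m, t <= c * n.+1 ^ D
      & forall OPT, is_optimal_length e OPT ->
          completes_gossip e (read_schedule n m) /\
          size (read_schedule n m) <= C * (OPT * trunc_log 2 n ^ 2)].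
Proof.
(* By [program_correct] the number of rounds is at most [2 * n.+1 ^ 4] in every case. *)
have [P [c [D mach]]] := machine 2 4 (isT : 6 < 32) gossip_program_scope.
exists P, c, D, (4 * (104 * d + 1)) => n e esym eirr deg.
have := mach n e eirr; set sg := sexec n _ _ _ => /=.
case: (posnP n) => [n0|n0].
  have l0 : sg 1 0 = 0.
    by rewrite /sg; move: (e); rewrite n0.
  rewrite l0 => /(_ isT)[t [m [h1 h2 h3 _]]]; exists t, m; split=> // OPT _.
  have -> : read_schedule n m = [::] by rewrite /read_schedule h3.
  by split=> // u; have := ltn_ord u; rewrite {2}n0.
have hE : graph_in e (input_store e) by move=> u v; rewrite mulnC; exact: adjacency_codeE.
have [len_le opt] := program_correct esym eirr deg (fun=> 0) n0 hE erefl erefl.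
rewrite -/sg in len_le opt.
case=> [|t [m [h1 h2 h3 h4]]].
  apply: leq_trans len_le _; rewrite leq_mul2l /= !expnS expn0 muln1.
  apply: leq_mul => //; rewrite mulnA; apply: leq_mul => //.
  by apply: leq_trans (leq_pred _) _; apply: leq_mul.
exists t, m; split=> // OPT hO; have := optimal_length_bound hO; rewrite card_ord => OPTn.
have ON : OPT < n * n by apply: leq_trans OPTn; rewrite -addn1 leq_add2l.
have [|As [[cf [z fl]] sz l1 out]] := opt OPT ON.
  by case: hO => [[s h5 h6] _]; exists s.
have sE : read_schedule n m = [seq sources A | A <- As] ++ rev [seq targets A | A <- As].
  apply: (@eq_from_nth _ finset.set0).
    by rewrite size_map size_iota size_cat size_rev !size_map h3 l1.
  move=> r; rewrite size_map size_iota h3 l1 => rl.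
  rewrite (nth_map 0) ?size_iota ?h3 ?l1 // nth_iota // add0n.
  apply/setP => v; rewrite inE -addnA h4 ?(mulnC r) ?out //.
  by rewrite l1; apply: leq_trans (_ : n * r.+1 <= _); [rewrite mulnSr ltn_add2l|rewrite leq_mul2l
    rl orbT].
split; first by rewrite sE; exact: gather_gossip fl.
rewrite size_map size_iota h3 l1 addnn -mul2n.
(* For a single node the logarithm vanishes, so the length has to be 0; indeed [OPT] is 0 then, and
   so is the bound on the run. *)
case: (ltnP 1 n) => n1; last first.
  have O0 : OPT = 0 by have n1' : n = 1 by [lia]; move: ON; rewrite n1'; lia.
  by rewrite O0 /gather_bound !mul0n leqn0 in sz *; rewrite (eqP sz).
set L := trunc_log 2 n in sz *.
have L1 : 0 < L by apply: trunc_log_max.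
have lb : (load_bound n d OPT).+1 <= (104 * d + 1) * L.
  have := trunc_log_price n1 ON; rewrite /load_bound -/L.
  move: (trunc_log 2 _) => x hx.
  have := leq_mul (leqnn (4 * d)) hx; rewrite mulnDl; lia.
apply: leq_trans (leq_mul (leqnn 2) sz) _; rewrite /gather_bound -/L.
apply: leq_trans (_ : 2 * (OPT * ((104 * d + 1) * L) * (2 * L)) <= _).
  by rewrite leq_mul2l /=; apply: leq_mul; [rewrite leq_mul2l lb orbT|lia].
by apply: eq_leq; rewrite expnS expn1; move: (104 * d + 1) => y; lia.
Qed.

(** * Planar graphs are degenerate *)

Import Order.TTheory GRing.Theory Num.Theory.

(** * Orientations and the parity of crossings *)

Section Chirotope.
Variables (T : eqType) (o : T -> T -> T -> bool).

(** Sign rules for the determinants of points in general position: antisymmetry, and the fact that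
    the terms of [abc - abd + acd - bcd = 0] and of the Grassmann-Pluecker relation
    [abc adf - abd acf + abf acd = 0] cannot all have the same sign. With abstract orientations,
    statements about crossings become finite boolean checks. *)
Definition chirotope : Prop :=
  [/\ forall a b c, uniq [:: a; b; c] ->
        o b a c = ~~ o a b c /\ o a c b = ~~ o a b c,
      forall a b c d, uniq [:: a; b; c; d] ->
        ~~ [&& o a b c == ~~ o a b d, o a b c == o a c d
             & o a b c == ~~ o b c d]
    & forall a b c d f, uniq [:: a; b; c; d; f] ->
        ~~ [&& (o a b c (+) o a d f) == ~~ (o a b d (+) o a c f)
             & (o a b c (+) o a d f) == (o a b f (+) o a c d)]].

Definition crossing (a b c d : T) : bool :=
  (o a b c (+) o a b d) && (o c d a (+) o c d b).

Fixpoint cross_path (a b c : T) (q : seq T) : bool :=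
  if q is d :: q' then crossing a b c d (+) cross_path a b d q' else false.

Fixpoint cross_paths (a : T) (p : seq T) (c : T) (q : seq T) : bool :=
  if p is b :: p' then cross_path a b c q (+) cross_paths b p' c q else false.

(** The [uniq] test makes degenerate triangles empty, so [triangle_crossing] also covers paths that
    visit a vertex twice. *)
Definition in_triangle (a b c d : T) : bool :=
  uniq [:: a; b; c] && (o a b d == o b c d) && (o b c d == o c a d).

Hypothesis chi : chirotope.

Let anti1 a b c : uniq [:: a; b; c] -> o b a c = ~~ o a b c.
Proof. by case: chi => h _ _ /h[]. Qed.
Let anti2 a b c : uniq [:: a; b; c] -> o a c b = ~~ o a b c.
Proof. by case: chi => h _ _ /h[]. Qed.
Let cyc1 a b c : uniq [:: a; b; c] -> o b c a = o a b c.
Proof.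
move=> u; have u' : uniq [:: b; a; c].
  by move: u; rewrite /= !inE !negb_or !andbT (eq_sym b a) => /andP[/andP[-> ->] ->].
by rewrite (anti2 u') (anti1 u) negbK.
Qed.
Let cyc2 a b c : uniq [:: a; b; c] -> o c a b = o a b c.
Proof.
move=> u; have u' : uniq [:: a; c; b].
  by move: u; rewrite /= !inE !negb_or !andbT (eq_sym c b) => /andP[/andP[-> ->] ->].
by rewrite (anti1 u') (anti2 u) negbK.
Qed.

Lemma crossing_sym a b c d : crossing a b c d = crossing c d a b.
Proof. by rewrite /crossing andbC. Qed.

Lemma crossing0l a c d : crossing a a c d = false.
Proof. by rewrite /crossing addbb andbF. Qed.

Lemma crossing0r a b c : crossing a b c c = false.
Proof. by rewrite /crossing addbb. Qed.

Lemma crossing_swap a b c d : uniq [:: a; c; d] -> uniq [:: b; c; d] ->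
  crossing b a c d = crossing a b c d.
Proof.
move=> ua ub; case: (eqVneq a b) => [->//|nab].
rewrite /crossing [_ (+) o c d a]addbC; congr andb.
move: ua ub; rewrite /= !inE !negb_or !andbT => /andP[/andP[n1 n2] n3] /andP[/andP[n4 n5] _].
rewrite (anti1 (a := a) (b := b) (c := c)) /= ?inE ?negb_or ?nab ?n1 ?n4 //.
rewrite (anti1 (a := a) (b := b) (c := d)) /= ?inE ?negb_or ?nab ?n2 ?n5 //.
by case: (o a b c); case: (o a b d).
Qed.

Let neqs (a b c d f : T) : uniq [:: a; b; c; d; f] ->
  [/\ [/\ a != b, a != c, a != d & a != f], [/\ b != c, b != d & b != f],
  c != d, c != f & d != f] /\
  [/\ [/\ b != a, c != a, d != a & f != a], [/\ c != b, d != b & f != b],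
  d != c, f != c & f != d].
Proof.
rewrite [b == a]eq_sym [c == a]eq_sym [d == a]eq_sym [f == a]eq_sym [c == b]eq_sym [d == b]eq_sym
  [f == b]eq_sym [d == c]eq_sym [f == c]eq_sym [f == d]eq_sym /= !inE !negb_or !andbT.
by move=> /andP[/and4P[-> -> -> ->] /andP[/and3P[-> -> ->] /andP[/andP[-> ->] ->]]].
Qed.

(** All rules on five points, with one three-term relation per base point, rewritten in terms of the
    ten increasing triples. A goal about five points is then decided by running through the [2 ^ 10]
    sign patterns. *)
Let constraints5 (a b c d f : T) : uniq [:: a; b; c; d; f] ->
  [&& ~~ [&& o a b c == ~~ o a b d, o a b c == o a c d & o a b c == ~~ o b c d],
      ~~ [&& o a b c == ~~ o a b f, o a b c == o a c f & o a b c == ~~ o b c f],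
      ~~ [&& o a b d == ~~ o a b f, o a b d == o a d f & o a b d == ~~ o b d f],
      ~~ [&& o a c d == ~~ o a c f, o a c d == o a d f & o a c d == ~~ o c d f],
      ~~ [&& o b c d == ~~ o b c f, o b c d == o b d f & o b c d == ~~ o c d f],
      ~~ [&& (o a b c (+) o a d f) == ~~ (o a b d (+) o a c f) & (o a b c (+) o a d f) == (o a b f
        (+) o a c d)],
      ~~ [&& (~~ o a b c (+) o b d f) == ~~ (~~ o a b d (+) o b c f) & (~~ o a b c (+) o b d f) ==
        (~~ o a b f (+) o b c d)],
      ~~ [&& (o a b c (+) o c d f) == ~~ (~~ o a c d (+) ~~ o b c f) & (o a b c (+) o c d f) ==
        (~~ o a c f (+) ~~ o b c d)],
      ~~ [&& (o a b d (+) ~~ o c d f) == ~~ (o a c d (+) ~~ o b d f) & (o a b d (+) ~~ o c d f) ==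
        (~~ o a d f (+) o b c d)]
    & ~~ [&& (o a b f (+) o c d f) == ~~ (o a c f (+) o b d f) & (o a b f (+) o c d f) == (o a d f
      (+) o b c f)]].
Proof.
move=> u; have [[[n1 n2 n3 n4] [n5 n6 n7] n8 n9 n10] [[m1 m2 m3 m4] [m5 m6 m7] m8 m9 m10]] := neqs
  u.
case: chi => _ h4 h5.
have U (x y z : T) : x != y -> x != z -> y != z -> uniq [:: x; y; z].
  by rewrite /= !inE !negb_or andbT => -> -> ->.
have U4 (x y z w : T) : x != y -> x != z -> x != w -> y != z -> y != w -> z != w -> uniq [:: x; y;
  z; w].
  by rewrite /= !inE !negb_or andbT => -> -> -> -> -> ->.
have U5 (x y z w v : T) : x != y -> x != z -> x != w -> x != v -> uniq [:: y; z; w; v] -> uniq [::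
  x; y; z; w; v].
  by move=> k1 k2 k3 k4 k5; rewrite cons_uniq k5 !inE !negb_or k1 k2 k3 k4.
rewrite h4 ?U4 //=.
rewrite h4 ?U4 //=.
rewrite h4 ?U4 //=.
rewrite h4 ?U4 //=.
rewrite h4 ?U4 //=.
have := h5 a b c d f.
rewrite U5 ?U4 // => /(_ isT).
move=> /= -> /=.
have := h5 b a c d f.
rewrite U5 ?U4 // => /(_ isT).
rewrite (anti1 (a := a) (b := b) (c := c)) ?U //.
rewrite (anti1 (a := a) (b := b) (c := d)) ?U //.
rewrite (anti1 (a := a) (b := b) (c := f)) ?U //.
move=> /= -> /=.
have := h5 c a b d f.
rewrite U5 ?U4 // => /(_ isT).
rewrite (cyc2 (a := a) (b := b) (c := c)) ?U //.
rewrite (anti1 (a := a) (b := c) (c := d)) ?U //.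
rewrite (anti1 (a := a) (b := c) (c := f)) ?U //.
rewrite (anti1 (a := b) (b := c) (c := d)) ?U //.
rewrite (anti1 (a := b) (b := c) (c := f)) ?U //.
move=> /= -> /=.
have := h5 d a b c f.
rewrite U5 ?U4 // => /(_ isT).
rewrite (cyc2 (a := a) (b := b) (c := d)) ?U //.
rewrite (cyc2 (a := a) (b := c) (c := d)) ?U //.
rewrite (anti1 (a := a) (b := d) (c := f)) ?U //.
rewrite (cyc2 (a := b) (b := c) (c := d)) ?U //.
rewrite (anti1 (a := b) (b := d) (c := f)) ?U //.
rewrite (anti1 (a := c) (b := d) (c := f)) ?U //.
move=> /= -> /=.
have := h5 f a b c d.
rewrite U5 ?U4 // => /(_ isT).
rewrite (cyc2 (a := a) (b := b) (c := f)) ?U //.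
rewrite (cyc2 (a := a) (b := c) (c := f)) ?U //.
rewrite (cyc2 (a := a) (b := d) (c := f)) ?U //.
rewrite (cyc2 (a := b) (b := c) (c := f)) ?U //.
rewrite (cyc2 (a := b) (b := d) (c := f)) ?U //.
rewrite (cyc2 (a := c) (b := d) (c := f)) ?U //.
Qed.

(* A segment leaves a triangle as often as it enters it. *)
Lemma triangle_crossing a b c d f : uniq [:: a; d; f] -> uniq [:: b; d; f] ->
    uniq [:: c; d; f] ->
  crossing a b d f (+) crossing b c d f (+) crossing c a d f =
  in_triangle a b c d (+) in_triangle a b c f.
Proof.
move=> ua ub uc; rewrite /in_triangle.
have [->|nab] := eqVneq a b.
  by rewrite /= inE eqxx crossing0l (crossing_swap (a := b)) //= addbb.
have [->|nbc] := eqVneq b c.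
  by rewrite /= !inE eqxx andbF crossing0l (crossing_swap (a := a)) //= addbF addbb.
have [->|nca] := eqVneq c a.
  by rewrite /= !inE eqxx orbT crossing0l (crossing_swap (a := a)) //= addbF addbb.
have u : uniq [:: a; b; c] by rewrite /= !inE negb_or nab eq_sym nca nbc.
rewrite u /=.
have u5 : uniq [:: a; b; c; d; f].
  move: u ua ub uc; rewrite /= !inE !negb_or !andbT.
  move=> /andP[/andP[-> ->] ->] /andP[/andP[-> ->] ->].
  by move=> /andP[/andP[-> ->] _] /andP[/andP[-> ->] _].
have U (x y z : T) : x != y -> x != z -> y != z -> uniq [:: x; y; z].
  by rewrite /= !inE !negb_or andbT => -> -> ->.
have [[[n1 n2 n3 n4] [n5 n6 n7] n8 n9 n10] [[m1 m2 m3 m4] [m5 m6 m7] m8 m9 m10]] := neqs u5.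
rewrite /crossing !(cyc1 (a := a) (b := d)) // !(cyc1 (a := b) (b := d)) //.
rewrite (cyc1 (a := c) (b := d)) //.
rewrite (anti1 (a := a) (b := c) (c := d)) ?U // (anti1 (a := a) (b := c) (c := f)) ?U //.
move: (constraints5 u5).
case: (o a b c); case: (o a b d); case: (o a b f); case: (o a c d); case: (o a c f);
case: (o a d f); case: (o b c d); case: (o b c f); case: (o b d f); case: (o c d f) => //.
Qed.

(** The straight-line case of [K_5], with its fifteen pairs of disjoint edges. *)
Lemma five_points_crossing (a b c d f : T) : uniq [:: a; b; c; d; f] ->
  crossing a b c d (+) crossing a b c f (+) crossing a b d f (+)
  crossing a c b d (+) crossing a c b f (+) crossing a c d f (+)
  crossing a d b c (+) crossing a d b f (+) crossing a d c f (+)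
  crossing a f b c (+) crossing a f b d (+) crossing a f c d (+)
  crossing b c d f (+) crossing b d c f (+) crossing b f c d.
Proof.
move=> u; have [[[n1 n2 n3 n4] [n5 n6 n7] n8 n9 n10] [[m1 m2 m3 m4] [m5 m6 m7] m8 m9 m10]] := neqs
  u.
have U (x y z : T) : x != y -> x != z -> y != z -> uniq [:: x; y; z].
  by rewrite /= !inE !negb_or andbT => -> -> ->.
move: (constraints5 u); rewrite /crossing.
rewrite (anti2 (a := a) (b := b) (c := c)) ?U //.
rewrite (anti2 (a := a) (b := b) (c := d)) ?U //.
rewrite (anti2 (a := a) (b := c) (c := d)) ?U //.
rewrite (anti2 (a := a) (b := b) (c := f)) ?U //.
rewrite (anti2 (a := a) (b := c) (c := f)) ?U //.
rewrite (anti2 (a := a) (b := d) (c := f)) ?U //.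
rewrite (cyc1 (a := a) (b := b) (c := c)) ?U //.
rewrite (cyc1 (a := a) (b := b) (c := d)) ?U //.
rewrite (anti2 (a := b) (b := c) (c := d)) ?U //.
rewrite (cyc1 (a := a) (b := b) (c := f)) ?U //.
rewrite (anti2 (a := b) (b := c) (c := f)) ?U //.
rewrite (anti2 (a := b) (b := d) (c := f)) ?U //.
rewrite (cyc1 (a := a) (b := c) (c := d)) ?U //.
rewrite (cyc1 (a := b) (b := c) (c := d)) ?U //.
rewrite (cyc1 (a := a) (b := c) (c := f)) ?U //.
rewrite (cyc1 (a := b) (b := c) (c := f)) ?U //.
rewrite (anti2 (a := c) (b := d) (c := f)) ?U //.
rewrite (cyc1 (a := a) (b := d) (c := f)) ?U //.
rewrite (cyc1 (a := b) (b := d) (c := f)) ?U //.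
rewrite (cyc1 (a := c) (b := d) (c := f)) ?U //.
case: (o a b c); case: (o a b d); case: (o a b f); case: (o a c d); case: (o a c f);
case: (o a d f); case: (o b c d); case: (o b c f); case: (o b d f); case: (o c d f) => //.
Qed.

Lemma crossing_swapl a b c d :
  {in [:: a; b], forall x, x \notin [:: c; d]} -> crossing b a c d = crossing a b c d.
Proof.
move=> dis; have [->|ncd] := eqVneq c d; first by rewrite !crossing0r.
apply: crossing_swap.
  by have := dis a; rewrite /= !inE eqxx negb_or ncd andbT => ->.
by have := dis b; rewrite /= !inE eqxx orbT negb_or ncd andbT => ->.
Qed.

Lemma crossing_swapr a b c d :
  {in [:: a; b], forall x, x \notin [:: c; d]} -> crossing a b d c = crossing a b c d.
Proof.
move=> dis; rewrite crossing_sym crossing_swapl 1?crossing_sym // => x xcd.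
by apply/negP => /dis; rewrite xcd.
Qed.

Lemma cross_path_cat a b c q q' :
  cross_path a b c (q ++ q') = cross_path a b c q (+) cross_path a b (last c q) q'.
Proof. by elim: q c => //= d q IH c; rewrite IH addbA. Qed.

Lemma cross_path_rev a b c q : {in [:: a; b], forall x, x \notin c :: q} ->
  cross_path a b (last c q) (rev (belast c q)) = cross_path a b c q.
Proof.
elim: q c => //= d q IH c dis.
rewrite rev_cons -cats1 cross_path_cat IH => [|x xab]; last first.
  by have := dis x xab; rewrite inE negb_or => /andP[].
have -> : last (last d q) (rev (belast d q)) = d.
  by case: q {IH dis} => //= e q; rewrite rev_cons last_rcons.
rewrite /= addbF addbC crossing_swapr // => x xab.
by have := dis x xab; rewrite !inE !negb_or => /and3P[-> ->].
Qed.

(** [triangle_crossing] telescopes over the segments of the path. *)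
Lemma cross_path_triangle a b c d q : {in [:: a; b; c], forall x, x \notin d :: q} ->
  cross_path a b d q (+) cross_path b c d q (+) cross_path c a d q =
  in_triangle a b c d (+) in_triangle a b c (last d q).
Proof.
elim: q d => [|f q IH] d dis /=; first by rewrite addbb.
have -> : in_triangle a b c d (+) in_triangle a b c (last f q) =
  (in_triangle a b c d (+) in_triangle a b c f) (+)
  (in_triangle a b c f (+) in_triangle a b c (last f q)).
  by rewrite addbA -(addbA (in_triangle a b c d)) addbb addbF.
rewrite -IH => [|x xab]; last by have := dis x xab; rewrite inE negb_or => /andP[].
have -> : in_triangle a b c d (+) in_triangle a b c f =
  crossing a b d f (+) crossing b c d f (+) crossing c a d f.
  have [->|ndf] := eqVneq d f; first by rewrite !crossing0r addbb.
  have U x : x \in [:: a; b; c] -> uniq [:: x; d; f].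
    by move/dis; rewrite /= !inE !negb_or ndf => /and3P[-> ->].
  by rewrite triangle_crossing //; apply: U; rewrite !inE eqxx ?orbT.
move: (crossing a b d f) (crossing b c d f) (crossing c a d f).
move: (cross_path a b f q) (cross_path b c f q) (cross_path c a f q).
by do 6!case.
Qed.

(* Coning from an end point: against a closed polygon, a path can be replaced by a segment. *)
Lemma cross_paths_closed a p c q : {in a :: p, forall x, x \notin c :: q} ->
  last c q = c -> cross_paths a p c q = cross_path a (last a p) c q.
Proof.
move=> dis closed.
(* The closed polygon starts and ends at the same point, so the two triangle tests cancel. *)
have tri x y z : x \in a :: p -> y \in a :: p -> z \in a :: p ->
  cross_path x y c q (+) cross_path y z c q (+) cross_path z x c q = false.
  move=> xp yp zp; rewrite cross_path_triangle ?closed ?addbb // => t.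
  by rewrite !inE => /or3P[] /eqP->; apply: dis.
have loop x : cross_path x x c q = false.
  by elim: q c {dis closed tri} => //= d q IH c; rewrite crossing0l IH.
have sym x y : x \in a :: p -> y \in a :: p -> cross_path x y c q = cross_path y x c q.
  by move=> xp yp; have := tri _ _ _ xp yp xp; rewrite loop addbF; do 2!case: cross_path.
elim: p a {dis} tri sym => [|b p IH] a tri sym /=; first by rewrite loop.
have bp x : x \in b :: p -> x \in a :: b :: p by move=> h; rewrite inE h orbT.
rewrite IH => [|x y z xp yp zp|x y xp yp]; last 2 first.
- by apply: tri; apply: bp.
- by apply: sym; apply: bp.
have lp : last b p \in a :: b :: p by rewrite inE mem_last orbT.
have := tri a b (last b p); rewrite lp !inE !eqxx orbT => /(_ isT isT isT).
rewrite (sym (last b p) a) // ?inE ?eqxx //.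
by do 3!case: cross_path.
Qed.

Lemma cross_paths_sym a p c q : cross_paths a p c q = cross_paths c q a p.
Proof.
elim: p a => [|b p IH] a /=.
  by elim: q c => //= d q IH c; rewrite -IH.
rewrite {}IH; elim: q c => //= d q IH c.
rewrite -{}IH crossing_sym.
move: (crossing _ _ _ _) (cross_path a b d q) (cross_path c d b p) (cross_paths d q b p).
by do 4!case.
Qed.

Lemma cross_paths_cat a p c q q' :
  cross_paths a p c (q ++ q') = cross_paths a p c q (+) cross_paths a p (last c q) q'.
Proof.
elim: p a => //= b p IH a; rewrite cross_path_cat IH.
by rewrite -!addbA; congr addb; rewrite addbCA.
Qed.

Lemma cross_paths_rev a p c q : {in a :: p, forall x, x \notin c :: q} ->
  cross_paths a p (last c q) (rev (belast c q)) = cross_paths a p c q.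
Proof.
elim: p a => //= b p IH a dis; rewrite IH => [|x xp]; last first.
  by apply: dis; rewrite inE xp orbT.
rewrite cross_path_rev // => x xab; apply: dis.
by move: xab; rewrite !inE => /orP[]->; rewrite ?orbT.
Qed.

(* The paths q1, q2, q3 form a closed polygon. *)
Lemma cross_paths_straighten a b p k l m q1 q2 q3 :
    last a p = b -> last k q1 = l -> last l q2 = m -> last k q3 = m ->
    {in a :: p, forall x, x \notin [:: k, l & q1 ++ q2 ++ q3]} ->
  cross_paths a p k q1 (+) cross_paths a p l q2 (+) cross_paths a p k q3 =
  cross_paths a [:: b] k q1 (+) cross_paths a [:: b] l q2 (+) cross_paths a [:: b] k q3.
Proof.
move=> lp l1 l2 l3 dis.
have lastin : b \in a :: p by rewrite -lp mem_last.
pose q := q1 ++ q2 ++ rev (belast k q3).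
have lq : last k q = k.
  rewrite !last_cat l1 l2 -l3; case: (q3) => //= e s.
  by rewrite rev_cons last_rcons.
have sub x : x \in k :: q -> x \in [:: k, l & q1 ++ q2 ++ q3].
  rewrite !inE !mem_cat mem_rev => /or4P[-> //|-> | ->|/mem_belast]; rewrite ?orbT //.
  by rewrite inE => /orP[->//|->]; rewrite !orbT.
have disq x : x \in a :: p -> x \notin k :: q.
  by move/dis; apply: contra; exact: sub.
have split r : {in a :: r, forall x, x \in a :: p} ->
    cross_paths a r k q1 (+) cross_paths a r l q2 (+) cross_paths a r k q3 =
    cross_paths a r k q.
  move=> rp; rewrite /q !cross_paths_cat l1 l2 -l3 cross_paths_rev ?addbA // => x /rp/dis.
  by apply: contra; rewrite !inE !mem_cat => /orP[]->; rewrite ?orbT.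
rewrite !split //; last first.
  by move=> x; rewrite !inE => /orP[/eqP->|/eqP->]; rewrite ?eqxx // -inE.
rewrite cross_paths_closed // lp cross_paths_closed //= => x.
by rewrite !inE => /orP[/eqP->|/eqP->]; apply: disq; rewrite ?inE ?eqxx.
Qed.

End Chirotope.

Section CompleteGraph.
Local Open Scope ring_scope.
Variables (T : eqType) (o : T -> T -> T -> bool).
Hypothesis chi : chirotope o.

(* Straightening the ten edges of a drawing of K_5 one by one does not change the parity of
  the number of crossings of independent edges. *)
Lemma K5_crossing (r : nat -> T) (p : nat -> nat -> seq T) :
    uniq [seq r i | i <- iota 0 5] ->
    (forall i j, (i < j < 5)%N -> last (r i) (p i j) = r j) ->
    (forall i j k l, (i < j < 5)%N -> (k < l < 5)%N -> uniq [:: i; j; k; l] ->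
       {in r i :: p i j, forall x, x \notin r k :: p k l}) ->
  exists i j k l, [/\ (i < j < 5)%N, (k < l < 5)%N, uniq [:: i; j; k; l]
    & cross_paths o (r i) (p i j) (r k) (p k l)].
Proof.
move=> ur lp dis.
(* The flag tells whether the edge has been straightened. *)
pose cv (b : bool) i j := if b then [:: r j] else p i j.
pose F (b : bool) i j (c : bool) k l := cross_paths o (r i) (cv b i j) (r k) (cv c k l).
have rp i j x : (i < j < 5)%N -> x \in [:: r i; r j] -> x \in r i :: p i j.
  by move=> ij; rewrite !inE => /orP[->//|/eqP->]; rewrite -(lp i j ij) -in_cons mem_last.
have disc b c i j k l : (i < j < 5)%N -> (k < l < 5)%N -> uniq [:: i; j; k; l] ->
    {in r i :: cv b i j, forall x, x \notin r k :: cv c k l}.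
  move=> ij kl u x xb; apply/negP => xc.
  have xp : x \in r i :: p i j by case: (b) xb => //; exact: rp.
  have xq : x \in r k :: p k l by case: (c) xc => //; exact: rp.
  by have := dis _ _ _ _ ij kl u x xp; rewrite xq.
have Fs b c i j k l : F c k l b i j = F b i j c k l by exact: cross_paths_sym.
have st b1 b2 b3 i j k l m : (i < j < 5)%N -> (k < l)%N && (l < m < 5)%N ->
    uniq [:: i; j; k; l; m] ->
    F false i j b1 k l + F false i j b2 l m + F false i j b3 k m =
    F true i j b1 k l + F true i j b2 l m + F true i j b3 k m.
  move=> ij klm u.
  have [kl lm km] : [/\ (k < l < 5)%N, (l < m < 5)%N & (k < m < 5)%N].
    case/and3P: klm => kl lm m5; split; apply/andP; split=> //.
      exact: ltn_trans lm m5.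
    exact: ltn_trans kl lm.
  have lc b i' j' : (i' < j' < 5)%N -> last (r i') (cv b i' j') = r j'.
    by move=> h; case: b => //; exact: lp.
  apply: (cross_paths_straighten chi (lp _ _ ij) (lc b1 _ _ kl) (lc b2 _ _ lm) (lc b3 _ _ km)).
  have [u1 u2 u3] : [/\ uniq [:: i; j; k; l], uniq [:: i; j; l; m] & uniq [:: i; j; k; m]].
    by move: u; rewrite /= !inE !negb_or =>
      /and5P[/and4P[-> -> -> ->] /and3P[-> -> ->] /andP[-> ->] -> _].
  move=> x xp.
  have := disc false b1 _ _ _ _ ij kl u1 x xp; have := disc false b2 _ _ _ _ ij lm u2 x xp.
  have := disc false b3 _ _ _ _ ij km u3 x xp; rewrite !inE !mem_cat !negb_or.
  by move=> /andP[-> ->] /andP[-> ->] /andP[_ ->].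
(* Edges are straightened in lexicographic order, each against the triangle of the other three
   vertices; a flag for a side of that triangle is [true] if the side has been treated already. *)
have h0 := st false false false 0 1 2 3 4 isT isT isT.
have h1 := st false false false 0 2 1 3 4 isT isT isT.
have h2 := st false false false 0 3 1 2 4 isT isT isT.
have h3 := st false false false 0 4 1 2 3 isT isT isT.
have h4 := st true false true 1 2 0 3 4 isT isT isT.
have h5 := st true false true 1 3 0 2 4 isT isT isT.
have h6 := st true false true 1 4 0 2 3 isT isT isT.
have h7 := st true true true 2 3 0 1 4 isT isT isT.
have h8 := st true true true 2 4 0 1 3 isT isT isT.
have h9 := st true true true 3 4 0 1 2 isT isT isT.
have straight : uniq [:: r 0; r 1; r 2; r 3; r 4] by [].
have := five_points_crossing chi straight.
have E i j k l : crossing o (r i) (r j) (r k) (r l) = F true i j true k l.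
  by rewrite /F /= !addbF.
rewrite !{}E.
move=> odd0; have odd1 : is_true (F true 0 1 true 2 3 + F true 0 1 true 2 4 + F true 0 1 true 3 4
  + F true 0 2 true 1 3 + F true 0 2 true 1 4 + F true 0 2 true 3 4 + F true 0 3 true 1 2 + F true
  0 3 true 1 4 + F true 0 3 true 2 4 + F true 0 4 true 1 2 + F true 0 4 true 1 3 + F true 0 4 true
  2 3 + F true 1 2 true 3 4 + F true 1 3 true 2 4 + F true 1 4 true 2 3) by exact: odd0.
have eqt : (F true 0 1 true 2 3 + F true 0 1 true 2 4 + F true 0 1 true 3 4 + F true 0 2 true 1 3
  + F true 0 2 true 1 4 + F true 0 2 true 3 4 + F true 0 3 true 1 2 + F true 0 3 true 1 4 + F true
  0 3 true 2 4 + F true 0 4 true 1 2 + F true 0 4 true 1 3 + F true 0 4 true 2 3 + F true 1 2 true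
  3 4 + F true 1 3 true 2 4 + F true 1 4 true 2 3) = (F false 0 1 false 2 3 + F false 0 1 false 2
  4 + F false 0 1 false 3 4 + F false 0 2 false 1 3 + F false 0 2 false 1 4 + F false 0 2 false 3
  4 + F false 0 3 false 1 2 + F false 0 3 false 1 4 + F false 0 3 false 2 4 + F false 0 4 false 1
  2 + F false 0 4 false 1 3 + F false 0 4 false 2 3 + F false 1 2 false 3 4 + F false 1 3 false 2
  4 + F false 1 4 false 2 3).
  have e0 (a b c : bool) : a = b -> c + a - b = c by move=> ->; rewrite addrK.
  (* The left sides of the ten equalities are subtracted and the right sides added. Each pair of
     disjoint edges passes through one state with a single straightened edge, and these states
     cancel. *)
  transitivity (F false 0 1 false 2 3 + F false 0 1 false 2 4 + F false 0 1 false 3 4 + F false 0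
    2 false 1 3 + F false 0 2 false 1 4 + F false 0 2 false 3 4 + F false 0 3 false 1 2 + F false
    0 3 false 1 4 + F false 0 3 false 2 4 + F false 0 4 false 1 2 + F false 0 4 false 1 3 + F
    false 0 4 false 2 3 + F false 1 2 false 3 4 + F false 1 3 false 2 4 + F false 1 4 false 2 3 - (
    (F false 0 1 false 2 3 + F false 0 1 false 3 4 + F false 0 1 false 2 4) + (F false 0 2 false 1
      3 + F false 0 2 false 3 4 + F false 0 2 false 1 4) + (F false 0 3 false 1 2 + F false 0 3
      false 2 4 + F false 0 3 false 1 4) + (F false 0 4 false 1 2 + F false 0 4 false 2 3 + F
      false 0 4 false 1 3) + (F true 0 3 false 1 2 + F false 1 2 false 3 4 + F true 0 4 false 1 2)
      + (F true 0 2 false 1 3 + F false 1 3 false 2 4 + F true 0 4 false 1 3) + (F true 0 2 false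
      1 4 + F false 1 4 false 2 3 + F true 0 3 false 1 4) + (F true 0 1 false 2 3 + F true 1 4
      false 2 3 + F true 0 4 false 2 3) + (F true 0 1 false 2 4 + F true 1 3 false 2 4 + F true 0
      3 false 2 4) + (F true 0 1 false 3 4 + F true 1 2 false 3 4 + F true 0 2 false 3 4)) + (
    (F true 0 1 false 2 3 + F true 0 1 false 3 4 + F true 0 1 false 2 4) + (F true 0 2 false 1 3 +
      F true 0 2 false 3 4 + F true 0 2 false 1 4) + (F true 0 3 false 1 2 + F true 0 3 false 2 4
      + F true 0 3 false 1 4) + (F true 0 4 false 1 2 + F true 0 4 false 2 3 + F true 0 4 false 1
      3) + (F true 0 3 true 1 2 + F true 1 2 false 3 4 + F true 0 4 true 1 2) + (F true 0 2 true 1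
      3 + F true 1 3 false 2 4 + F true 0 4 true 1 3) + (F true 0 2 true 1 4 + F true 1 4 false 2
      3 + F true 0 3 true 1 4) + (F true 0 1 true 2 3 + F true 1 4 true 2 3 + F true 0 4 true 2 3)
      + (F true 0 1 true 2 4 + F true 1 3 true 2 4 + F true 0 3 true 2 4) + (F true 0 1 true 3 4 +
      F true 1 2 true 3 4 + F true 0 2 true 3 4))).
    by ring.
  rewrite (Fs true false 0 3 1 2) (Fs true true 0 3 1 2) (Fs true false 0 4 1 2) (Fs true true 0 4
    1 2) in h4.
  rewrite (Fs true false 0 2 1 3) (Fs true true 0 2 1 3) (Fs true false 0 4 1 3) (Fs true true 0 4
    1 3) in h5.
  rewrite (Fs true false 0 2 1 4) (Fs true true 0 2 1 4) (Fs true false 0 3 1 4) (Fs true true 0 3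
    1 4) in h6.
  rewrite (Fs true false 0 1 2 3) (Fs true true 0 1 2 3) (Fs true false 1 4 2 3) (Fs true true 1 4
    2 3) (Fs true false 0 4 2 3) (Fs true true 0 4 2 3) in h7.
  rewrite (Fs true false 0 1 2 4) (Fs true true 0 1 2 4) (Fs true false 1 3 2 4) (Fs true true 1 3
    2 4) (Fs true false 0 3 2 4) (Fs true true 0 3 2 4) in h8.
  rewrite (Fs true false 0 1 3 4) (Fs true true 0 1 3 4) (Fs true false 1 2 3 4) (Fs true true 1 2
    3 4) (Fs true false 0 2 3 4) (Fs true true 0 2 3 4) in h9.
  by rewrite h0 h1 h2 h3 h4 h5 h6 h7 h8 h9 subrK.
move: odd1; rewrite {}eqt => odd_total.
pose quads : seq (nat * nat * nat * nat) := [:: (0, 1, 2, 3); (0, 1, 2, 4); (0, 1, 3, 4); (0, 2,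
  1, 3); (0, 2, 1, 4); (0, 2, 3, 4); (0, 3, 1, 2); (0, 3, 1, 4); (0, 3, 2, 4); (0, 4, 1, 2); (0,
  4, 1, 3); (0, 4, 2, 3); (1, 2, 3, 4); (1, 3, 2, 4); (1, 4, 2, 3)]%N.
have ok : all (fun t => let: (i, j, k, l) := t in
    [&& (i < j < 5)%N, (k < l < 5)%N & uniq [:: i; j; k; l]]) quads by [].
case: (boolP (has (fun t => let: (i, j, k, l) := t in F false i j false k l) quads)).
  by case/hasP=> -[[[i j] k] l] /(allP ok)/and3P[ij kl u] h; exists i, j, k, l.
move=> none; move: none odd_total; rewrite /= !negb_or andbT.
by do 14![case/andP=> /negbTE ->]; move/negbTE ->.
Qed.

End CompleteGraph.

(** * Points of the plane in general position *)

Section PlanePoints.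
Local Open Scope ring_scope.
Variable R : realFieldType.
Implicit Types a b c d f : R * R.

Definition det3 a b c : R :=
  (b.1 - a.1) * (c.2 - a.2) - (b.2 - a.2) * (c.1 - a.1).

Variables (I : finType) (z : I -> R * R).

Definition generic : Prop :=
  forall i j k, uniq [:: i; j; k] -> det3 (z i) (z j) (z k) != 0.

Definition orientation (i j k : I) : bool := 0 < det3 (z i) (z j) (z k).

Lemma generic_chirotope : generic -> chirotope orientation.
Proof.
move=> gen.
have sgM (x y : R) : x != 0 -> y != 0 -> (0 < x) (+) (0 < y) = (x * y < 0).
  move=> x0 y0; case: (ltrgt0P x) x0 => // hx _; case: (ltrgt0P y) y0 => // hy _ /=.
  - by apply/esym/negbTE; rewrite -leNgt; apply: mulr_ge0; exact: ltW.
  - by apply/esym; rewrite pmulr_rlt0.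
  - by apply/esym; rewrite nmulr_rlt0.
  - by apply/esym/negbTE; rewrite -leNgt; apply: mulr_le0; exact: ltW.
have sub := subseq_uniq.
split=> [a b c u|a b c d u|a b c d f u].
- have e1 : det3 (z b) (z a) (z c) = - det3 (z a) (z b) (z c) by rewrite /det3; ring.
  have e2 : det3 (z a) (z c) (z b) = - det3 (z a) (z b) (z c) by rewrite /det3; ring.
  have := gen _ _ _ u; rewrite /orientation e1 e2 oppr_gt0 => n0.
  by rewrite -leNgt le_eqVlt (negbTE n0).
- have [u1 u2 u3 u4] : [/\ uniq [:: a; b; c], uniq [:: a; b; d], uniq [:: a; c; d]
      & uniq [:: b; c; d]].
    by move: u; rewrite /= !inE !negb_or => /and4P[/and3P[-> -> ->] /andP[-> ->] -> _].
  have := gen _ _ _ u1; have := gen _ _ _ u2; have := gen _ _ _ u3; have := gen _ _ _ u4.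
  rewrite /orientation.
  have : det3 (z a) (z b) (z c) - det3 (z a) (z b) (z d) + det3 (z a) (z c) (z d)
         - det3 (z b) (z c) (z d) = 0 by rewrite /det3; ring.
  move: (det3 (z a) (z b) (z c)) (det3 (z a) (z b) (z d)) (det3 (z a) (z c) (z d))
    (det3 (z b) (z c) (z d)) => p q r s e s0 r0 q0 p0.
  case: (ltrgt0P p) p0 => // hp _; case: (ltrgt0P q) q0 => // hq _;
  case: (ltrgt0P r) r0 => // hr _; case: (ltrgt0P s) s0 => // hs _ //; lra.
- have [[u1 u2 u3] [u4 u5 u6]] : [/\ uniq [:: a; b; c], uniq [:: a; d; f] & uniq [:: a; b; d]]
      /\ [/\ uniq [:: a; c; f], uniq [:: a; b; f] & uniq [:: a; c; d]].
    by move: u; rewrite /= !inE !negb_or =>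
      /and5P[/and4P[-> -> -> ->] /and3P[-> -> ->] /andP[-> ->] -> _].
  rewrite /orientation !sgM ?gen //.
  have : det3 (z a) (z b) (z c) * det3 (z a) (z d) (z f)
      - det3 (z a) (z b) (z d) * det3 (z a) (z c) (z f)
      + det3 (z a) (z b) (z f) * det3 (z a) (z c) (z d) = 0 by rewrite /det3; ring.
  have := mulf_neq0 (gen _ _ _ u1) (gen _ _ _ u2).
  have := mulf_neq0 (gen _ _ _ u3) (gen _ _ _ u4).
  have := mulf_neq0 (gen _ _ _ u5) (gen _ _ _ u6).
  move: (_ * _) (_ * det3 (z a) (z c) (z f)) (_ * det3 (z a) (z d) (z f)) => p q r p0 q0 r0.
  case: (ltrgt0P p) p0 => // hp _; case: (ltrgt0P q) q0 => // hq _;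
  case: (ltrgt0P r) r0 => // hr _ //; lra.
Qed.

Lemma crossing_point i j k l : uniq [:: i; j; k; l] -> generic ->
    crossing orientation i j k l ->
  exists s t : R, [/\ 0 <= s <= 1, 0 <= t <= 1,
    (z i).1 + s * ((z j).1 - (z i).1) = (z k).1 + t * ((z l).1 - (z k).1)
  & (z i).2 + s * ((z j).2 - (z i).2) = (z k).2 + t * ((z l).2 - (z k).2)].
Proof.
move=> u gen.
have [u1 u2 u3 u4] : [/\ uniq [:: i; j; k], uniq [:: i; j; l], uniq [:: k; l; i]
    & uniq [:: k; l; j]].
  move: u; rewrite /= !inE !negb_or => /and4P[/and3P[-> A B] /andP[C D] E _].
  by rewrite A B C D E !(eq_sym _ i) !(eq_sym _ j) A B C D.
have opp (x y : R) : x != 0 -> y != 0 -> (0 < x) (+) (0 < y) ->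
    x - y != 0 /\ 0 <= x / (x - y) <= 1.
  move=> x0 y0; case: (ltrgt0P x) x0 => // hx _; case: (ltrgt0P y) y0 => // hy _ //= _.
    have h : 0 < x - y by lra.
    by rewrite (gt_eqF h) ler_pdivrMr // mul1r divr_ge0 /=; lra.
  have h : x - y < 0 by lra.
  rewrite (lt_eqF h); split=> //.
  have -> : x / (x - y) = - x / (y - x) by rewrite -(opprB x y) invrN mulrNN.
  have h' : 0 < y - x by lra.
  by rewrite ler_pdivrMr // mul1r divr_ge0 /=; lra.
rewrite /crossing /orientation => /andP[].
move=> /opp[] //; [exact: gen|exact: gen|move=> n1 ht].
move=> /opp[] //; [exact: gen|exact: gen|move=> n2 hs].
(* The affine function [det3 (z k) (z l)] changes sign along the first segment and [s] is the
   parameter of its zero; likewise [t] on the second segment. *)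
exists (det3 (z k) (z l) (z i) / (det3 (z k) (z l) (z i) - det3 (z k) (z l) (z j))).
exists (det3 (z i) (z j) (z k) / (det3 (z i) (z j) (z k) - det3 (z i) (z j) (z l))).
have e : det3 (z k) (z l) (z i) - det3 (z k) (z l) (z j) =
   - (det3 (z i) (z j) (z k) - det3 (z i) (z j) (z l)) by rewrite /det3; ring.
split=> //; rewrite e; move: n1; rewrite /det3.
all: by move=> n1; field.
Qed.

(** In each coordinate a common point would be within [e] of the first end points of both
    segments. *)
Lemma far_not_crossing i j k l (e : R) : uniq [:: i; j; k; l] -> generic ->
    `|(z i).1 - (z j).1| <= e -> `|(z i).2 - (z j).2| <= e ->
    `|(z k).1 - (z l).1| <= e -> `|(z k).2 - (z l).2| <= e ->
    (2 * e < `|(z i).1 - (z k).1|) || (2 * e < `|(z i).2 - (z k).2|) ->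
  crossing orientation i j k l = false.
Proof.
move=> u gen d1 d2 d3 d4 far; apply/negP => /(crossing_point u gen)[s [t [hs ht e1 e2]]].
have bound (x y a b : R) : x + s * (y - x) = a + t * (b - a) -> `|x - y| <= e ->
    `|a - b| <= e -> ~~ (2 * e < `|x - a|).
  move=> eq h1 h2; rewrite -leNgt.
  have -> : x - a = s * (x - y) + t * (b - a) by lra.
  apply: le_trans (ler_normD _ _) _; rewrite !normrM.
  have [s0 s1] := andP hs; have [t0 t1] := andP ht.
  rewrite (ger0_norm s0) (ger0_norm t0) (distrC b).
  have := ler_wpM2r (normr_ge0 (x - y)) s1; have := ler_wpM2r (normr_ge0 (a - b)) t1.
  lra.
by case/orP: far; apply/negP; apply: bound; eassumption.
Qed.

End PlanePoints.

Section Perturbation.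
Local Open Scope ring_scope.

(* Moving the i-th point by t (i, i^2) makes every determinant a polynomial in t whose
  leading coefficient is a Vandermonde determinant. *)
Lemma generic_perturbation (R : realFieldType) (I : finType) (z : I -> R * R) (e : R) :
  0 < e -> exists z' : I -> R * R, generic z' /\
    forall i, `|(z' i).1 - (z i).1| <= e /\ `|(z' i).2 - (z i).2| <= e.
Proof.
move=> e0.
pose x (i : I) : R := (enum_rank i : nat)%:R.
have xinj i j : i != j -> x j - x i != 0.
  move=> ij; rewrite subr_eq0 eqr_nat; apply: contra ij => /eqP h.
  by apply/eqP/enum_rank_inj/val_inj.
pose w (t : R) (i : I) : R * R := ((z i).1 + t * x i, (z i).2 + t * x i ^+ 2).
pose c0 (i j k : I) := det3 (z i) (z j) (z k).
pose c1 (i j k : I) := ((z j).1 - (z i).1) * (x k ^+ 2 - x i ^+ 2)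
  + (x j - x i) * ((z k).2 - (z i).2)
  - ((z j).2 - (z i).2) * (x k - x i) - (x j ^+ 2 - x i ^+ 2) * ((z k).1 - (z i).1).
pose c2 (i j k : I) := (x j - x i) * (x k - x i) * (x k - x j).
pose q (i j k : I) : {poly R} := (c0 i j k)%:P + c1 i j k *: 'X + c2 i j k *: 'X^2.
have qE t i j k : (q i j k).[t] = det3 (w t i) (w t j) (w t k).
  by rewrite /q /c0 /c1 /c2 /det3 !hornerE /=; ring.
have q0 i j k : uniq [:: i; j; k] -> q i j k != 0.
  move=> u; apply/eqP => /(congr1 (fun p : {poly R} => p`_2)).
  rewrite coef0 /q !coefD coefC !coefZ coefX coefXn /= mulr0 mulr1 !add0r /c2 => /eqP.
  move: u; rewrite /= !inE !negb_or => /andP[/andP[ij ik] /andP[jk _]].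
  by rewrite !mulf_eq0 (negbTE (xinj _ _ ij)) (negbTE (xinj _ _ ik)) (negbTE (xinj _ _ jk)).
pose p := \prod_(u : I * I * I | uniq [:: u.1.1; u.1.2; u.2]) q u.1.1 u.1.2 u.2.
have p0 : p != 0 by apply/prodf_neq0 => u /q0.
pose M : R := (#|I| ^ 2).+1%:R.
have M0 : 0 < M by rewrite ltr0n.
have xM i : x i <= M /\ x i ^+ 2 <= M.
  have h : (enum_rank i <= #|I|)%N by rewrite ltnW.
  rewrite /x /M -natrX !ler_nat; split; last by rewrite leqW // leq_exp2r.
  apply: leq_trans h _; apply: leqW; case: #|I| => // m; exact: leq_pmulr.
(* A sequence of distinct admissible step sizes: a nonzero [p] cannot vanish at the first [size p]
   of them. *)
pose tau (m : nat) := e / (M * m.+1%:R).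
have [m pm] : exists m, p.[tau m] != 0.
  case: (boolP (all (root p) [seq tau m | m <- iota 0 (size p)])); last first.
    by case/allPn => t /mapP[m _ ->]; exists m.
  move=> allr; have /(max_poly_roots p0 allr) : uniq [seq tau m | m <- iota 0 (size p)].
    rewrite map_inj_uniq ?iota_uniq // => m1 m2 /(mulfI (lt0r_neq0 e0))/invr_inj.
    by move/(mulfI (lt0r_neq0 M0))/eqP; rewrite eqr_nat eqSS => /eqP.
  by rewrite size_map size_iota ltnn.
have t0 : 0 < tau m by rewrite divr_gt0 // mulr_gt0 // ltr0n.
have tM : tau m * M <= e.
  rewrite /tau invfM mulrA mulrAC -(mulrA e) mulVf ?gt_eqF // mulr1.
  by rewrite ler_pdivrMr ?ltr0n // ler_peMr ?(ltW e0) // ler1n.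
exists (w (tau m)); split=> [i j k u|i].
  move: pm; rewrite horner_prod => /prodf_neq0 /(_ (i, j, k) u) /=.
  by rewrite qE.
have small (y : R) : 0 <= y -> y <= M -> `|tau m * y| <= e.
  move=> y0 yM; rewrite ger0_norm; last by apply: mulr_ge0 => //; exact: ltW.
  by apply: (le_trans _ tM); rewrite (ler_pM2l t0).
have [h1 h2] := xM i.
have cancel (a b : R) : a + b - a = b by ring.
have x0 : 0 <= x i by exact: ler0n.
by split; rewrite /w /= cancel; apply: small => //; exact: exprn_ge0.
Qed.

End Perturbation.

From mathcomp Require Import all_classical all_reals all_analysis.
Import Order.TTheory GRing.Theory Num.Theory.
Import numFieldNormedType.Exports.

(** * Curves over the unit interval and compactness *)

Section Curves.
Local Open Scope classical_set_scope.
Local Open Scope ring_scope.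
Variable R : realType.

(** Compactness of the unit interval in the form used below: as smaller thresholds work too,
    thresholds that work near each point can be replaced by a uniform one. *)
Lemma segment_uniform (Q : R -> R -> Prop) :
    (forall d d' s, 0 < d' -> d' <= d -> Q d s -> Q d' s) ->
    (forall s, 0 <= s <= 1 -> exists2 d, 0 < d &
      forall s', 0 <= s' <= 1 -> `|s - s'| < d -> Q d s') ->
  exists2 d, 0 < d & forall s, 0 <= s <= 1 -> Q d s.
Proof.
move=> anti loc.
have := @segment_compact R 0 1; rewrite compact_near_coveringP.
move=> /(_ R (0^'+) (fun d s => 0 <= s <= 1 -> Q d s)) cov.
have : \forall d \near 0^'+, `[0, 1] `<=` (fun s : R => 0 <= s <= 1 -> Q d s).
  apply: cov => s /=; rewrite in_itv /= => s01.
  have [d d0 hd] := loc s s01.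
  exists (ball s d, [set d' | 0 < d' < d]); first split=> /=.
  - exact: nbhsx_ballx.
  - near=> x => /=; apply/andP; split; near: x; [exact: nbhs_right_gt|exact: nbhs_right_lt].
  - move=> [s' d'] /= [bs /andP[d'0 d'd]] s'01.
    by apply: (anti d) => //; [exact: ltW|exact: hd].
move=> h.
have [d [hd d0]] : exists d, (`[0, 1] `<=` (fun s : R => 0 <= s <= 1 -> Q d s)) /\ 0 < d.
  near (0 : R)^'+ => d; exists d; split; first by near: d.
  by near: d; exact: nbhs_right_gt.
by exists d => // s s01; apply: hd => //=; rewrite in_itv.
Unshelve. all: by end_near.
Qed.

Definition near_point (e : R) (p q : R * R) : Prop :=
  `|p.1 - q.1| < e /\ `|p.2 - q.2| < e.

Definition curve (g : R -> R * R) : Prop :=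
  forall s, 0 <= s <= 1 -> forall e, 0 < e -> exists2 d, 0 < d &
    forall s', 0 <= s' <= 1 -> `|s - s'| < d -> near_point e (g s) (g s').

Lemma continuous_curve (g : R -> R * R) :
  {within `[0, 1], continuous g} -> curve g.
Proof.
move=> /subspace_continuousP cg s s01 e e0.
have /cg/cvg_ballP/(_ e e0) : (`[0, 1]%classic : set R) s by rewrite /= in_itv.
rewrite near_withinE => /nbhs_ballP[d /= d0 hd].
exists d => // s' s'01 ss'.
have [] := hd s' ss' _; first by rewrite /= in_itv.
by [].
Qed.

Lemma curve_uniform g e : curve g -> 0 < e -> exists2 d, 0 < d &
  forall s s', 0 <= s <= 1 -> 0 <= s' <= 1 -> `|s - s'| < d -> near_point e (g s) (g s').
Proof.
move=> cg e0.
have [||d d0 hd] := segment_uniform (Q := fun d s => forall s', 0 <= s' <= 1 ->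
    `|s - s'| < d -> near_point e (g s) (g s')).
- move=> d d' s d'0 le h s' s'01 lt; apply: h => //; exact: lt_le_trans lt le.
- move=> s s01; have [d d0 hd] := cg s s01 (e / 2) ltac:(lra).
  exists (d / 2); first lra.
  move=> s1 s101 h1 s2 s201 h2.
  have [a1 a2] := hd s1 s101 ltac:(lra).
  have hs : `|s - s2| < d by have := ler_distD s1 s s2; lra.
  have [b1 b2] := hd s2 s201 hs.
  split.
    have := ler_distD (g s).1 (g s1).1 (g s2).1; rewrite (distrC (g s1).1 (g s).1); lra.
  have := ler_distD (g s).2 (g s1).2 (g s2).2; rewrite (distrC (g s1).2 (g s).2); lra.
by exists d => // s s' s01 s'01; apply: hd.
Qed.

(** Two uses of [segment_uniform]: one for the distance of a fixed point from a curve, one for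
    letting that point run through [g]. *)
Lemma curves_apart g h : curve g -> curve h ->
    (forall s t, 0 <= s <= 1 -> 0 <= t <= 1 -> g s <> h t) ->
  exists2 d, 0 < d &
    forall s t, 0 <= s <= 1 -> 0 <= t <= 1 -> ~ near_point d (g s) (h t).
Proof.
move=> cg ch ne.
have anti d d' p q : d' <= d -> near_point d' p q -> near_point d p q.
  by move=> le [a b]; split; apply: lt_le_trans le.
have shift d p q r : near_point (d / 2) p q -> near_point (d / 2) q r -> near_point d p r.
  move=> [a b] [a' b']; split.
    have := ler_distD q.1 p.1 r.1; lra.
  have := ler_distD q.2 p.2 r.2; lra.
have sym d p q : near_point d p q -> near_point d q p.
  by rewrite /near_point !(distrC q.1) !(distrC q.2).
have point p (k : R -> R * R) : curve k -> (forall t, 0 <= t <= 1 -> p <> k t) ->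
    exists2 d, 0 < d & forall t, 0 <= t <= 1 -> ~ near_point d p (k t).
  move=> ck nep.
  apply: (segment_uniform (Q := fun d t => ~ near_point d p (k t))).
    by move=> d d' s d'0 le nd /(anti _ _ _ _ le).
  move=> t t01.
  have [e e0 he] : exists2 e, 0 < e & ~ near_point e p (k t).
    have [e1|e1] := eqVneq p.1 (k t).1; last first.
      by exists `|p.1 - (k t).1|; [rewrite normr_gt0 subr_eq0|case; rewrite ltxx].
    have [e2|e2] := eqVneq p.2 (k t).2; last first.
      by exists `|p.2 - (k t).2|; [rewrite normr_gt0 subr_eq0|case; rewrite ltxx].
    by case: (nep t t01); apply/eqP; rewrite -pair_eqE /= /pair_eq /= e1 e2 !eqxx.
  have [d d0 hd] := ck t t01 (e / 2) ltac:(lra).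
  exists (Num.min d (e / 2)); first by rewrite lt_min d0; lra.
  move=> t' t'01; rewrite lt_min => /andP[h1 _] np; apply: he.
  apply: (shift _ _ (k t')); last by apply: sym; exact: hd.
  by apply: anti np; rewrite ge_min lexx orbT.
have [||d d0 hd] := segment_uniform (Q := fun d s => forall t, 0 <= t <= 1 ->
    ~ near_point d (g s) (h t)).
- by move=> d d' s d'0 le nd t t01 /(anti _ _ _ _ le); exact: nd.
- move=> s s01; have [e e0 he] := point (g s) h ch (fun t => ne s t s01).
  have [d d0 hd] := cg s s01 (e / 2) ltac:(lra).
  exists (Num.min d (e / 2)); first by rewrite lt_min d0; lra.
  move=> s' s'01; rewrite lt_min => /andP[h1 _] t t01 np; apply: (he t t01).
  apply: (shift _ _ (g s')); first exact: hd.
  by apply: anti np; rewrite ge_min lexx orbT.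
by exists d => // s t s01; apply: hd.
Qed.

End Curves.

Lemma finite_threshold (R : realFieldType) (T : finType) (P : T -> R -> Prop) :
    (forall x d d', (0 < d')%R -> (d' <= d)%R -> P x d -> P x d') ->
    (forall x, exists2 d, (0 < d)%R & P x d) ->
  exists2 d, (0 < d)%R & forall x, P x d.
Proof.
move=> anti ex.
have [d d0 hd] : exists2 d, (0 < d)%R & forall x, x \in enum T -> P x d.
  elim: (enum T) => [|x s [d d0 hd]]; first by exists 1%R.
  have [d' d'0 hd'] := ex x.
  exists (Num.min d d'); first by rewrite lt_min d0.
  have m0 : (0 < Num.min d d')%R by rewrite lt_min d0.
  move=> y; rewrite inE => /orP[/eqP->|/hd ys].
    by apply: anti hd' => //; rewrite ge_min lexx orbT.
  by apply: anti ys => //; rewrite ge_min lexx.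
by exists d => // x; apply: hd; rewrite mem_enum.
Qed.

(** * Polygonal approximation of a drawing *)

Section FarPaths.
Local Open Scope ring_scope.
Variables (R : realType) (I : finType) (z : I -> R * R) (d : R).
Hypothesis gen : generic z.

Let close i j := (`|(z i).1 - (z j).1| <= d) && (`|(z i).2 - (z j).2| <= d).
Let far i j := (2 * d < `|(z i).1 - (z j).1|) || (2 * d < `|(z i).2 - (z j).2|).

Lemma cross_paths_far a p c q : path close a p -> path close c q ->
    {in a :: p & c :: q, forall x y, far x y && (x != y)} ->
  cross_paths (orientation z) a p c q = false.
Proof.
elim: p a => //= b p IH a /andP[ab pb] qc hf.
rewrite IH //; last by move=> x y xp yq; apply: hf => //; rewrite inE xp orbT.
rewrite addbF {IH}.
elim: q c qc hf => //= f q IHq c /andP[cf qf] hf.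
rewrite IHq //; last by move=> x y xp yq; apply: hf => //; rewrite inE yq orbT.
rewrite addbF.
have [->|nab] := eqVneq a b; first by rewrite crossing0l.
have [->|ncf] := eqVneq c f; first by rewrite crossing0r.
have [/andP[d1 d2] /andP[d3 d4]] := (ab, cf).
have [] := (hf a c, hf a f); have [] := (hf b c, hf b f).
rewrite !inE !eqxx !orbT.
move=> /(_ isT isT)/andP[_ n1] /(_ isT isT)/andP[_ n2].
move=> /(_ isT isT)/andP[h n3] /(_ isT isT)/andP[_ n4].
apply: (far_not_crossing (e := d)) => //.
by rewrite /= !inE !negb_or nab n1 n2 n3 n4 ncf.
Qed.

End FarPaths.

Section PlanarK5.
Local Open Scope ring_scope.
Variables (R : realType) (V : finType) (e : rel V).
Variables (pt : V -> R * R) (arc : V -> V -> R -> R * R).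
Hypothesis draw : plane_drawing e pt arc.

Let piece := (V + V * V)%type.

(** Vertices count as constant curves, and so do non-edges. Thus all pieces form a finite type of
    continuous curves, and thresholds can be taken over all of them at once. *)
Let crv (a : piece) : R -> R * R :=
  match a with
  | inl u => fun=> pt u
  | inr (u, v) => if e u v then arc u v else fun=> pt u
  end.

Let supp (a : piece) : seq V :=
  match a with inl u => [:: u] | inr (u, v) => [:: u; v] end.

Let curve_cst (p : R * R) : curve (fun=> p).
Proof. by move=> s _ d d0; exists 1 => // s' _ _; rewrite /near_point !subrr normr0. Qed.

Let curve_crv a : curve (crv a).
Proof.
case: a => [u|[u v]] /=; first exact: curve_cst.
case: ifP => [uv|_]; last exact: curve_cst.
exact/continuous_curve/(arc_continuous draw).
Qed.

Let crv_cases a s : 0 <= s <= 1 -> (exists2 w, w \in supp a & crv a s = pt w) \/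
  exists u v, [/\ a = inr (u, v), e u v, 0 < s < 1 & crv a s = arc u v s].
Proof.
move=> s01; case: a => [u|[u v]] /=; first by left; exists u; rewrite ?inE.
case: ifP => uv; last by left; exists u; rewrite // inE eqxx.
have [->|s0] := eqVneq s 0; first by left; exists u; rewrite ?inE ?eqxx // (arc_source draw).
have [->|s1] := eqVneq s 1.
  by left; exists v; rewrite ?inE ?eqxx ?orbT // (arc_target draw).
by right; exists u, v; split=> //; case/andP: s01 => a b; rewrite !lt_neqAle a b s1 eq_sym s0.
Qed.

Let crv_disjoint a b s t : {in supp a, forall x, x \notin supp b} ->
  0 <= s <= 1 -> 0 <= t <= 1 -> crv a s <> crv b t.
Proof.
move=> dis s01 t01.
case: (crv_cases a s01) => [[w wa ->]|[u [v [ea uv si ->]]]];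
case: (crv_cases b t01) => [[w' wb ->]|[u' [v' [eb uv' ti ->]]]].
- by move=> /(pt_inj draw) ww; have := dis w wa; rewrite ww wb.
- by move=> h; apply: (arc_avoids_pt draw (w := w) uv' (x := t)); rewrite ?in_itv.
- by apply: (arc_avoids_pt draw (w := w') uv (x := s)); rewrite in_itv.
- apply: (arc_disjoint draw uv uv'); rewrite ?in_itv // => /setP/(_ u).
  have : u \notin supp b by apply: dis; rewrite ea inE eqxx.
  by rewrite eb !inE eqxx /= => /negbTE->.
Qed.

Lemma drawing_no_K5 (B : nat -> {set V}) (r : nat -> V) (p : nat -> nat -> seq V) :
    (forall i, (i < 5)%N -> r i \in B i) ->
    (forall i j, (i < j < 5)%N -> [disjoint B i & B j]) ->
    (forall i j, (i < j < 5)%N -> [/\ path e (r i) (p i j), last (r i) (p i j) = r j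
       & {subset p i j <= B i :|: B j}%SET]) ->
  False.
Proof.
move=> rB Bdis pP.
have Bdis' i j : (i < 5)%N -> (j < 5)%N -> i != j -> [disjoint B i & B j].
  move=> i5 j5; rewrite neq_ltn => /orP[ij|ji]; first by apply: Bdis; rewrite ij.
  by rewrite disjoint_sym; apply: Bdis; rewrite ji.
(* [d] separates pieces without common end points. Consecutive samples of a piece are within
   [d / 16] and are moved by at most [d / 16], so polygon edges have size at most [3 d / 16].
   Samples of separated pieces stay more than twice that apart, since otherwise the originals would
   be within [3 d / 8 + 2 d / 16 = d / 2]. *)
have [d d0 hd] : exists2 d, 0 < d & forall ab : piece * piece,
    {in supp ab.1, forall x, x \notin supp ab.2} ->
    forall s t, 0 <= s <= 1 -> 0 <= t <= 1 -> ~ near_point d (crv ab.1 s) (crv ab.2 t).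
  apply: finite_threshold => [ab d d' d'0 dd' h dis s t s01 t01 [n1 n2]|[a b]].
    by apply: (h dis s t) => //; split; apply: lt_le_trans dd'.
  case: (boolP (all (fun x => x \notin supp b) (supp a))) => [/allP dis|nd].
    have [d d0 hd] := curves_apart (curve_crv a) (curve_crv b) (fun s t => crv_disjoint dis).
    by exists d => // _.
  by exists 1 => // dis; case/negP: nd; apply/allP.
have [h h0 hh] : exists2 h, 0 < h & forall a s s', 0 <= s <= 1 -> 0 <= s' <= 1 ->
    `|s - s'| < h -> near_point (d / 16) (crv a s) (crv a s').
  apply: finite_threshold => [a h h' h'0 le H s s' s01 s'01 lt|a].
    by apply: H => //; apply: lt_le_trans le.
  by apply: curve_uniform; [exact: curve_crv|lra].
have [N hN] : exists N : nat, N.+1%:R^-1 < h.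
  exists (Num.truncn h^-1); rewrite invf_plt ?posrE ?ltr0n //.
  exact: truncnS_gt.
(* Polygon vertices are indexed by piece and sample number rather than by position: the end of an
   arc and its node coincide in the plane, and the perturbation makes them distinct points in
   general position. *)
pose I : finType := (piece * 'I_N.+2)%type.
pose par (k : 'I_N.+2) : R := k%:R / N.+1%:R.
have par01 k : 0 <= par k <= 1.
  rewrite /par divr_ge0 ?ler0n //= ler_pdivrMr ?ltr0n // mul1r ler_nat.
  by rewrite -ltnS.
pose z (i : I) := crv i.1 (par i.2).
have [z' [gen hz]] := generic_perturbation z (ltac:(lra) : 0 < d / 16).
pose close (i j : I) := (`|(z' i).1 - (z' j).1| <= 3 * d / 16) &&
  (`|(z' i).2 - (z' j).2| <= 3 * d / 16).
have zclose i j : near_point (d / 16) (z i) (z j) -> close i j.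
  move=> [n1 n2]; have [a1 a2] := hz i; have [b1 b2] := hz j.
  apply/andP; split.
    have := ler_distD (z i).1 (z' i).1 (z' j).1; have := ler_distD (z j).1 (z i).1 (z' j).1.
    rewrite (distrC (z j).1 (z' j).1); lra.
  have := ler_distD (z i).2 (z' i).2 (z' j).2; have := ler_distD (z j).2 (z i).2 (z' j).2.
  rewrite (distrC (z j).2 (z' j).2); lra.
have zfar i j : {in supp i.1, forall x, x \notin supp j.1} ->
    (2 * (3 * d / 16) < `|(z' i).1 - (z' j).1|) ||
    (2 * (3 * d / 16) < `|(z' i).2 - (z' j).2|).
  move=> dis; apply: contraT; rewrite negb_or -!leNgt => /andP[n1 n2].
  exfalso.
  apply: (hd (i.1, j.1) dis (par i.2) (par j.2)) => //.
  have [a1 a2] := hz i; have [b1 b2] := hz j; rewrite /= -/(z i) -/(z j); split.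
    have := ler_distD (z' i).1 (z i).1 (z j).1; have := ler_distD (z' j).1 (z' i).1 (z j).1.
    rewrite (distrC (z i).1 (z' i).1); lra.
  have := ler_distD (z' i).2 (z i).2 (z j).2; have := ler_distD (z' j).2 (z' i).2 (z j).2.
  rewrite (distrC (z i).2 (z' i).2); lra.
pose node v : I := (inl v, ord0).
pose along u v : seq I := [seq (inr (u, v), k) | k <- enum 'I_N.+2].
pose fix poly u (q : seq V) : seq I :=
  if q is v :: q' then along u v ++ node v :: poly v q' else [::].
have poly_last u q : last (node u) (poly u q) = node (last u q).
  by elim: q u => //= v q IH u; rewrite last_cat /= IH.
have alongE u v : along u v = (inr (u, v), ord0) ::
    [seq (inr (u, v), lift ord0 k) | k <- enum 'I_N.+1].
  by rewrite /along enum_ordSl /= -map_comp.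
have close_along u v : e u v -> path close (node u) (along u v ++ [:: node v]).
  move=> uv; rewrite alongE /= cat_path /=.
  have ze k : z (inr (u, v), k) = arc u v (par k) by rewrite /z /= uv.
  have par0 : par ord0 = 0 by rewrite /par mul0r.
  have par1 : par ord_max = 1 by rewrite /par divff // pnatr_eq0.
  have near_refl (q : R * R) : near_point (d / 16) q q.
    by rewrite /near_point !subrr normr0; split; lra.
  apply/and3P; split.
  - apply: zclose; rewrite ze par0 (arc_source draw) //; exact: (near_refl (pt u)).
  - apply/(pathP (inr (u, v), ord0)) => i; rewrite size_map size_enum_ord => iN.
    have e1 : nth (inr (u, v), ord0) [seq (inr (u, v), lift ord0 k) | k <- enum 'I_N.+1] i
      = (inr (u, v), inord i.+1) :> I.
      rewrite (nth_map ord0) ?size_enum_ord //; congr pair; apply: val_inj.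
      by rewrite /= nth_enum_ord // inordK.
    have e0 : nth (inr (u, v), ord0) ((inr (u, v), ord0) ::
        [seq (inr (u, v), lift ord0 k) | k <- enum 'I_N.+1]) i
      = (inr (u, v), inord i) :> I.
      case: i iN {e1} => [|i] iN; first by congr pair; apply: val_inj; rewrite /= inordK.
      have iN' : (i < N.+1)%N by apply: ltnW.
      rewrite /= (nth_map ord0) ?size_enum_ord //; congr pair; apply: val_inj.
      by rewrite /= nth_enum_ord // inordK // ltnS ltnW.
    rewrite e1 e0; apply: zclose; apply: (hh (inr (u, v))) => //=.
    rewrite /par !inordK //; last by rewrite ltnS ltnW.
    rewrite -mulrBl -natr1 opprD addrA subrr add0r normrM normrN normr1 mul1r.
    by rewrite ger0_norm // invr_ge0 ler0n.
  - rewrite andbT; set w := last _ _.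
    have -> : w = (inr (u, v), ord_max) :> I.
      rewrite /w -nth_last size_map size_enum_ord /= (nth_map ord0) ?size_enum_ord //.
      by congr pair; apply: val_inj; rewrite /= nth_enum_ord.
    by apply: zclose; rewrite ze par1 (arc_target draw) //; exact: (near_refl (pt v)).
have close_poly u q : path e u q -> path close (node u) (poly u q).
  elim: q u => //= v q IH u /andP[uv vq].
  have := close_along u v uv; rewrite !cat_path /= andbT => /andP[-> ->] /=.
  exact: IH.
have poly_supp u q i : i \in node u :: poly u q -> exists2 x, x \in supp i.1 & true.
  by move=> _; case: i => -[x|[x y]] k; exists x; rewrite // inE eqxx.
have poly_sub u q i : i \in node u :: poly u q -> {subset supp i.1 <= u :: q}.
  elim: q u => [|v q IH] u; first by rewrite inE => /eqP-> x.
  rewrite inE => /orP[/eqP-> x|]; first by rewrite !inE => /eqP->; rewrite eqxx.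
  rewrite mem_cat => /orP[/mapP[k _ ->] x|/IH sv x /sv].
    by rewrite /= !inE => /orP[]->; rewrite ?orbT.
  by rewrite [in X in _ -> X]inE => ->; rewrite orbT.
have sub i j x : (i < j < 5)%N -> x \in r i :: p i j -> x \in (B i :|: B j)%SET.
  move=> ij; have [_ _ sp] := pP _ _ ij; rewrite inE => /orP[/eqP->|/sp //].
  by rewrite inE rB //; case/andP: ij => a b; exact: ltn_trans a b.
have disj i j k l : (i < j < 5)%N -> (k < l < 5)%N -> uniq [:: i; j; k; l] ->
    forall x y, x \in node (r i) :: poly (r i) (p i j) -> y \in node (r k) :: poly (r k) (p k l) ->
    {in supp x.1, forall v, v \notin supp y.1}.
  move=> ij kl u x y /poly_sub sx /poly_sub sy v /sx/(sub _ _ _ ij) v1.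
  apply/negP => /sy/(sub _ _ _ kl) v2.
  have [i5 j5] : (i < 5)%N /\ (j < 5)%N.
    by case/andP: ij => a b; split=> //; exact: ltn_trans a b.
  have [k5 l5] : (k < 5)%N /\ (l < 5)%N.
    by case/andP: kl => a b; split=> //; exact: ltn_trans a b.
  have contra a b : (a < 5)%N -> (b < 5)%N -> a != b -> v \in B a -> v \in B b -> False.
    by move=> a5 b5 ab va; rewrite (disjointFr (Bdis' a b a5 b5 ab) va).
  move: u; rewrite /= !inE !negb_or => /and4P[/and3P[_ ik il] /andP[jk jl] _ _].
  move: v1 v2; rewrite !inE => /orP[va|va] /orP[vb|vb];
  by [apply: contra ik va vb|apply: contra il va vb|apply: contra jk va vb|apply: contra jl va vb].
have [||i j ij|i j k l ij kl u|] := @K5_crossing I (orientation z') _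
    (fun i => node (r i)) (fun i j => poly (r i) (p i j)).
- exact: generic_chirotope.
- rewrite map_inj_in_uniq // => i j; rewrite !mem_iota !add0n /= => i5 j5 [] rij.
  apply/eqP; apply: contraT => nij; have := disjointFr (Bdis' i j i5 j5 nij) (rB i i5).
  by rewrite rij rB.
- by rewrite poly_last; have [_ -> _] := pP _ _ ij.
- move=> x xp; apply/negP => xq.
  have [v vx _] := poly_supp _ _ _ xp.
  by have := disj _ _ _ _ ij kl u x x xp xq v vx; rewrite vx.
move=> i [j [k [l [ij kl u]]]].
rewrite (cross_paths_far gen (d := 3 * d / 16)) //.
- by apply: close_poly; have [] := pP _ _ ij.
- by apply: close_poly; have [] := pP _ _ kl.
move=> x y xp yq; have dxy := disj _ _ _ _ ij kl u x y xp yq.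
rewrite zfar //=; apply/eqP => xy.
have [v vx _] := poly_supp _ _ _ xp.
by have := dxy v vx; rewrite -xy vx.
Qed.
End PlanarK5.

(** If all vertices of [U] had at least 16 neighbours in [U], the singletons would form a family of
    average degree at least [2 ^ 4]. Then [dense_minor] gives five branch sets, and paths through
    them form a drawing of [K_5]. *)
Lemma planar_degenerate (R : realType) (V : finType) (e : rel V) :
  symmetric e -> irreflexive e -> planar R e -> degenerate 15 e.
Proof.
move=> esym eirr [pt [arc draw]] U U0.
have [/existsP[u /andP[uU low]]|high] :=
  boolP [exists u in U, #|[set v in U | e u v]%SET| <= 15]; first by exists u.
exfalso; move: high; rewrite negb_exists => /forallP high.
pose F := [set [set u] | u in U]%SET.
have Finj : {in U &, injective (fun u : V => [set u]%SET)}.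
  by move=> u v _ _; exact: finset.set1_inj.
have bF : branch_family e F.
  split=> [A /imsetP[u _ ->]|A /imsetP[u _ ->] x y|A B /imsetP[u _ ->] /imsetP[v _ ->] uv].
  - by apply/finset.set0Pn; exists u; rewrite inE.
  - by rewrite !inE => /eqP-> /eqP->; exists [::]; split.
  - rewrite finset.disjoints_subset finset.sub1set !inE; apply: contra uv => /eqP-> //.
have [||L sL [h1 _ h3]] := dense_minor esym (t := 4) bF.
- have [u uU] := finset.set0Pn _ U0; apply/finset.set0Pn; exists [set u]%SET.
  exact: imset_f.
- rewrite /family_edges big_imset //= card_in_imset // mulnC -sum_nat_const.
  apply: leq_sum => u uU; have := high u; rewrite uU /= -ltnNge => h; apply: leq_trans h _.
  have -> : (F :\ [set u] = [set [set v] | v in U :\ u])%SET.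
    apply/finset.setP => A; rewrite !inE; apply/andP/imsetP => [[nA /imsetP[v vU eA]]|[v]].
      by exists v => //; rewrite !inE vU andbT; apply: contra nA => /eqP <-; rewrite eA.
    rewrite !inE => /andP[nv vU] ->; split; last exact: imset_f.
    by apply: contra nv => /eqP/finset.set1_inj->.
  rewrite /family_degree big_imset /=; last by move=> v w _ _; exact: finset.set1_inj.
  rewrite -sum1_card big_mkcond [leqRHS]big_mkcond /=; apply: leq_sum => v _.
  rewrite !inE; case: (eqVneq v u) => [->|nvu]; first by rewrite eirr andbF.
  case: (v \in U) => //=; case uv: (e u v) => //; rewrite lt0b.
  by apply/adjacent_setsP; exists u, v; rewrite !inE !eqxx.
pose B i := nth finset.set0 L i.
have LB i : i < 5 -> B i \in L by move=> i5; rewrite mem_nth // sL.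
have rex i : exists r, i < 5 -> r \in B i.
  case: (ltnP i 5) => [i5|_]; last by have [u _] := finset.set0Pn _ U0; exists u.
  have [_ [A /imsetP[u uU ->]]] := h1 _ (LB i i5).
  by rewrite finset.sub1set => uB; exists u.
have [r rB] := boolp.choice rex.
have BB i j : i < j < 5 -> [disjoint B i & B j] /\ adjacent_sets e (B i) (B j).
  move=> /andP[ij j5]; apply/andP; have /(pairwiseP finset.set0) := h3.
  by apply=> //; rewrite unfold_in sL //; exact: ltn_trans j5.
have pex (ij : nat * nat) : exists p, ij.1 < ij.2 < 5 ->
    [/\ path e (r ij.1) p, last (r ij.1) p = r ij.2 & {subset p <= B ij.1 :|: B ij.2}%SET].
  case: ij => i j /=; case: (boolP (i < j < 5)) => [ij|_]; last by exists [::].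
  have [_ /adjacent_setsP[a [b [aB bB ab]]]] := BB i j ij.
  have /andP[lij j5] := ij; have i5 := ltn_trans lij j5.
  have [cBi _] := h1 _ (LB i i5); have [cBj _] := h1 _ (LB j j5).
  have [p [pp lp sp]] := cBi _ _ (rB i i5) aB; have [q [pq lq sq]] := cBj _ _ bB (rB j j5).
  exists (p ++ b :: q) => _; rewrite cat_path pp lp /= ab pq last_cat /= lq; split=> // x.
  by rewrite mem_cat !inE => /or3P[/sp->|/eqP->|/sq->]; rewrite ?bB ?orbT.
have [p pP] := boolp.choice pex.
apply: (drawing_no_K5 draw (B := B) (r := r) (p := fun i j => p (i, j))) => // i j ij.
- by have [] := BB i j ij.
- exact: (pP (i, j) ij).
Qed.

(* MathComp / MathComp-Analysis *)

Theorem theorem3 :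
  exists (P : program) (c d C : nat),
  forall (R : realType) (n : nat) (e : rel 'I_n),
    symmetric e -> irreflexive e -> planar R e ->
    exists (t : nat) (m : memory),
      [/\ runs P (graph_memory e) t m,
          t <= c * n.+1 ^ d
        & forall OPT : nat, is_optimal_length e OPT ->
            completes_gossip e (read_schedule n m) /\
            size (read_schedule n m) <= C * (OPT * trunc_log 2 n ^ 2)].
Proof.
have [P [c [d [C radio]]]] := degenerate_radio_gossip 15.
exists P, c, d, C => R n e esym eirr /(planar_degenerate esym eirr).
exact: radio.
Qed.
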